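(* Let $\psi(t)=\tanh(t)$. Let $x_1,\dots,x_n\sim N(0,I_d)$ and $W_1,\dots,W_p\sim N(0,d^{-1}I_d)$ be independent, $n\le p$, and let $\widetilde X\in\mathbb{R}^{n\times p}$ have entries $\widetilde X_{ij}=\psi(W_j^Tx_i)$. Let $\widehat\theta\in\mathbb{R}^p$ be a (possibly random) vector belonging to the row space of $\widetilde X$, and let $\eta=\widehat\theta+z$, where $z\in\mathbb{R}^p$ is independent of $(\widetilde X,\widehat\theta)$ and its entries are independent with $z_j\sim(1-\epsilon)\delta_0+\epsilon Q_j$, $j=1,\dots,p$, where $\epsilon\in[0,1)$ and $Q_1,\dots,Q_p$ are arbitrary probability distributions on $\mathbb{R}$. Let $\widetilde u\in\operatorname{argmin}_{u\in\mathbb{R}^n}\|\eta-\widetilde X^Tu\|_1$ and $\widetilde\theta=\widetilde X^T\widetilde u$. Assume $$\frac{\sqrt{\frac np}\,\log\left(\frac{ep}{n}\right)}{1-\epsilon},\qquad \frac{n^2}{p},\qquad \frac nd$$ are all sufficiently small. Then $\widetilde\theta=\widehat\theta$ with high probability.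
   Context: $\|\cdot\|_1$ is the $\ell_1$ norm and $\delta_0$ the point mass at $0$. Convention: ''sufficiently small'' and ''with high probability'' mean that for every $\delta\in(0,1)$ there is $c>0$ depending only on $\delta$ such that if the displayed quantities are at most $c$ then the conclusion holds with probability at least $1-\delta$. *)

(* Defs.v *)
From HB Require Import structures.
From mathcomp Require Import all_boot all_order all_algebra.
From mathcomp Require Import all_classical all_reals all_analysis.

Set Implicit Arguments.
Unset Strict Implicit.
Unset Printing Implicit Defensive.

Import Order.TTheory GRing.Theory Num.Theory.
Import numFieldNormedType.Exports.

Local Open Scope classical_set_scope.
Local Open Scope ring_scope.

Definition tanh {R : realType} (t : R) : R :=
  (expR t - expR (- t)) / (expR t + expR (- t)).

Definition l1norm {R : realType} (m : nat) (v : 'cV[R]_m) : R :=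
  \sum_(j < m) `|v j 0|.

Definition argmin {R : realType} (U : Type) (f : U -> R) : set U :=
  [set u | forall v, f u <= f v].

Definition random_matrix {R : realType} (disp : measure_display)
    (T : measurableType disp) (m n : nat) (M : T -> 'M[R]_(m, n)) : Prop :=
  forall i j, measurable_fun setT (fun w => M w i j).

Definition sigma_mx {R : realType} (T : Type) (m n : nat)
    (M : T -> 'M[R]_(m, n)) : set (set T) :=
  <<s \bigcup_(ij in [set: 'I_m * 'I_n])
        preimage_set_system setT (fun w => M w ij.1 ij.2)
          (measurable : set (set R)) >>.

Definition sigma_join (T : Type) (F G : set (set T)) : set (set T) :=
  <<s F `|` G >>.

Definition sigma_rv {R : realType} (T : Type) (X : T -> R) : set (set T) :=
  preimage_set_system setT X (measurable : set (set R)).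

(* Mutual independence: the product rule over every subfamily. *)
Definition mutually_independent {R : realType} (disp : measure_display)
    (T : measurableType disp) (P : probability T R) (I : finType)
    (F : I -> set (set T)) : Prop :=
  forall (J : {set I}) (E : I -> set T),
    (forall i, i \in J -> F i (E i)) ->
    P (\big[setI/setT]_(i in J) E i) = (\prod_(i in J) P (E i))%E.

Definition independent2 {R : realType} (disp : measure_display)
    (T : measurableType disp) (P : probability T R)
    (F G : set (set T)) : Prop :=
  forall A B, F A -> G B -> P (A `&` B) = (P A * P B)%E.

Definition has_law {R : realType} (disp : measure_display)
    (T : measurableType disp) (P : probability T R)
    (X : T -> R) (mu : set R -> \bar R) : Prop :=
  measurable_fun setT X /\
  forall A, measurable A -> P (X @^-1` A) = mu A.

(* v ~ N(0, s2 I_m). The second parameter of normal_prob is the standard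
   deviation. *)
Definition isotropic_gaussian {R : realType} (disp : measure_display)
    (T : measurableType disp) (P : probability T R) (m : nat) (s2 : R)
    (v : T -> 'cV[R]_m) : Prop :=
  (forall k, has_law P (fun w => v w k 0) (normal_prob 0 (Num.sqrt s2))) /\
  mutually_independent P (fun k : 'I_m => sigma_rv (fun w => v w k 0)).

(* (1 - eps) delta_0 + eps Q *)
Definition contamination {R : realType} (eps : R)
    (Q : probability R R) (A : set R) : \bar R :=
  ((1 - eps)%:E * \d_(0%R : R) A + eps%:E * Q A)%E.

Definition feature_matrix {R : realType} (T : Type) (n p d : nat)
    (psi : R -> R) (x : 'I_n -> T -> 'cV[R]_d) (W : 'I_p -> T -> 'cV[R]_d)
    (w : T) : 'M[R]_(n, p) :=
  \matrix_(i < n, j < p) psi (((W j w)^T *m x i w) 0 0).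

(* E has probability at least r. For a measurable E this is r <= P E; the
   measurable subset A only avoids assuming that E is measurable. *)
Definition prob_at_least {R : realType} (disp : measure_display)
    (T : measurableType disp) (P : probability T R) (r : R)
    (E : set T) : Prop :=
  exists A, [/\ measurable A, A `<=` E & (r%:E <= P A)%E].

(* Main.v *)
(* If v = utilde - u0 with thetahat = X^T u0, minimality reads
   |z - X^T v|_1 <= |z|_1, hence the l1 mass of X^T v on the zeros of z is at
   most <v, S> where S = X sgn(z). So v = 0 as soon as, for every unit v, that
   mass exceeds |S|_2.

   Conditionally on the rows x_i, the features tanh(W_j . x_i) are independent
   over j and odd in W_j, so E |S|_2^2 = O(n p). For the lower bound, translate
   W_j by b with x_i . b = v_i: this makes sum_i v_i tanh(W_j . x_i) grow by a
   constant, and costs only a bounded density (Cameron-Martin) because the Gram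
   matrix of the x_i is well conditioned when n/d is small. Thus
   E exp(- |sum_i v_i X_ij|) <= 1 - rate2, and a union bound over a grid of
   (C n)^n points, against the at least (1 - eps) p / 4 zeros of z, gives a mass
   of order (1 - eps) p. The hypotheses say that this dominates both
   n log(e n) and sqrt(n p).

   All probabilistic estimates are bounds on expectations of nonnegative
   functionals; they are added up and Markov's inequality is applied once. *)

Require Import Defs.
From HB Require Import structures.
From mathcomp Require Import all_boot all_order all_algebra.
From mathcomp Require Import all_classical all_reals all_analysis.
From mathcomp Require Import measurable_realfun gauss_integral.
From mathcomp Require Import ring lra.

Set Implicit Arguments.
Unset Strict Implicit.
Unset Printing Implicit Defensive.

Import Order.TTheory GRing.Theory Num.Theory.
Import numFieldNormedType.Exports.

Local Open Scope classical_set_scope.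
Local Open Scope ring_scope.

(** * The one-dimensional Gaussian law *)

(** The noise is independent of the feature matrix [X], but its independence from the rows [x_i] is
    not part of the model. So the certificate of recovery may depend on [z] and [X] only, and the
    quality of the Gram matrix, a property of the rows, cannot be one of its terms. It enters inside
    the expectation for frozen noise: the certificate is truncated at 1, and on a bad design
    [design_defect] is already at least 1, so adding the defect pays for the bad rows.

    Conditioning is done by Tonelli: one of two independent variables is frozen at [w], the other is
    integrated over a second copy [w'] of the sample space. The functionals are mostly exponentials
    because these factor over independent coordinates.

    Two nets occur. For the Gaussian design, [|M^T v|_1] is a seminorm with an upper bound of the
    right order, so rounding errors need only be small in Euclidean norm: mesh [1/sqrt n] and
    [exp(O(n))] points suffice, and [n/d] small is enough without a logarithm. The finer grid, of
    mesh [1/n], is used for the features only. *)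

Section lebesgue_invariance.
Context {R : realType}.
Local Notation mu := lebesgue_measure.

Lemma lebesgue_measure_translation (b : R) (A : set R) : measurable A ->
  pushforward mu ((fun t => t + b) : _ -> measurableTypeR R) A = mu A.
Proof.
move=> mA; apply/esym/lebesgue_measure_unique => //=.
  by move=> ?; apply: measurable_funD.
move=> ? _ [[a c]] _ <-.
rewrite /pushforward.
rewrite (_ : _ @^-1` _ = `](a - b), (c - b)]%classic).
  rewrite /= !lebesgue_measure_itv/= !lte_fin ltrD2r.
  by case: ifP => // _; rewrite -!EFinB opprB addrA subrK.
apply/seteqP; split=> x /=; rewrite !in_itv/=; rewrite ltrBlDr lerBrDr//.
Qed.

Lemma ge0_integral_translation (b : R) (f : R -> \bar R) :
  measurable_fun [set: R] f -> (forall r, 0 <= f r)%E ->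
  (\int[mu]_r f (r + b)%R = \int[mu]_r f r)%E.
Proof.
move=> mf f0; have mb : measurable_fun setT ((fun t => t + b) : _ -> measurableTypeR R).
  by apply: measurable_funD.
transitivity (\int[pushforward mu ((fun t => (t + b)%R) : _ -> measurableTypeR R)]_r f r)%E.
  by rewrite ge0_integral_pushforward.
by apply: eq_measure_integral => //= A mA AS; exact/lebesgue_measure_translation.
Qed.

Lemma ge0_integral_oppr (f : R -> \bar R) :
  measurable_fun [set: R] f -> (forall r, 0 <= f r)%E ->
  (\int[mu]_r f (- r)%R = \int[mu]_r f r)%E.
Proof.
move=> mf f0.
transitivity (\int[pushforward mu (-%R : _ -> measurableTypeR R)]_r f r)%E.
  by rewrite ge0_integral_pushforward.
by apply: eq_measure_integral => //= A mA AS; exact/lebesgue_measureN.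
Qed.

End lebesgue_invariance.

Section normal_law.
Context {R : realType}.
Local Notation mu := lebesgue_measure.

(** The Radon-Nikodym derivative of [normal_prob] transfers integrals of functions, and it equals
    [normal_pdf] almost everywhere because both have the same integral over every measurable set. *)
Lemma ge0_integral_normal (s : R) (f : R -> \bar R) : 
  measurable_fun [set: R] f -> (forall r, 0 <= f r)%E ->
  (\int[normal_prob 0 s]_t f t = \int[mu]_t (f t * (normal_pdf 0 s t)%:E))%E.
Proof.
move=> mf f0; have dom := normal_prob_dominates 0 s.
rewrite -(Radon_Nikodym_SigmaFinite.change_of_variables dom) //.
apply: ge0_ae_eq_integral => //.
- apply: emeasurable_funM => //.
  exact: measurable_int (Radon_Nikodym_SigmaFinite.f_integrable dom).
- by apply: emeasurable_funM => //; apply/measurable_EFinP; exact: measurable_normal_pdf.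
- by move=> x _; rewrite mule_ge0// Radon_Nikodym_SigmaFinite.f_ge0.
- by move=> x _; rewrite mule_ge0// lee_fin normal_pdf_ge0.
apply: ae_eqe_mul2l => /=.
apply: integral_ae_eq => //=.
- exact: Radon_Nikodym_SigmaFinite.f_integrable.
- by apply/measurable_EFinP; exact: measurable_normal_pdf.
- by move=> E _ mE; rewrite -Radon_Nikodym_SigmaFinite.f_integral.
Qed.

Context d (T : measurableType d) (P : probability T R) (X : T -> R) (s : R).
Hypotheses (s0 : 0 < s) (XN : has_law P X (normal_prob 0 s)).

Lemma ge0_expectation_normal (f : R -> \bar R) :
  measurable_fun [set: R] f -> (forall r, 0 <= f r)%E ->
  (\int[P]_w f (X w) = \int[mu]_t (f t * (normal_pdf 0 s t)%:E))%E.
Proof.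
case: XN => mX XE mf f0; rewrite -ge0_integral_normal//.
transitivity (\int[pushforward P (X : _ -> measurableTypeR R)]_r f r)%E.
  by rewrite ge0_integral_pushforward.
apply: eq_measure_integral => //= A mA AS. exact: XE.
Qed.

Lemma expectation_normal_opp (f : R -> \bar R) :
  measurable_fun [set: R] f -> (forall r, 0 <= f r)%E ->
  (\int[P]_w f (- X w)%R = \int[P]_w f (X w))%E.
Proof.
move=> mf f0; have mfN : measurable_fun setT (fun t : R => f (- t)).
  by apply: measurableT_comp.
rewrite (@ge0_expectation_normal (fun t : R => f (- t)))// ge0_expectation_normal//.
rewrite -ge0_integral_oppr.
- by apply: eq_integral => t _; rewrite opprK normal_pdfE ?gt_eqF// /normal_fun !subr0 sqrrN.
- by apply: emeasurable_funM => //; apply/measurable_EFinP; exact: measurable_normal_pdf.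
- by move=> x; rewrite mule_ge0// lee_fin normal_pdf_ge0.
Qed.

(** Cameron-Martin in dimension one: the exponential is the density ratio of [N(b, s^2)] to
    [N(0, s^2)]. *)
Lemma expectation_normal_shift (b : R) (f : R -> \bar R) :
  measurable_fun [set: R] f -> (forall r, 0 <= f r)%E ->
  (\int[P]_w f (X w + b)%R =
   \int[P]_w (f (X w) * (expR (X w * b / s ^+ 2 - b ^+ 2 / (s ^+ 2 *+ 2)))%:E))%E.
Proof.
move=> mf f0.
have mfb : measurable_fun setT (fun t : R => f (t + b)).
  by apply: measurableT_comp => //; exact: measurable_funD.
have mg : measurable_fun setT (fun t : R => f t * (expR (t * b / s ^+ 2 - b ^+ 2 / (s ^+ 2 *+ 2)))%:E)%E.
  apply: emeasurable_funM => //; apply/measurable_EFinP.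
  apply: measurableT_comp => //; apply: measurable_funB => //.
  by do 2 apply: measurable_funM => //.
rewrite (@ge0_expectation_normal (fun t : R => f (t + b)))//.
rewrite (@ge0_expectation_normal (fun t : R => f t * (expR (t * b / s ^+ 2 - b ^+ 2 / (s ^+ 2 *+ 2)))%:E)%E) //; last first.
  by move=> t; rewrite mule_ge0// lee_fin expR_ge0.
rewrite -[RHS](ge0_integral_translation b).
- apply: eq_integral => t _; rewrite -muleA -EFinM; congr (_ * _%:E)%E.
  rewrite normal_pdfE ?gt_eqF// mulrCA -expRD; congr (_ * expR _).
  rewrite !subr0; field; exact: lt0r_neq0.
- apply: emeasurable_funM => //; apply/measurable_EFinP; exact: measurable_normal_pdf.
- by move=> x; rewrite mule_ge0// ?mule_ge0// lee_fin ?normal_pdf_ge0 ?expR_ge0.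
Qed.
End normal_law.

(** Multiplying the standard density by [exp(t^2/4)] halves its exponent, which gives [sqrt 2] times
    the centred density of variance 2. *)
Lemma expectation_normal_expR_sqr (R : realType) d (T : measurableType d)
    (P : probability T R) (X : T -> R) : has_law P X (normal_prob 0 1) ->
  (\int[P]_w (expR (X w ^+ 2 / 4))%:E = (Num.sqrt 2)%:E)%E.
Proof.
move=> XN; rewrite (ge0_expectation_normal XN (f := fun t : R => (expR (t ^+ 2 / 4))%:E)).
- rewrite -[RHS]mule1 -(integral_normal_pdf 0 (Num.sqrt 2 : R)) -[RHS]ge0_integralZl; [rewrite /=|try by []..].
  + apply: eq_integral => t _; rewrite -!EFinM; congr _%:E.
    have s20 : (0:R) < Num.sqrt 2 by rewrite sqrtr_gt0.
    rewrite !normal_pdfE ?gt_eqF// mulrCA -expRD mulrA.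
    congr (_ * expR _).
      rewrite /normal_peak expr1n mul1r sqr_sqrtr// -mulrnAr sqrtrM//.
      by rewrite invfM mulrA divff ?mul1r// gt_eqF.
    by rewrite sqr_sqrtr// !subr0; field.
  + by apply/measurable_EFinP; exact: measurable_normal_pdf.
  + by move=> t _; rewrite lee_fin normal_pdf_ge0.
- apply/measurable_EFinP; apply: measurableT_comp => //; apply: measurable_funM => //.
- by move=> r; rewrite lee_fin expR_ge0.
Qed.

(** * Grouping of independent families *)

Section grouping.
Context {R : realType} d (T : measurableType d) (P : probability T R).

(** Uniqueness of measures on a pi-system: the restriction of [P] to [B] and the multiple of [P] by
    [P B] are finite measures that agree on [C]. *)
Lemma independent_generated (C : set (set T)) (B : set T) :
  C `<=` measurable -> setI_closed C -> C setT -> measurable B ->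
  (forall A, C A -> P (A `&` B) = P A * P B)%E ->
  forall A, <<s C >> A -> P (A `&` B) = (P A * P B)%E.
Proof.
move=> Cm CI CT mB CE A sA.
have r0 : 0 <= fine (P B) by rewrite fine_ge0.
have PBE : P B = (fine (P B))%:E by rewrite fineK// fin_num_measure.
have -> : (P A * P B = mscale (NngNum r0) P A)%E by rewrite /mscale/= -PBE muleC.
apply: (g_sigma_algebra_measure_unique C Cm (fun _ => setT) (fun _ => CT) _ (mrestr P mB)) => //.
- by rewrite -subTset => x _; exists 0%N.
- by move=> E CE'; rewrite /= /mrestr/= CE// /mscale/= -PBE muleC.
- by move=> _; rewrite /= /mrestr/= (le_lt_trans (probability_le1 _ _)) ?ltry//; apply: measurableI.
Qed.

Context (I K : finType) (pi : I -> K) (F : I -> set (set T)).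

Definition group_sigma (k : K) : set (set T) :=
  <<s \bigcup_(i in [set i | pi i = k]) F i >>.

Hypotheses (Fm : forall i, F i `<=` measurable) (FI : forall i, setI_closed (F i))
  (FT : forall i, F i setT) (Find : mutually_independent P F).

(** Intersections within one class form a pi-system, and the sigma-algebra it generates contains
    [group_sigma k]. *)
Let C (k : K) : set (set T) :=
  [set A | exists2 E : I -> set T, (forall i, F i (E i)) &
     A = \big[setI/setT]_(i | pi i == k) E i].

Let Cm k : C k `<=` measurable.
Proof.
move=> _ [E FE ->]; apply: bigsetI_measurable => i _.
exact: Fm.
Qed.

Let CI k : setI_closed (C k).
Proof.
move=> _ _ [E1 FE1 ->] [E2 FE2 ->]; exists (fun i => E1 i `&` E2 i).
  by move=> i; exact: FI.
by rewrite big_split.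
Qed.

Let CT k : C k setT.
Proof. by exists (fun=> setT) => //; rewrite big1. Qed.

Let FC i : F i `<=` C (pi i).
Proof.
move=> A FA; exists (fun j => if j == i then A else setT).
  by move=> j; case: eqP => [->|].
by rewrite (bigD1 i)//= eqxx big1 ?setIT// => j /andP[_ /negbTE ->].
Qed.

Let sub_group k : group_sigma k `<=` <<s C k >>.
Proof.
apply: smallest_sub; first exact: smallest_sigma_algebra.
by move=> A [i <- FA]; apply: sub_sigma_algebra; exact: FC.
Qed.

Let base (J : {set K}) (E : K -> set T) : (forall k, k \in J -> C k (E k)) ->
  P (\big[setI/setT]_(k in J) E k) = (\prod_(k in J) P (E k))%E.
Proof.
move=> CE.
have /choice[e He] k : exists e : I -> set T, (forall i, F i (e i)) /\
    (k \in J -> E k = \big[setI/setT]_(i | pi i == k) e i).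
  have [kJ|kJ] := boolP (k \in J).
    by have [e ? ?] := CE k kJ; exists e.
  by exists (fun=> setT); split => // i; exact: FT.
pose e' i := e (pi i) i.
have E' k : k \in J -> E k = \big[setI/setT]_(i in [set i | pi i == k]%SET) e' i.
  move=> kJ; rewrite (He k).2//; apply: eq_big => i; first by rewrite inE.
  by move=> /eqP ik; rewrite /e' ik.
have Fe' i : F i (e' i) by exact: (He _).1.
transitivity (P (\big[setI/setT]_(i in [set i | pi i \in J]%SET) e' i)).
  congr (P _); rewrite [RHS](partition_big pi (mem J))/=; last by move=> i; rewrite inE.
  apply: eq_bigr => k kJ; rewrite E'//; apply: eq_bigl => i.
  by rewrite !inE; case: eqP => [->|]; rewrite ?kJ ?andbF.
rewrite Find// (partition_big pi (mem J))/=; last by move=> i; rewrite inE.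
apply: eq_bigr => k kJ; rewrite E'// Find//; apply: eq_bigl => i.
by rewrite !inE; case: eqP => [->|]; rewrite ?kJ ?andbF.
Qed.

Lemma grouping : mutually_independent P group_sigma.
Proof.
move=> J E JE.
(* The classes in [s] have already been enlarged from the pi-system [C k] to the sigma-algebra it
   generates; each induction step enlarges one more by [independent_generated]. *)
suff main (s : seq K) (J' : {set K}) (E' : K -> set T) :
    (forall k, k \in J' -> if k \in s then <<s C k >> (E' k) else C k (E' k)) ->
    P (\big[setI/setT]_(k in J') E' k) = (\prod_(k in J') P (E' k))%E.
  apply: (main (enum K)) => k kJ; rewrite (_ : k \in enum K = true); last by rewrite mem_enum.
  by apply: sub_group; exact: JE.
elim: s J' E' => [|k0 s IH] J' E' HE.
  by apply: base => k kJ; have := HE k kJ.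
have [k0s|k0s] := boolP (k0 \in s).
  apply: IH => k kJ; have := HE k kJ; rewrite in_cons.
  by case: eqP => //= ->; rewrite k0s.
have [k0J|k0J] := boolP (k0 \in J'); last first.
  apply: IH => k kJ; have := HE k kJ; rewrite in_cons.
  by case: eqP => //= kk0; move: k0J; rewrite -kk0 kJ.
have mC k : <<s C k >> `<=` measurable.
  by apply: smallest_sub; [exact: sigma_algebra_measurable|exact: Cm].
pose J0 := J' :\ k0.
have HJ0 k : k \in J0 -> if k \in s then <<s C k >> (E' k) else C k (E' k).
  rewrite !inE => /andP[kk0 kJ]; have := HE k kJ.
  by rewrite in_cons (negbTE kk0).
rewrite (big_setD1 k0)//= [RHS](big_setD1 k0)//= -(IH J0)//.
apply: (independent_generated (C := C k0)) => //.
- apply: bigsetI_measurable => k kJ.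
  by have := HJ0 k kJ; case: ifP => _; [exact: mC|exact: Cm].
- move=> A CA; rewrite (IH J0)//.
  pose E1 k := if k == k0 then A else E' k.
  have E1E k : k \in J0 -> E1 k = E' k by rewrite !inE /E1 => /andP[/negbTE ->].
  have E10 : E1 k0 = A by rewrite /E1 eqxx.
  have := IH J' E1.
  have -> : (\prod_(k in J') P (E1 k) = P (E1 k0) * \prod_(k in J0) P (E1 k))%E by rewrite (big_setD1 k0).
  rewrite (big_setD1 k0 k0J)/= E10 (eq_bigr _ E1E).
  rewrite (eq_bigr (fun k => P (E' k))) => [|k kJ]; last by rewrite E1E.
  apply=> k kJ; have [->|kk0] := eqVneq k k0; first by rewrite (negbTE k0s) E10.
  have kJ0 : k \in J0 by rewrite !inE kk0.
  by rewrite E1E//; exact: HJ0.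
- by have := HE k0 k0J; rewrite in_cons eqxx.
Qed.

End grouping.

Lemma measurable_prod_in {R : realType} d (T : measurableType d) (I : finType)
    (J : {set I}) (h : I -> T -> R) :
  (forall i, i \in J -> measurable_fun setT (h i)) ->
  measurable_fun setT (fun x => \prod_(i in J) h i x).
Proof.
move=> mh; rewrite (_ : (fun _ => _) = fun x => \prod_(i <- enum J) h i x).
  by apply: measurable_prod => i; rewrite mem_enum; exact: mh.
by apply/funext => x; rewrite big_enum.
Qed.

(** * Tonelli's theorem and product formulas for independent variables *)

Section independent_integral.
Context {R : realType} d (T : measurableType d) (P : probability T R).

(** Independence makes the joint law the product of the marginals, so Tonelli applies. The inner
    integral runs over the same space with [A w] frozen, which takes the place of a conditional
    expectation. *)
Lemma ge0_integral_independent d1 d2 (S1 : measurableType d1) (S2 : measurableType d2)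
    (A : T -> S1) (B : T -> S2) (H : S1 * S2 -> \bar R) :
  measurable_fun setT A -> measurable_fun setT B ->
  (forall E1 E2, measurable E1 -> measurable E2 ->
    P (A @^-1` E1 `&` B @^-1` E2) = P (A @^-1` E1) * P (B @^-1` E2))%E ->
  measurable_fun setT H -> (forall s, 0 <= H s)%E ->
  (\int[P]_w H (A w, B w) = \int[P]_w \int[P]_w' H (A w, B w'))%E.
Proof.
move=> mA mB ind mH H0.
pose Am : {mfun T >-> S1} := HB.pack A (isMeasurableFun.Build _ _ _ _ _ mA).
pose Bm : {mfun T >-> S2} := HB.pack B (isMeasurableFun.Build _ _ _ _ _ mB).
have mAB : measurable_fun setT (fun w => (A w, B w)) by exact: measurable_fun_pair.
pose ABm : {mfun T >-> (S1 * S2)%type} := HB.pack (fun w => (A w, B w)) (isMeasurableFun.Build _ _ _ _ _ mAB).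
transitivity (\int[distribution P ABm]_s H s)%E.
  by rewrite /distribution ge0_integral_pushforward.
transitivity (\int[(distribution P Am \x distribution P Bm)%E]_s H s)%E.
  apply: eq_measure_integral => E mE _; symmetry.
  by apply: product_measure_unique => // E1 E2 mE1 mE2; exact: ind.
rewrite (fubini_tonelli1 H)// /fubini_F.
rewrite [LHS]ge0_integral_pushforward//.
- apply: eq_integral => w _ /=; rewrite ge0_integral_pushforward//.
  exact: measurableT_comp mH (measurable_fun_pair _ _).
- exact: measurable_fun_fubini_tonelli_F.
- by move=> y _; apply: integral_ge0.
Qed.

Lemma ge0_integral_independent_le d1 d2 (S1 : measurableType d1) (S2 : measurableType d2)
    (A : T -> S1) (B : T -> S2) (H : S1 * S2 -> \bar R) (g : T -> \bar R) :
  measurable_fun setT A -> measurable_fun setT B ->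
  (forall E1 E2, measurable E1 -> measurable E2 ->
    P (A @^-1` E1 `&` B @^-1` E2) = P (A @^-1` E1) * P (B @^-1` E2))%E ->
  measurable_fun setT H -> (forall s, 0 <= H s)%E ->
  measurable_fun setT g -> 
  (forall w, \int[P]_w' H (A w, B w') <= g w)%E ->
  (\int[P]_w H (A w, B w) <= \int[P]_w g w)%E.
Proof.
move=> mA mB ind mH H0 mg Hg.
rewrite (ge0_integral_independent mA mB ind mH H0).
pose Bm : {mfun T >-> S2} := HB.pack B (isMeasurableFun.Build _ _ _ _ _ mB).
apply: ge0_le_integral => //.
- by move=> w _; apply: integral_ge0.
- have := measurableT_comp (measurable_fun_fubini_tonelli_F (m2 := distribution P Bm) H mH H0) mA.
  apply: eq_measurable_fun => w _ /=; rewrite /fubini_F /= ge0_integral_pushforward//.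
  exact: measurableT_comp mH (measurable_fun_pair _ _).
Qed.

Lemma ge0_integral_prod2 (f g : T -> R) :
  (forall w, 0 <= f w) -> (forall w, 0 <= g w) ->
  measurable_fun setT f -> measurable_fun setT g ->
  (forall E1 E2, measurable E1 -> measurable E2 ->
    P (f @^-1` E1 `&` g @^-1` E2) = P (f @^-1` E1) * P (g @^-1` E2))%E ->
  (\int[P]_w (f w * g w)%:E = \int[P]_w (f w)%:E * \int[P]_w (g w)%:E)%E.
Proof.
move=> f0 g0 mf mg ind.
(* [ge0_integral_independent] asks for [H] nonnegative on the whole plane, hence the absolute
   values. *)
transitivity (\int[P]_w (fun s => (`|s.1| * `|s.2|)%:E) (f w, g w))%E.
  by apply: eq_integral => w _ /=; rewrite !ger0_norm.
have mH : measurable_fun setT (fun s : R * R => (`|s.1| * `|s.2|)%:E).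
  apply/measurable_EFinP; apply: measurable_funM; apply: measurableT_comp => //.
rewrite (ge0_integral_independent (H := fun s : R * R => (`|s.1| * `|s.2|)%:E))//=.
under eq_integral => w _.
  under eq_integral => w' _ do rewrite EFinM (ger0_norm (g0 w')).
  rewrite ge0_integralZl//; last 2 first.
  - exact/measurable_EFinP.
  - by move=> ? _; rewrite lee_fin.
  rewrite ger0_norm//. over.
rewrite ge0_integralZr//.
- exact/measurable_EFinP.
- by move=> ? _; rewrite lee_fin.
- by apply: integral_ge0 => ? _; rewrite lee_fin.
Qed.

Context (I : finType) (F : I -> set (set T)).
Hypotheses (Fm : forall i, F i `<=` measurable) (FI : forall i, setI_closed (F i))
  (FT : forall i, F i setT) (Find : mutually_independent P F).

Lemma independent_blocks (a : I -> bool) (A B : set T) :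
  group_sigma a F true A -> group_sigma a F false B ->
  P (A `&` B) = (P A * P B)%E.
Proof.
move=> FA FB.
have := grouping (pi := a) Fm FI FT Find (J := [set: bool]%SET) (E := fun b => if b then A else B).
have -> : (\prod_(b in [set: bool]%SET) P (if b then A else B) = P A * P B)%E.
  by rewrite big_mkcond big_bool !inE.
by rewrite big_mkcond big_bool !inE; apply; case.
Qed.

Lemma ge0_integral_prod (J : {set I}) (f : I -> T -> R) :
  (forall i w, 0 <= f i w) ->
  (forall i E, i \in J -> measurable E -> F i (f i @^-1` E)) ->
  (\int[P]_w (\prod_(i in J) f i w)%:E = \prod_(i in J) \int[P]_w (f i w)%:E)%E.
Proof.
move=> f0.
have [k] := ubnP #|J|; elim: k J => // k IH J; rewrite ltnS => Jk fF.
have [->|[j jJ]] := set_0Vmem J.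
  rewrite !big_set0; under eq_integral do rewrite big_set0.
  by rewrite integral_cst//= mul1e probability_setT.
rewrite (big_setD1 j)//= -IH; last 2 first.
- by rewrite (leq_trans _ Jk)// [X in (_ < X)%N](cardsD1 j) jJ.
- by move=> i E; rewrite !inE => /andP[_]; exact: fF.
under eq_integral => w _ do rewrite (big_setD1 j)//=.
have mf i : i \in J -> measurable_fun setT (f i).
  by move=> iJ _ E mE; rewrite setTI; apply: (Fm (i := i)); exact: fF.
(* The remaining factors are measurable for the sigma-algebra generated by the indices other than
   [j], so their product is independent of factor [j]. *)
pose TF := g_sigma_algebraType (\bigcup_(i in [set i | (i == j) = false]) F i).
have mg : measurable_fun (setT : set TF) (fun w => \prod_(i in J :\ j) f i w).
  apply: measurable_prod_in => i; rewrite !inE => /andP[ij iJ].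
  move=> _ E mE; rewrite setTI; apply: sub_sigma_algebra; exists i; first exact/negbTE.
  exact: fF.
have mg' : measurable_fun setT (fun w => \prod_(i in J :\ j) f i w).
  apply: measurable_prod_in => i; rewrite !inE => /andP[ij iJ].
  exact: mf.
rewrite ge0_integral_prod2//.
- by move=> w; apply: prodr_ge0.
- exact: mf.
move=> E1 E2 mE1 mE2.
apply: (independent_blocks (a := fun i => i == j)).
  apply: sub_sigma_algebra; exists j; rewrite /= ?eqxx//.
  exact: fF.
by rewrite -[X in group_sigma _ _ _ X]setTI; exact: mg.
Qed.

Lemma ge0_integral_prodT (f : I -> T -> R) :
  (forall i w, 0 <= f i w) ->
  (forall i E, measurable E -> F i (f i @^-1` E)) ->
  (\int[P]_w (\prod_i f i w)%:E = \prod_i \int[P]_w (f i w)%:E)%E.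
Proof.
move=> f0 fF.
transitivity (\int[P]_w (\prod_(i in [set: I]%SET) f i w)%:E)%E.
  by apply: eq_integral => w _; congr _%:E; apply: eq_bigl => i; rewrite inE.
rewrite ge0_integral_prod//; first by apply: eq_bigl => i; rewrite inE.
by move=> i E _; exact: fF.
Qed.

End independent_integral.

(** * Isotropic Gaussian vectors *)

(** Generators of the product sigma-algebra: measurability of a map into [mxspace] becomes an
    entrywise matter. *)
Definition mx_cylinders (R : realType) m n : set (set 'M[R]_(m, n)) :=
  \bigcup_(ij in [set: 'I_m * 'I_n])
    preimage_set_system setT (fun M : 'M[R]_(m, n) => M ij.1 ij.2) measurable.

Notation mxspace R m n := (g_sigma_algebraType (@mx_cylinders R m n)).

Section mxspace.
Context {R : realType}.

Lemma measurable_entry m n (i : 'I_m) (j : 'I_n) :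
  measurable_fun setT (fun M : mxspace R m n => M i j).
Proof.
move=> _ E mE; apply: sub_sigma_algebra; exists (i, j) => //.
by exists E.
Qed.

Lemma measurable_mxspace d (T : measurableType d) m n (M : T -> 'M[R]_(m, n)) :
  (forall i j, measurable_fun setT (fun w => M w i j)) ->
  measurable_fun setT (M : T -> mxspace R m n).
Proof.
move=> mM; apply: (@measurability _ _ T (mxspace R m n) setT M (@mx_cylinders R m n)) => // _ [_ [[i j] _ [E mE <-]] <-].
by rewrite !setTI; have := mM i j measurableT E mE; rewrite setTI.
Qed.

(** If the source carries the sigma-algebra generated by the entries of [M], then [M] is measurable
    by construction. *)
Lemma sigma_mx_preimage (T : pointedType) m n (M : T -> 'M[R]_(m, n)) (E : set (mxspace R m n)) :
  measurable E -> sigma_mx M (M @^-1` E).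
Proof.
move=> mE; pose G := \bigcup_(ij in [set: 'I_m * 'I_n])
  preimage_set_system setT (fun w => M w ij.1 ij.2) (measurable : set (set R)).
have mM : measurable_fun setT (M : g_sigma_algebraType G -> mxspace R m n).
  apply: measurable_mxspace => i j _ B mB; apply: sub_sigma_algebra.
  by exists (i, j) => //; exists B.
by have := mM measurableT E mE; rewrite setTI.
Qed.

Lemma sigma_mx_measurable d (T : measurableType d) m n (M : T -> 'M[R]_(m, n)) :
  random_matrix M -> sigma_mx M `<=` measurable.
Proof.
move=> mM; apply: smallest_sub; first exact: sigma_algebra_measurable.
by move=> _ [[i j] _ [E mE <-]]; exact: mM.
Qed.

Lemma sigma_mx_setI (T : pointedType) m n (M : T -> 'M[R]_(m, n)) : setI_closed (sigma_mx M).
Proof.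
move=> A B; rewrite /sigma_mx.
set G := \bigcup_(ij in _) _ => sA sB.
exact: (@measurableI _ (g_sigma_algebraType G)).
Qed.

Lemma sigma_mx_setT (T : pointedType) m n (M : T -> 'M[R]_(m, n)) : sigma_mx M setT.
Proof.
rewrite /sigma_mx; set G := \bigcup_(ij in _) _.
exact: (@measurableT _ (g_sigma_algebraType G)).
Qed.

Lemma sigma_rv_measurable d (T : measurableType d) (X : T -> R) :
  measurable_fun setT X -> sigma_rv X `<=` measurable.
Proof. by move=> mX _ [E mE <-]; exact: mX. Qed.

Lemma sigma_rv_setI (T : Type) (X : T -> R) : setI_closed (sigma_rv X).
Proof.
move=> _ _ [E1 mE1 <-] [E2 mE2 <-]; exists (E1 `&` E2); first exact: measurableI.
by rewrite !setTI.
Qed.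

Lemma sigma_rv_setT (T : Type) (X : T -> R) : sigma_rv X setT.
Proof. by exists setT => //; rewrite setTI. Qed.

Lemma sigma_rv_preimage (T : Type) (X : T -> R) E : measurable E -> sigma_rv X (X @^-1` E).
Proof. by exists E => //; rewrite setTI. Qed.

End mxspace.

Section isotropic.
Context {R : realType} d (T : measurableType d) (P : probability T R).
Context (m : nat) (s2 : R) (v : T -> 'cV[R]_m).
Hypotheses (s20 : 0 < s2) (vG : isotropic_gaussian P s2 v).

Lemma isotropic_random_matrix : random_matrix v.
Proof. by move=> k j; rewrite (ord1 j); have [/(_ k)[]] := vG. Qed.

Let setk (k : 'I_m) (t : R) (y : 'cV[R]_m) : 'cV[R]_m :=
  \col_i (if i == k then t else y i 0).

Let measurable_setk k :
  measurable_fun setT (fun s : mxspace R m 1 * R => setk k s.2 s.1 : mxspace R m 1).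
Proof.
apply: measurable_mxspace => i j; rewrite (ord1 j) /setk.
have [ik|ik] := eqVneq i k.
  by under eq_fun do rewrite mxE ik eqxx; exact: measurable_snd.
under eq_fun do rewrite mxE (negbTE ik).
exact: (measurableT_comp (measurable_entry _ _) measurable_fst).
Qed.

Let coordinate_fubini k (f : mxspace R m 1 -> \bar R) :
  measurable_fun setT f -> (forall y, 0 <= f y)%E ->
  (\int[P]_w f (v w) = \int[P]_w \int[P]_w' f (setk k (v w' k 0)%R (v w)))%E.
Proof.
move=> mf f0; have [vN vI] := vG.
have mv i : measurable_fun setT (fun w => v w i 0) by case: (vN i).
(* Coordinate [k] is overwritten by 0, so that [y0] depends on the other coordinates only and is
   independent of [v w k 0]. *)
pose y0 w : mxspace R m 1 := setk k 0 (v w).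
have Fm i : sigma_rv (fun w => v w i 0) `<=` measurable by exact: sigma_rv_measurable.
have FI i : setI_closed (sigma_rv (fun w => v w i 0)) by exact: sigma_rv_setI.
have FT i : sigma_rv (fun w => v w i 0) setT by exact: sigma_rv_setT.
transitivity (\int[P]_w (fun s : mxspace R m 1 * R => f (setk k s.2 s.1)) (y0 w, (v w k 0)%R))%E.
  apply: eq_integral => w _ /=; congr (f _); apply/matrixP => i j; rewrite (ord1 j) !mxE.
  by case: eqVneq => // ->.
rewrite [LHS](ge0_integral_independent (A := y0) (B := fun w => v w k 0) (H := fun s : mxspace R m 1 * R => f (setk k s.2 s.1))); [rewrite /=|try by []..].
- apply: eq_integral => w _; apply: eq_integral => w' _; congr (f _).
  by apply/matrixP => i j; rewrite !mxE; case: eqVneq.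
- apply: measurable_mxspace => i j; rewrite /y0; under eq_fun do rewrite mxE.
  by case: eqVneq => _; [exact: measurable_cst|exact: mv].
- move=> E1 E2 mE1 mE2; rewrite setIC muleC.
  apply: (independent_blocks Fm FI FT vI (a := fun i => i == k)).
    apply: sub_sigma_algebra; exists k; rewrite /= ?eqxx//.
    exact: sigma_rv_preimage.
  pose G := \bigcup_(i in [set i | (i == k) = false]) sigma_rv (fun w => v w i 0).
  have mM : measurable_fun setT (y0 : g_sigma_algebraType G -> mxspace R m 1).
    apply: measurable_mxspace => i j; rewrite /y0; under eq_fun do rewrite mxE.
    case: eqVneq => ik; first exact: measurable_cst.
    move=> _ B mB; apply: sub_sigma_algebra; exists i; first exact/negbTE.
    by exists B.
  by have := mM measurableT E1 mE1; rewrite setTI.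
- exact: (measurableT_comp mf (measurable_setk k)).
Qed.

Let mset1 k y : measurable_fun setT (fun t : R => setk k t y : mxspace R m 1).
Proof.
apply: measurable_mxspace => i j; under eq_fun do rewrite mxE.
by case: eqVneq => _; [exact: measurable_id|exact: measurable_cst].
Qed.

Let coordinate_shift k (b : R) (f : mxspace R m 1 -> \bar R) :
  measurable_fun setT f -> (forall y, 0 <= f y)%E ->
  (\int[P]_w f (setk k (v w k 0 + b)%R (v w)) =
   \int[P]_w (f (v w) * (expR (v w k 0 * b / s2 - b ^+ 2 / (s2 *+ 2)))%:E))%E.
Proof.
move=> mf f0; have [vN vI] := vG.
have sq : Num.sqrt s2 ^+ 2 = s2 by rewrite sqr_sqrtr// ltW.
have mS : measurable_fun setT (fun y : mxspace R m 1 => setk k (y k 0 + b) y : mxspace R m 1).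
  apply: measurable_mxspace => i j; under eq_fun do rewrite mxE.
  case: eqVneq => _; last exact: measurable_entry.
  by apply: measurable_funD => //; exact: measurable_entry.
rewrite (@coordinate_fubini k (fun y => f (setk k (y k 0 + b)%R y)))//; last exact: (measurableT_comp mf mS).
rewrite [RHS](@coordinate_fubini k (fun y => f y * (expR (y k 0 * b / s2 - b ^+ 2 / (s2 *+ 2)))%:E)%E); [|try by []..].
- apply: eq_integral => w _.
  rewrite [RHS](eq_integral (fun w' => f (setk k (v w' k 0)%R (v w)) *
     (expR (v w' k 0 * b / s2 - b ^+ 2 / (s2 *+ 2)))%:E)%E); last first.
    by move=> w' _; rewrite mxE eqxx.
  rewrite -{1 2}sq -(expectation_normal_shift _ (vN k) b (f := fun t : R => f (setk k t (v w))))//.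
  + apply: eq_integral => w' _; congr (f _).
    by apply/matrixP => i j; rewrite !mxE eqxx; case: eqVneq.
  + by rewrite sqrtr_gt0.
  + exact: (measurableT_comp mf (mset1 k (v w))).
- apply: emeasurable_funM => //; apply/measurable_EFinP/measurableT_comp => //.
  apply: measurable_funB => //; do 2 apply: measurable_funM => //; exact: measurable_entry.
- by move=> y; rewrite mule_ge0// lee_fin expR_ge0.
Qed.

Let coordinate_opp k (f : mxspace R m 1 -> \bar R) :
  measurable_fun setT f -> (forall y, 0 <= f y)%E ->
  (\int[P]_w f (setk k (- v w k 0)%R (v w)) = \int[P]_w f (v w))%E.
Proof.
move=> mf f0; have [vN vI] := vG.
have mS : measurable_fun setT (fun y : mxspace R m 1 => setk k (- y k 0) y : mxspace R m 1).
  apply: measurable_mxspace => i j; under eq_fun do rewrite mxE.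
  case: eqVneq => _; last exact: measurable_entry.
  by apply: measurableT_comp => //; exact: measurable_entry.
rewrite (@coordinate_fubini k (fun y => f (setk k (- y k 0)%R y)))//; last exact: (measurableT_comp mf mS).
rewrite [RHS](@coordinate_fubini k f); [|by []..].
apply: eq_integral => w _.
rewrite -(expectation_normal_opp _ (vN k) (f := fun t : R => f (setk k t (v w))))//.
- apply: eq_integral => w' _; congr (f _).
  by apply/matrixP => i j; rewrite !mxE eqxx; case: eqVneq.
- by rewrite sqrtr_gt0.
- exact: (measurableT_comp mf (mset1 k (v w))).
Qed.

(** Cameron-Martin for [N(0, s2 I)]: the coordinates are moved one at a time, and each contributes
    its own density factor. *)
Lemma isotropic_shift (b : 'cV[R]_m) (f : mxspace R m 1 -> \bar R) :
  measurable_fun setT f -> (forall y, 0 <= f y)%E ->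
  (\int[P]_w f (v w + b)%R = \int[P]_w (f (v w) *
    (expR (\sum_k v w k 0 * b k 0 / s2 - \sum_k b k 0 ^+ 2 / (s2 *+ 2)))%:E))%E.
Proof.
move=> mf f0.
pose shift (s : seq 'I_m) (y : 'cV[R]_m) : mxspace R m 1 :=
  \col_i (if i \in s then y i 0 + b i 0 else y i 0).
pose rho k (y : mxspace R m 1) := expR (y k 0 * b k 0 / s2 - b k 0 ^+ 2 / (s2 *+ 2)).
have mrho k : measurable_fun setT (rho k).
  apply: measurableT_comp => //; apply: measurable_funB => //.
  by do 2 apply: measurable_funM => //; exact: measurable_entry.
have mshift s : measurable_fun setT (shift s : mxspace R m 1 -> _).
  apply: measurable_mxspace => i j; under eq_fun do rewrite mxE.
  case: (i \in s); last exact: measurable_entry.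
  by apply: measurable_funD => //; exact: measurable_entry.
(* Quantifying over [g] lets the density factor of the coordinate just moved be absorbed into the
   test function. *)
have main s : uniq s -> forall g : mxspace R m 1 -> \bar R,
    measurable_fun setT g -> (forall y, 0 <= g y)%E ->
    (\int[P]_w g (shift s (v w)) = \int[P]_w (g (v w) * (\prod_(k <- s) rho k (v w))%:E))%E.
  elim: s => [_|k s IH /= /andP[ks us]] g mg g0.
    apply: eq_integral => w _; rewrite big_nil mule1; congr (g _).
    by apply/matrixP => i j; rewrite (ord1 j) mxE in_nil.
  transitivity (\int[P]_w g (shift s (setk k (v w k 0 + b k 0)%R (v w))))%E.
    apply: eq_integral => w _; congr (g _).
    apply/matrixP => i j; rewrite !mxE in_cons.
    by case: eqVneq => [->|//]; rewrite (negbTE ks).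
  have mgs : measurable_fun setT (fun y : mxspace R m 1 => g (shift s y)).
    exact: (measurableT_comp mg (mshift s)).
  rewrite (@coordinate_shift k (b k 0) (fun y => g (shift s y)))//.
  transitivity (\int[P]_w (fun y => g y * (rho k y)%:E) (shift s (v w)))%E.
    by apply: eq_integral => w _ /=; rewrite /rho mxE (negbTE ks).
  rewrite (IH us (fun y => g y * (rho k y)%:E)%E)//.
  - by apply: eq_integral => w _; rewrite big_cons EFinM muleA.
  - by apply: emeasurable_funM => //; exact/measurable_EFinP.
  - by move=> y; rewrite mule_ge0// lee_fin expR_ge0.
have := main _ (index_enum_uniq 'I_m) f mf f0.
rewrite (eq_integral (fun w => f (v w + b)%R)) => [->|w _]; last first.
  by congr (f _); apply/matrixP => i j; rewrite (ord1 j) !mxE mem_index_enum.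
apply: eq_integral => w _; congr (_ * _%:E)%E.
by rewrite -expR_sum; congr expR; rewrite sumrB.
Qed.

Lemma isotropic_opp (f : mxspace R m 1 -> \bar R) :
  measurable_fun setT f -> (forall y, 0 <= f y)%E ->
  (\int[P]_w f (- v w)%R = \int[P]_w f (v w))%E.
Proof.
move=> mf f0.
pose flip (s : seq 'I_m) (y : 'cV[R]_m) : mxspace R m 1 :=
  \col_i (if i \in s then - y i 0 else y i 0).
have mflip s : measurable_fun setT (flip s : mxspace R m 1 -> _).
  apply: measurable_mxspace => i j; under eq_fun do rewrite mxE.
  case: (i \in s); last exact: measurable_entry.
  by apply: measurableT_comp => //; exact: measurable_entry.
have main s : uniq s -> (\int[P]_w f (flip s (v w)) = \int[P]_w f (v w))%E.
  elim: s => [_|k s IH /= /andP[ks us]].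
    apply: eq_integral => w _; congr (f _).
    by apply/matrixP => i j; rewrite (ord1 j) mxE in_nil.
  have mfs : measurable_fun setT (fun y : mxspace R m 1 => f (flip s y)).
    exact: (measurableT_comp mf (mflip s)).
  rewrite -(IH us) -(@coordinate_opp k (fun y => f (flip s y)))//.
  apply: eq_integral => w _; congr (f _).
  apply/matrixP => i j; rewrite !mxE in_cons.
  by case: eqVneq => [->|//]; rewrite (negbTE ks).
rewrite -[RHS](main _ (index_enum_uniq 'I_m)).
apply: eq_integral => w _; congr (f _); apply/matrixP => i j.
by rewrite (ord1 j) !mxE mem_index_enum.
Qed.

End isotropic.

(** * Small balls for functions of a Gaussian vector *)

Lemma expRN_le_min (R : realType) (y : R) : 0 <= y ->
  expR (- y) <= 1 - Num.min y 1 / 2.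
Proof.
move=> y0; have e1 : expR (- y) <= (1 + y)^-1.
  rewrite expRN lef_pV2 ?posrE ?expR_gt0//; last lra.
  exact: expR_ge1Dx.
apply: (le_trans e1); have y1 : 0 < 1 + y by lra.
rewrite -[leLHS]mul1r ler_pdivrMr//.
by have [yl|yl] := leP y 1; nra.
Qed.

Section small_ball.
Context {R : realType} d (T : measurableType d) (P : probability T R).
Context (m : nat) (s2 : R) (v : T -> 'cV[R]_m).
Hypotheses (s20 : 0 < s2) (vG : isotropic_gaussian P s2 v).

(** Total mass of the shifted law: [isotropic_shift] with [f = 1] and the translation [s2 *: b]. *)
Lemma isotropic_exp_moment (b : 'cV[R]_m) :
  (\int[P]_w (expR (\sum_k v w k 0 * b k 0))%:E =
   (expR (s2 * \sum_k b k 0 ^+ 2 / 2))%:E)%E.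
Proof.
have := isotropic_shift s20 vG (s2 *: b) (f := fun=> 1%E) (@measurable_cst _ _ _ _ _ _) (fun=> lee01).
have -> : (\int[P]_w (fun=> 1%E) (v w + s2 *: b)%R = 1)%E.
  by rewrite integral_cst//= mul1e probability_setT.
set K := expR (s2 * \sum_k b k 0 ^+ 2 / 2).
under eq_integral => w _.
  have -> : (1 * (expR (\sum_k v w k 0 * (s2 *: b) k 0 / s2 - \sum_k (s2 *: b) k 0 ^+ 2 / (s2 *+ 2)))%:E
    = K^-1%:E * (expR (\sum_k v w k 0 * b k 0))%:E)%E.
    rewrite mul1e -EFinM /K -expRN -expRD; congr (expR _)%:E; rewrite addrC; congr (_ + _).
      rewrite mulr_sumr; congr (- _); apply: eq_bigr => k _; rewrite mxE; field; rewrite ?gt_eqF//.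
    apply: eq_bigr => k _; rewrite mxE; field; rewrite ?gt_eqF//.
  over.
have K0 : 0 < K by exact: expR_gt0.
have mE : measurable_fun setT (fun w => expR (\sum_k v w k 0 * b k 0)).
  apply: measurableT_comp => //; apply: measurable_sum => k; apply: measurable_funM => //.
  exact: (isotropic_random_matrix vG).
rewrite ge0_integralZl//; last 2 first.
- exact/measurable_EFinP.
- by rewrite lee_fin invr_ge0 ltW.
move=> H.
have := congr1 (fun t => K%:E * t)%E H.
by rewrite mule1 muleA -EFinM divff ?gt_eqF// mul1e => <-.
Qed.

(** With [M = 2 * expR B / tau], the argument in [small_ball] gives
    [E min(|Y|, 1) >= (tau / 2) / (1 + M)]; half of this is lost in passing to [E exp(-|Y|)] by
    [expRN_le_min]. *)
Definition small_ball_rate (tau B : R) := tau / 4 / (1 + 2 * expR B / tau).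

Lemma small_ball_rate_gt0 tau B : 0 < tau -> 0 < small_ball_rate tau B.
Proof.
move=> t0; rewrite /small_ball_rate; have eB := expR_gt0 B.
by rewrite !divr_gt0// addr_gt0// divr_gt0// mulr_gt0.
Qed.

Lemma small_ball_rate_le tau B : 0 < tau -> small_ball_rate tau B <= tau / 4.
Proof.
move=> t0; have eB := expR_gt0 B; rewrite /small_ball_rate.
have q0 : 0 <= 2 * expR B / tau by rewrite divr_ge0// ?mulr_ge0// ltW.
by rewrite ler_pdivrMr ?ler_peMr//; lra.
Qed.

(* Two points [v] and [v + b] cannot both be small, and the density [rho] of
   the law of [v + b] with respect to that of [v] has a bounded second moment. *)
Lemma small_ball (Y D : mxspace R m 1 -> R) (b : 'cV[R]_m) (tau B : R) :
  measurable_fun setT Y -> measurable_fun setT D -> 0 < tau ->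
  \sum_k b k 0 ^+ 2 / s2 <= B ->
  (forall y, 0 <= D y) ->
  (forall y : 'cV[R]_m, D y <= Num.min `|Y y| 1 + Num.min `|Y (y + b)| 1) ->
  (tau%:E <= \int[P]_w (D (v w))%:E)%E ->
  (\int[P]_w (expR (- `|Y (v w)|))%:E <= (1 - small_ball_rate tau B)%:E)%E.
Proof.
move=> mY mD tau0 bB D0 DY tauD.
pose phi (y : mxspace R m 1) := Num.min `|Y y| 1.
have phi0 y : 0 <= phi y by rewrite /phi le_min normr_ge0 ler01.
have phi1 y : phi y <= 1 by rewrite /phi ge_min lexx orbT.
have mphi : measurable_fun setT phi.
  by apply: measurable_minr => //; exact: measurableT_comp.
have mv : measurable_fun setT (v : T -> mxspace R m 1).
  by apply: measurable_mxspace; exact: (isotropic_random_matrix vG).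
have mvb : measurable_fun setT (fun w => v w + b : mxspace R m 1).
  apply: measurable_mxspace => i j; under eq_fun do rewrite mxE.
  by apply: measurable_funD => //; exact: (isotropic_random_matrix vG).
pose e := (\int[P]_w (phi (v w))%:E)%E.
have mphiv : measurable_fun setT (fun w => phi (v w)) by exact: (measurableT_comp mphi mv).
have mphivb : measurable_fun setT (fun w => phi (v w + b)) by exact: (measurableT_comp mphi mvb).
have e0 : (0 <= e)%E by apply: integral_ge0 => w _; rewrite lee_fin.
have e1 : (e <= 1)%E.
  rewrite -(@probability_setT _ _ _ P) -[leRHS]mul1e -integral_cst//; apply: ge0_le_integral => //.
  - by move=> w _; rewrite lee_fin.
  - exact/measurable_EFinP.
  - by move=> w _; rewrite lee_fin.
have [r re] : exists r, e = r%:E.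
  by exists (fine e); rewrite fineK// ge0_fin_numE// (le_lt_trans e1)// ltry.
(* Truncation level for the density: [rho * phi] is at most [M * phi] where [rho <= M], and at most
   [rho^2 / M] elsewhere. Since [E rho^2 <= expR B], the second part costs at most [tau / 2]. *)
pose M := 2 * expR B / tau.
have M0 : 0 < M by rewrite divr_gt0// mulr_gt0// expR_gt0.
pose rho w := expR (\sum_k v w k 0 * b k 0 / s2 - \sum_k b k 0 ^+ 2 / (s2 *+ 2)).
have mrho : measurable_fun setT rho.
  apply: measurableT_comp => //; apply: measurable_funB => //; apply: measurable_sum => k.
  by do 2 apply: measurable_funM => //; exact: (isotropic_random_matrix vG).
(* The squared density is again the exponential of an affine form, so its mean is a Gaussian
   exponential moment. *)
have rho2 : (\int[P]_w (rho w ^+ 2)%:E = (expR (\sum_k b k 0 ^+ 2 / s2))%:E)%E.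
  pose K := expR (- (\sum_k b k 0 ^+ 2 / s2)).
  have rE w : rho w ^+ 2 = K * expR (\sum_k v w k 0 * ((2 / s2) *: b) k 0).
    rewrite /rho -expRM_natl -expRD; congr expR; rewrite mulrBr !mulr_sumr -!sumrN -!big_split/=.
    apply: eq_bigr => k _; rewrite mxE; field; rewrite ?gt_eqF//.
  under eq_integral do rewrite rE EFinM.
  rewrite ge0_integralZl//; last 2 first.
  - apply/measurable_EFinP; apply: measurableT_comp => //; apply: measurable_sum => k; apply: measurable_funM => //.
    exact: (isotropic_random_matrix vG).
  - by rewrite lee_fin expR_ge0.
  rewrite isotropic_exp_moment -EFinM -expRD; congr (expR _)%:E.
  rewrite -sumrN mulr_sumr -big_split/=; apply: eq_bigr => k _; rewrite mxE; field; rewrite ?gt_eqF//.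
have shift_le : (\int[P]_w (phi (v w + b))%:E <= M%:E * e + (tau / 2)%:E)%E.
  rewrite (isotropic_shift s20 vG b (f := fun y => (phi y)%:E)); last 2 first.
  - exact/measurable_EFinP.
  - by move=> y; rewrite lee_fin.
  apply: (@le_trans _ _ (\int[P]_w ((M * phi (v w))%:E + (M^-1 * rho w ^+ 2)%:E))%E).
    apply: ge0_le_integral => //.
    - by move=> w _; rewrite -EFinM lee_fin mulr_ge0// expR_ge0.
    - apply/measurable_EFinP; exact: measurable_funM.
    - apply/measurable_EFinP; apply: measurable_funD; apply: measurable_funM => //.
      exact: measurable_funX.
    - move=> w _; rewrite -EFinM -EFinD lee_fin -/(rho w).
      have := phi0 (v w); have := phi1 (v w); have : 0 <= rho w by exact: expR_ge0.
      move: (rho w) (phi (v w)) => x y x0 y1 y0.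
      have [xM|Mx] := leP x M.
        apply: ler_wpDr; first by rewrite mulr_ge0 ?sqr_ge0// invr_ge0 ltW.
        by rewrite mulrC ler_wpM2r.
      apply: ler_wpDl; first by rewrite mulr_ge0// ltW.
      apply: (@le_trans _ _ x); first by rewrite ler_piMl.
      by rewrite ler_pdivlMl// expr2 ler_wpM2r// ltW.
  rewrite ge0_integralD//; last 4 first.
  - by move=> w _; rewrite lee_fin mulr_ge0// ltW.
  - apply/measurable_EFinP; exact: measurable_funM.
  - by move=> w _; rewrite lee_fin mulr_ge0 ?sqr_ge0// invr_ge0 ltW.
  - apply/measurable_EFinP; apply: measurable_funM => //; exact: measurable_funX.
  under eq_integral do rewrite EFinM.
  under [X in (_ + X)%E]eq_integral do rewrite EFinM.
  rewrite !ge0_integralZl//; last 6 first.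
  - exact/measurable_EFinP/measurable_funX.
  - by move=> w _; rewrite lee_fin sqr_ge0.
  - by rewrite lee_fin invr_ge0 ltW.
  - exact/measurable_EFinP.
  - by move=> w _; rewrite lee_fin.
  - by rewrite lee_fin ltW.
  rewrite rho2 leeD2l// -EFinM lee_fin /M invf_div.
  have eb : expR (\sum_k b k 0 ^+ 2 / s2) <= expR B by rewrite ler_expR.
  rewrite -(@ler_pM2l _ (2 * expR B / tau))//.
  rewrite -/M; have -> : M * (tau / (2 * expR B) * expR (\sum_k b k 0 ^+ 2 / s2)) = expR (\sum_k b k 0 ^+ 2 / s2).
    by rewrite /M; have := expR_gt0 B => eB0; field; rewrite ?gt_eqF//.
  have -> : M * (tau / 2) = expR B by rewrite /M; field; rewrite ?gt_eqF//.
  by [].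
(* The inequality [tau <= e + M e + tau / 2], solved for [e]. *)
have lo : small_ball_rate tau B *+ 2 <= r.
  have : (tau%:E <= e + (M%:E * e + (tau / 2)%:E))%E.
    apply: (le_trans tauD); apply: (@le_trans _ _ (e + \int[P]_w (phi (v w + b))%:E)%E); last exact: leeD2l.
    rewrite /e -ge0_integralD//; last 4 first.
    - by move=> w _; rewrite lee_fin.
    - exact/measurable_EFinP.
    - by move=> w _; rewrite lee_fin.
    - exact/measurable_EFinP.
    apply: ge0_le_integral => //.
    - by move=> w _; rewrite lee_fin.
    - exact/measurable_EFinP/(measurableT_comp mD mv).
    - by apply/measurable_EFinP; exact: measurable_funD.
    - by move=> w _; rewrite -EFinD lee_fin; exact: DY.
  rewrite re -EFinM -!EFinD lee_fin => H.
  rewrite /small_ball_rate -/M.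
  have M1 : 0 < 1 + M by lra.
  have -> : tau / 4 / (1 + M) *+ 2 = (tau / 2) / (1 + M) by field; rewrite ?gt_eqF//.
  rewrite ler_pdivrMr//; lra.
have mexp : measurable_fun setT (fun w => expR (- `|Y (v w)|)).
  do 3 apply: measurableT_comp => //.
  exact: (measurableT_comp mY mv).
have : (\int[P]_w (expR (- `|Y (v w)|))%:E + \int[P]_w (phi (v w) / 2)%:E <= 1)%E.
  rewrite -ge0_integralD//; last 3 first.
  - exact/measurable_EFinP.
  - by move=> w _; rewrite lee_fin divr_ge0.
  - by apply/measurable_EFinP; exact: measurable_funM.
  rewrite -(@probability_setT _ _ _ P) -[leRHS]mul1e -integral_cst//; apply: ge0_le_integral => //.
  - by move=> w _; rewrite -EFinD lee_fin addr_ge0 ?expR_ge0// divr_ge0.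
  - apply/measurable_EFinP; apply: measurable_funD => //; exact: measurable_funM.
  - by move=> w _; rewrite -EFinD lee_fin -lerBrDr expRN_le_min.
under [X in (_ + X <= _)%E -> _]eq_integral do rewrite mulrC EFinM.
rewrite ge0_integralZl//; last 2 first.
- exact/measurable_EFinP.
- by move=> w _; rewrite lee_fin.
rewrite -/e re -EFinM => H.
rewrite EFinB leeBrDr//; apply: le_trans H; rewrite leeD2l// lee_fin.
rewrite ler_pdivlMl//; lra.
Qed.

End small_ball.

(** * The Gaussian design *)

Lemma lee_prod_EFin (R : realType) (I : finType) (A : {pred I}) (F : I -> \bar R) (c : R) :
  (forall i, i \in A -> (0 <= F i <= c%:E)%E) ->
  (\prod_(i in A) F i <= (c ^+ #|A|)%:E)%E.
Proof.
move=> Fc; rewrite -prodr_const -prodEFin.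
suff : (0 <= \prod_(i in A) F i <= \prod_(i in A) c%:E)%E by case/andP.
apply: (big_ind2 (fun a b => (0 <= a <= b)%E)) => //; first by rewrite lee01 lexx.
by move=> a b a' b' /andP[? ?] /andP[? ?]; rewrite mule_ge0//= lee_pmul.
Qed.

Section independence_transfer.
Context {R : realType} d (T : measurableType d) (P : probability T R).

(** Independence inside each block combines with independence between blocks because an intersection
    over one block is an event of that block. *)
Lemma independent_nested (I K : finType) (F : I * K -> set (set T)) (G : I -> set (set T)) :
  (forall i, mutually_independent P (fun k => F (i, k))) ->
  mutually_independent P G ->
  (forall i (J : {set K}) (E : K -> set T), (forall k, k \in J -> F (i, k) (E k)) ->
     G i (\big[setI/setT]_(k in J) E k)) ->
  mutually_independent P F.
Proof.
move=> FI GI FG J E HE.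
pose Ji i := [set k | (i, k) \in J]%SET.
have HEi i : forall k, k \in Ji i -> F (i, k) (E (i, k)).
  by move=> k; rewrite inE => /HE.
transitivity (P (\big[setI/setT]_(i in [set: I]%SET) \big[setI/setT]_(k in Ji i) E (i, k))).
  congr (P _); rewrite pair_big_dep/=; apply: eq_big; last by case.
  by case=> i k /=; rewrite !inE.
rewrite GI; last by move=> i _; apply: FG => k; exact: HEi.
transitivity (\prod_(i in [set: I]%SET) \prod_(k in Ji i) P (E (i, k)))%E.
  by apply: eq_bigr => i _; rewrite (FI i (Ji i) (fun k => E (i, k))) //; exact: HEi.
rewrite pair_big_dep/=; apply: eq_big; last by case.
by case=> i k /=; rewrite !inE.
Qed.

Lemma independent_inj (I K : finType) (f : K -> I) (F : I -> set (set T)) :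
  injective f -> mutually_independent P F -> mutually_independent P (F \o f).
Proof.
move=> finj FI J E HE.
pose E' i := if [pick k | f k == i] is Some k then E k else setT.
have E'E k : E' (f k) = E k.
  rewrite /E'; case: pickP => [l /eqP/finj ->//|/(_ k)].
  by rewrite eqxx.
have := FI (f @: J)%SET E'.
have -> : (\prod_(i in (f @: J)%SET) P (E' i) = \prod_(k in J) P (E k))%E.
  rewrite big_imset/=; last by move=> ? ? _ _; apply: finj.
  by apply: eq_bigr => k _; rewrite E'E.
rewrite big_imset/=; last by move=> ? ? _ _; apply: finj.
rewrite (eq_bigr E) => [|k _]; last by rewrite E'E.
by apply=> _ /imsetP[k kJ ->]; rewrite E'E; exact: HE.
Qed.

End independence_transfer.

Section gaussian_rows.
Context {R : realType} disp (T : measurableType disp) (P : probability T R).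
Context (n d : nat) (x : 'I_n -> T -> 'cV[R]_d).
Hypotheses (xG : forall i, isotropic_gaussian P 1 (x i))
  (xI : mutually_independent P (fun i => sigma_mx (x i))).

(** The [l1] norm of a combination of rows is a sum over columns, so the design is regrouped from
    independent rows into independent columns, each again isotropic. *)
Definition column (k : 'I_d) (w : T) : 'cV[R]_n := \col_i x i w k 0.

Let mx i k : measurable_fun setT (fun w => x i w k 0).
Proof. exact: (isotropic_random_matrix (xG i)). Qed.

Let F (ik : 'I_n * 'I_d) := sigma_rv (fun w => x ik.1 w ik.2 0).

Let Fm ik : F ik `<=` measurable.
Proof. exact: sigma_rv_measurable. Qed.

Let FI ik : setI_closed (F ik).
Proof. exact: sigma_rv_setI. Qed.

Let FT ik : F ik setT.
Proof. exact: sigma_rv_setT. Qed.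

Let Find : mutually_independent P F.
Proof.
apply: (independent_nested _ xI) => [i|i J E HE]; first by case: (xG i).
rewrite /sigma_mx; set G := \bigcup_(ij in _) _.
apply: (@bigsetI_measurable _ (g_sigma_algebraType G)) => k kJ.
apply: sub_sigma_algebra; exists (k, 0) => //.
exact: HE.
Qed.

Let Gind : mutually_independent P (group_sigma snd F).
Proof. exact: grouping. Qed.

Let Gm k : group_sigma snd F k `<=` measurable.
Proof.
apply: smallest_sub; first exact: sigma_algebra_measurable.
by move=> A [i _]; exact: Fm.
Qed.

Let column_group k (E : set (mxspace R n 1)) :
  measurable E -> group_sigma snd F k (column k @^-1` E).
Proof.
move=> mE; pose G := \bigcup_(ik in [set ik | ik.2 = k]) F ik.
have mM : measurable_fun setT (column k : g_sigma_algebraType G -> mxspace R n 1).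
  apply: measurable_mxspace => i j; rewrite /column; under eq_fun do rewrite mxE.
  move=> _ B mB; apply: sub_sigma_algebra; exists (i, k) => //.
  by exists B.
by have := mM measurableT E mE; rewrite setTI.
Qed.

Lemma column_isotropic k : isotropic_gaussian P 1 (column k).
Proof.
have colE i : (fun w => column k w i 0) = (fun w => x i w k 0).
  by apply/funext => w; rewrite mxE.
split=> [i|]; first by rewrite colE; case: (xG i).
have -> : (fun i => sigma_rv (fun w => column k w i 0)) = F \o (fun i => (i, k)).
  by apply/funext => i; rewrite colE.
by apply: independent_inj => // i j [].
Qed.

Lemma ge0_integral_columns (f : 'I_d -> mxspace R n 1 -> R) :
  (forall k y, 0 <= f k y) -> (forall k, measurable_fun setT (f k)) ->
  (\int[P]_w (\prod_k f k (column k w))%:E = \prod_k \int[P]_w (f k (column k w))%:E)%E.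
Proof.
move=> f0 mf.
apply: (ge0_integral_prodT (F := group_sigma snd F) Gm _ _ Gind
  (f := fun k w => f k (column k w))).
- move=> k A B sA sB.
  exact: (@measurableI _ (g_sigma_algebraType (\bigcup_(i in [set i | i.2 = k]) F i))).
- move=> k.
  exact: (@measurableT _ (g_sigma_algebraType (\bigcup_(i in [set i | i.2 = k]) F i))).
- by move=> k w.
- move=> k E mE.
  apply: (@column_group k (f k @^-1` E)).
  by have := mf k measurableT E mE; rewrite setTI.
Qed.

Definition l1_combination (M : 'M[R]_(n, d)) (u : 'cV[R]_n) : R :=
  \sum_k `|\sum_i u i 0 * M i k|.

Definition row_matrix (w : T) : 'M[R]_(n, d) := \matrix_(i, k) x i w k 0.

Let Z (u : 'cV[R]_n) (y : mxspace R n 1) := \sum_i y i 0 * u i 0.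

Let mZ u : measurable_fun setT (Z u).
Proof.
apply: measurable_sum => i; apply: measurable_funM => //; exact: measurable_entry.
Qed.

Let l1_row_matrix w u : l1_combination (row_matrix w) u = \sum_k `|Z u (column k w)|.
Proof.
apply: eq_bigr => k _; congr `|_|; apply: eq_bigr => i _.
by rewrite !mxE mulrC.
Qed.

Let mcol k : measurable_fun setT (column k : T -> mxspace R n 1).
Proof. by apply: measurable_mxspace; exact: (isotropic_random_matrix (column_isotropic k)). Qed.

(** For one column, [exp|Z| <= exp Z + exp(-Z)] with [Z] Gaussian of variance at most 1, and
    [2 exp(1/2) <= 4]. *)
Lemma l1_exp_moment_ub (u : 'cV[R]_n) : \sum_i u i 0 ^+ 2 <= 1 ->
  (\int[P]_w (expR (l1_combination (row_matrix w) u))%:E <= (4 ^+ d)%:E)%E.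
Proof.
move=> u1.
under eq_integral do rewrite l1_row_matrix expR_sum.
rewrite (ge0_integral_columns (f := fun k y => expR `|Z u y|)); last 2 first.
- by move=> *; exact: expR_ge0.
- by move=> k; do 2 apply: measurableT_comp => //.
rewrite -[d in leRHS]card_ord.
apply: lee_prod_EFin => k _; apply/andP; split.
  by apply: integral_ge0 => w _; rewrite lee_fin expR_ge0.
apply: (@le_trans _ _ (\int[P]_w ((expR (\sum_i column k w i 0 * u i 0))%:E
    + (expR (\sum_i column k w i 0 * (- u) i 0))%:E))%E).
  apply: ge0_le_integral => //.
  - apply/measurable_EFinP; do 2 apply: measurableT_comp => //; exact: (measurableT_comp (mZ u) (mcol k)).
  - apply/measurable_EFinP; apply: measurable_funD; apply: measurableT_comp => //.
      exact: (measurableT_comp (mZ u) (mcol k)).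
    exact: (measurableT_comp (mZ (- u)) (mcol k)).
  - move=> w _; rewrite -EFinD lee_fin /Z.
    have -> : \sum_i column k w i 0 * (- u) i 0 = - \sum_i column k w i 0 * u i 0.
      by rewrite -sumrN; apply: eq_bigr => i _; rewrite [(- u) _ _]mxE mulrN.
    move: (\sum_i column k w i 0 * u i 0) => t.
    by case: (ger0P t) => _; rewrite ?lerDl ?lerDr expR_ge0.
rewrite ge0_integralD//; last 2 first.
- apply/measurable_EFinP; apply: measurableT_comp => //; exact: (measurableT_comp (mZ u) (mcol k)).
- apply/measurable_EFinP; apply: measurableT_comp => //; exact: (measurableT_comp (mZ (- u)) (mcol k)).
rewrite !(isotropic_exp_moment _ (column_isotropic k))//.
rewrite -EFinD lee_fin.
have e2 (b : 'cV[R]_n) : \sum_i b i 0 ^+ 2 <= 1 -> expR (1 * \sum_i b i 0 ^+ 2 / 2) <= 2.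
  move=> b1; rewrite mul1r -mulr_suml.
  rewrite -[leLHS]invrK -[leRHS]invrK -expRN lef_pV2 ?posrE ?invr_gt0 ?expR_gt0//.
  apply: le_trans (expR_ge1Dx _); lra.
have uN : \sum_i (- u) i 0 ^+ 2 = \sum_i u i 0 ^+ 2.
  by apply: eq_bigr => i _; rewrite mxE sqrrN.
have := e2 u u1; have := e2 (- u); rewrite uN => /(_ u1).
lra.
Qed.

Lemma l1_exp_moment_lb (u : 'cV[R]_n) : 1 / 4 <= \sum_i u i 0 ^+ 2 ->
  (\int[P]_w (expR (- l1_combination (row_matrix w) u))%:E <=
    ((1 - small_ball_rate 1 4) ^+ d)%:E)%E.
Proof.
move=> u1.
have s0 : 0 < \sum_i u i 0 ^+ 2 by lra.
under eq_integral do rewrite l1_row_matrix -sumrN expR_sum.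
rewrite (ge0_integral_columns (f := fun k y => expR (- `|Z u y|))); last 2 first.
- by move=> *; exact: expR_ge0.
- by move=> k; do 3 apply: measurableT_comp => //.
rewrite -[d in leRHS]card_ord.
apply: lee_prod_EFin => k _; apply/andP; split.
  by apply: integral_ge0 => w _; rewrite lee_fin expR_ge0.
(* Translating a column by [u / |u|^2] raises [Z u] by exactly 1, which allows [D = 1] and
   [tau = 1]; the squared length [1 / |u|^2] of the translation is at most 4. *)
apply: (small_ball (Y := Z u) (D := fun=> 1) (b := (\sum_i u i 0 ^+ 2)^-1 *: u) _ (column_isotropic k)) => //.
- under eq_bigr do rewrite mxE divr1 exprMn.
  rewrite -mulr_sumr expr2 -mulrA mulVf ?gt_eqF// mulr1.
  rewrite -[leRHS]invrK lef_pV2 ?posrE//; lra.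
- move=> y; have -> : Z u (y + (\sum_i u i 0 ^+ 2)^-1 *: u) = Z u y + 1.
    rewrite /Z -[in RHS](@mulVf _ (\sum_i u i 0 ^+ 2)) ?gt_eqF//.
    rewrite mulr_sumr -big_split/=; apply: eq_bigr => i _; rewrite !mxE; ring.
  move: (Z u y) => t; have := ler_norm (t + 1); have := ler_norm (- t); rewrite normrN.
  have := normr_ge0 t; have := normr_ge0 (t + 1).
  by case: (leP `|t| 1) => ?; case: (leP `|t + 1| 1) => ?; lra.
- by rewrite integral_cst//= mul1e probability_setT.
Qed.

Lemma row_exp_moment (i : 'I_n) :
  (\int[P]_w (expR (\sum_k x i w k 0 ^+ 2 / 4))%:E <= (2 ^+ d)%:E)%E.
Proof.
have [xN xi] := xG i.
under eq_integral do rewrite expR_sum.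
rewrite (ge0_integral_prodT _ _ _ xi (f := fun k w => expR (x i w k 0 ^+ 2 / 4))).
- rewrite -[d in leRHS]card_ord.
  apply: lee_prod_EFin => k _; apply/andP; split.
    by apply: integral_ge0 => w _; rewrite lee_fin expR_ge0.
  rewrite (expectation_normal_expR_sqr (X := fun w => x i w k 0)); last first.
    by have := xN k; rewrite sqrtr1.
  rewrite lee_fin -(@ler_pXn2r _ 2)// ?nnegrE ?sqrtr_ge0// sqr_sqrtr//; lra.
- by move=> k; exact: sigma_rv_measurable.
- by move=> k; exact: sigma_rv_setI.
- by move=> k; exact: sigma_rv_setT.
- by move=> k w; exact: expR_ge0.
- move=> k E mE.
  rewrite (_ : _ @^-1` E = (fun w => x i w k 0) @^-1` ((fun t => expR (t ^+ 2 / 4)) @^-1` E))//.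
  apply: sigma_rv_preimage.
  have mm : measurable_fun setT (fun t : R => expR (t ^+ 2 / 4)).
    by apply: measurableT_comp => //; apply: measurable_funM.
  by have := mm measurableT E mE; rewrite setTI.
Qed.

End gaussian_rows.

(** * Lattice approximation in the unit ball and the size of nets *)

Section lattice.
Context {R : realType} (n B : nat) (h : R).

Definition lattice_point (f : {ffun 'I_n -> bool * 'I_B.+1}) : 'cV[R]_n :=
  \col_i ((-1) ^+ (f i).1 * h * (f i).2%:R).

Hypotheses (h0 : 0 < h) (hB : h^-1 <= B%:R).

(** Each coordinate is rounded towards zero, so norms do not grow and the point stays in the unit
    ball; reaching magnitude 1 takes [B >= 1/h] multiples of the mesh. *)
Lemma lattice_approx (v : 'cV[R]_n) : (forall i, `|v i 0| <= 1) ->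
  exists f, forall i, `|lattice_point f i 0| <= `|v i 0| /\
     `|v i 0 - lattice_point f i 0| <= h.
Proof.
move=> v1.
pose k i := Num.truncn (`|v i 0| / h).
have kE i : (k i)%:R <= `|v i 0| / h < (k i).+1%:R.
  by apply: truncn_itv; rewrite divr_ge0// ltW.
have kB i : (k i < B.+1)%N.
  rewrite ltnS -(ler_nat R); have /andP[/le_trans + _] := kE i; apply.
  by apply: le_trans hB; rewrite ler_pdivrMr// mulVf ?gt_eqF.
exists [ffun i => (v i 0 < 0, Ordinal (kB i))] => i.
have /andP[k1 k2] := kE i.
rewrite !mxE ffunE/= -mulrA.
have h1 : h * (k i)%:R <= `|v i 0| by rewrite mulrC -ler_pdivlMr.
have h2 : `|v i 0| <= h * (k i)%:R + h.
  by rewrite -[X in _ + X]mulr1 -mulrDr mulrC -ler_pdivrMr// natr1 ltW.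
have hk : 0 <= h * (k i)%:R by rewrite mulr_ge0// ltW.
rewrite normrM normr_sign mul1r (ger0_norm hk); split => //.
case: (ltrP (v i 0) 0) h1 h2 => v0.
  by rewrite ltr0_norm// expr1 mulN1r opprK => h1 h2; rewrite ler_norml; apply/andP; split; lra.
by rewrite ger0_norm// expr0 mul1r => h1 h2; rewrite ler_norml; apply/andP; split; lra.
Qed.

Lemma sum_sqr_approx_ub (u v : 'cV[R]_n) : (forall i, `|u i 0| <= `|v i 0|) ->
  \sum_i u i 0 ^+ 2 <= \sum_i v i 0 ^+ 2.
Proof.
move=> uv; apply: ler_sum => i _.
by rewrite -(real_normK (num_real (u i 0))) -(real_normK (num_real (v i 0))) lerXn2r ?nnegrE.
Qed.

Lemma sum_sqr_approx_lb (u v : 'cV[R]_n) : (forall i, `|v i 0 - u i 0| <= h) ->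
  \sum_i v i 0 ^+ 2 <= 2 * \sum_i u i 0 ^+ 2 + 2 * (n%:R * h ^+ 2).
Proof.
move=> uv; have -> : n%:R * h ^+ 2 = \sum_(i < n) h ^+ 2.
  by rewrite sumr_const card_ord mulr_natl.
rewrite !mulr_sumr -big_split/=; apply: ler_sum => i _.
have := uv i; move: (v i 0) (u i 0) => a b ab.
have : (a - b) ^+ 2 <= h ^+ 2.
  by rewrite -(real_normK (num_real (a - b))); apply: lerXn2r; rewrite ?nnegrE// ltW.
(* [2 b^2 + 2 (a - b)^2 - a^2 = (a - 2 b)^2]. *)
by have := sqr_ge0 (a - 2 * b); lra.
Qed.

End lattice.

Lemma sum_geometric_half (R : realType) (m : nat) : \sum_(j < m) (2^-1 : R) ^+ j <= 2.
Proof.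
suff -> : \sum_(j < m) (2^-1 : R) ^+ j = 2 - 2 * 2^-1 ^+ m.
  by rewrite gerBl mulr_ge0// exprn_ge0// invr_ge0.
elim: m => [|m IH]; first by rewrite big_ord0 expr0; lra.
by rewrite big_ord_recr/= IH exprS; lra.
Qed.

(** Counting by weights: [f] weighs 2 to the minus the sum of its magnitudes. As [k <= k^2], a
    counted [f] weighs at least [2^-(L n)], while all weights sum to at most [4^n]: two signs and a
    geometric series give a factor 4 per coordinate. *)
Lemma card_lattice_ball (R : realType) (n B L : nat) :
  (#|[set f : {ffun 'I_n -> bool * 'I_B.+1} | (\sum_i (f i).2 ^ 2 <= L * n)%N]%SET|%:R : R) <=
  (4 * 2 ^+ L) ^+ n.
Proof.
set N := (X in #|X|%:R).
pose w (c : bool * 'I_B.+1) : R := 2^-1 ^+ c.2.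
have w0 c : 0 <= w c by rewrite /w exprn_ge0// invr_ge0.
have -> : #|N|%:R = \sum_(f in N) (1 : R) by rewrite sumr_const.
apply: (@le_trans _ _ (\sum_(f in N) (2 ^+ L) ^+ n * \prod_i w (f i))).
  apply: ler_sum => f; rewrite inE => fN.
  rewrite -exprM /w -expr_sum -[X in X * _]invrK -exprVn.
  rewrite -[leLHS](@mulVf _ (2^-1 ^+ (L * n))) ?expf_neq0 ?invr_eq0//.
  rewrite ler_pM2l ?invr_gt0 ?exprn_gt0 ?invr_gt0//.
  apply: ler_wiXn2l; [by rewrite invr_ge0|by rewrite invf_le1//; lra|].
  apply: leq_trans fN; apply: leq_sum => i _.
  by case: ((f i).2 : nat) => // k; rewrite -[X in (X <= _)%N]expn1 leq_pexp2l.
rewrite -mulr_sumr mulrC exprMn ler_wpM2r ?exprn_ge0//.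
apply: (@le_trans _ _ (\sum_(f : {ffun 'I_n -> bool * 'I_B.+1}) \prod_i w (f i))).
  rewrite [leRHS](bigID (mem N))/= lerDl sumr_ge0// => f _.
  by apply: prodr_ge0.
rewrite -(bigA_distr_bigA (fun _ c => w c)) /= prodr_const card_ord.
apply: lerXn2r; rewrite ?nnegrE ?sumr_ge0//.
rewrite (eq_bigr (fun c => (fun (_ : bool) j => 2^-1 ^+ (nat_of_ord j)) c.1 c.2))//.
rewrite -(pair_bigA _ (fun (_ : bool) (j : 'I_B.+1) => (2^-1 : R) ^+ j))/= big_bool/=.
have := sum_geometric_half R B.+1; lra.
Qed.

Lemma l1_combinationD (R : realType) n d (M : 'M[R]_(n, d)) (u v : 'cV[R]_n) :
  l1_combination M (u + v) <= l1_combination M u + l1_combination M v.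
Proof.
rewrite /l1_combination -big_split/=; apply: ler_sum => k _.
apply: le_trans (ler_normD _ _); rewrite -big_split/=.
by under eq_bigr do rewrite mxE mulrDl.
Qed.

Lemma l1_combinationZ (R : realType) n d (M : 'M[R]_(n, d)) (a : R) (u : 'cV[R]_n) :
  l1_combination M (a *: u) = `|a| * l1_combination M u.
Proof.
rewrite /l1_combination mulr_sumr; apply: eq_bigr => k _.
rewrite -normrM mulr_sumr; congr `|_|; apply: eq_bigr => i _.
by rewrite mxE mulrA.
Qed.

Lemma l1_combination_ge0 (R : realType) n d (M : 'M[R]_(n, d)) (u : 'cV[R]_n) :
  0 <= l1_combination M u.
Proof. exact: sumr_ge0. Qed.

Lemma entry_le1 (R : realType) n (v : 'cV[R]_n) : \sum_i v i 0 ^+ 2 <= 1 ->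
  forall i, `|v i 0| <= 1.
Proof.
move=> v1 i; rewrite -(@ler_pXn2r _ 2)// ?nnegrE// expr1n real_normK ?num_real//.
apply: le_trans v1; rewrite (bigD1 i)//= lerDl sumr_ge0// => j _; exact: sqr_ge0.
Qed.

Section design.
Context {R : realType}.

(** The arguments 1 and 4 come from [l1_exp_moment_lb]. The levels are tuned so that
    [4 exp(-l1_up)], [(1 - rate1) exp(l1_low)] and [2 exp(-row_up / 4)] are all at most
    [exp(-rate1 / 2)]: the three parts of [design_defect] then decay alike. *)
Definition rate1 : R := small_ball_rate 1 4.
Definition l1_low : R := rate1 / 2.
Definition l1_up : R := 2 + rate1 / 2.
(** Above [4 l1_up / l1_low], so that the rounding error in [l1_design_lb] is at most half of the
    lower bound, and at least 2 for the absorption in [l1_design_ub]. *)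
Definition net_size : nat := (Num.truncn (4 * l1_up / l1_low)).+2.
(** By Cauchy-Schwarz an [l1] lower bound [t d] in dimension [d] gives [t^2 d] for the squared
    Euclidean norm. *)
Definition gram_low : R := (l1_low / 2) ^+ 2.
Definition row_up : R := 4 + 2 * rate1.

Lemma rate1_gt0 : 0 < rate1. Proof. exact: small_ball_rate_gt0. Qed.

Lemma l1_low_gt0 : 0 < l1_low. Proof. by rewrite divr_gt0// rate1_gt0. Qed.

Context (n d : nat).

(** Rounding at this mesh produces an error of Euclidean norm at most [1 / net_size], whatever
    [n]. *)
Definition net_mesh : R := (net_size%:R * Num.sqrt n%:R)^-1.
Definition net_point := @lattice_point R n (net_size * n) net_mesh.
Definition net : {set {ffun 'I_n -> bool * 'I_(net_size * n).+1}} :=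
  [set f : {ffun 'I_n -> bool * 'I_(net_size * n).+1} |
    (\sum_i (f i).2 ^ 2 <= net_size ^ 2 * n)%N].

(* Markov terms for the Gaussian design [M]: a value below [1] forces every
   summand below [1], so that [|M^T u|_1] is of order [d] on the net and every
   row has squared norm of order [d]. *)
Definition design_defect (M : 'M[R]_(n, d)) : R :=
  \sum_(f in net) expR (l1_combination M (net_point f) - l1_up * d%:R) +
  \sum_(f in net | 1 / 4 <= \sum_i net_point f i 0 ^+ 2)
    expR (l1_low * d%:R - l1_combination M (net_point f)) +
  \sum_i expR (\sum_k M i k ^+ 2 / 4 - row_up / 4 * d%:R).

Hypothesis n0 : (0 < n)%N.

Let K0 : (0 : R) < net_size%:R.
Proof. by rewrite ltr0n. Qed.

Let sn0 : (0 : R) < Num.sqrt n%:R.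
Proof. by rewrite sqrtr_gt0 ltr0n. Qed.

Let h0 : 0 < net_mesh.
Proof. by rewrite invr_gt0 mulr_gt0. Qed.

Let hK : n%:R * net_mesh ^+ 2 = net_size%:R ^- 2.
Proof.
rewrite /net_mesh exprVn exprMn sqr_sqrtr// invfM mulrCA divff ?mulr1//.
by rewrite pnatr_eq0 -lt0n.
Qed.

Let hB : net_mesh^-1 <= (net_size * n)%:R.
Proof.
rewrite /net_mesh invrK natrM ler_pM2l//.
have s1 : (1 : R) <= Num.sqrt n%:R by rewrite -[leLHS]sqrtr1 ler_sqrt// ler1n.
by rewrite -[leRHS](@sqr_sqrtr R)// expr2 ler_peMl// ltW.
Qed.

Let net_sqr f : \sum_i net_point f i 0 ^+ 2 = net_mesh ^+ 2 * (\sum_i (f i).2 ^ 2)%N%:R.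
Proof.
rewrite natr_sum mulr_sumr; apply: eq_bigr => i _.
by rewrite mxE !exprMn sqrr_sign mul1r natrX.
Qed.

Lemma net_le1 f : (f \in net) = (\sum_i net_point f i 0 ^+ 2 <= 1).
Proof.
rewrite net_sqr inE -(ler_nat R) -ler_pdivlMl ?exprn_gt0// mulr1.
rewrite /net_mesh exprVn invrK exprMn sqr_sqrtr//.
by rewrite natrM natrX.
Qed.

Let approx (v : 'cV[R]_n) : \sum_i v i 0 ^+ 2 <= 1 -> exists2 f, f \in net &
  (forall i, `|v i 0 - net_point f i 0| <= net_mesh).
Proof.
move=> v1; have [f Hf] := lattice_approx h0 hB (entry_le1 v1).
exists f => [|i]; last by case: (Hf i).
rewrite net_le1; apply: le_trans v1; apply: sum_sqr_approx_ub => i.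
by case: (Hf i).
Qed.

Context (M : 'M[R]_(n, d)).
Hypothesis M1 : design_defect M < 1.

Let defect_terms : [/\ forall f, f \in net -> l1_combination M (net_point f) <= l1_up * d%:R,
  forall f, f \in net -> 1 / 4 <= \sum_i net_point f i 0 ^+ 2 ->
    l1_low * d%:R <= l1_combination M (net_point f) &
  forall i, \sum_k M i k ^+ 2 <= row_up * d%:R].
Proof.
move: M1; rewrite /design_defect.
set S1 := \sum_(f in net) _; set S2 := \sum_(f in net | _) _; set S3 := \sum_i _ => S.
have S10 : 0 <= S1 by apply: sumr_ge0 => *; exact: expR_ge0.
have S20 : 0 <= S2 by apply: sumr_ge0 => *; exact: expR_ge0.
have S30 : 0 <= S3 by apply: sumr_ge0 => *; exact: expR_ge0.
have lt0 (t : R) : expR t < 1 -> t < 0 by rewrite -[ltRHS]expR0 ltr_expR.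
split=> [f fN|f fN f4|i].
- have : expR (l1_combination M (net_point f) - l1_up * d%:R) <= S1.
    by rewrite /S1 (bigD1 f)//= lerDl sumr_ge0// => *; exact: expR_ge0.
  by move=> H; rewrite -subr_le0 ltW// lt0//; lra.
- have : expR (l1_low * d%:R - l1_combination M (net_point f)) <= S2.
    rewrite /S2 (bigD1 f)/=; last by rewrite fN f4.
    by rewrite lerDl sumr_ge0// => *; exact: expR_ge0.
  by move=> H; rewrite -subr_le0 ltW// lt0//; lra.
- have : expR (\sum_k M i k ^+ 2 / 4 - row_up / 4 * d%:R) <= S3.
    by rewrite /S3 (bigD1 i)//= lerDl sumr_ge0// => *; exact: expR_ge0.
  move=> H; have : \sum_k M i k ^+ 2 / 4 - row_up / 4 * d%:R < 0 by apply: lt0; lra.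
  by rewrite -mulr_suml; lra.
Qed.

Let error_sqr (e : 'cV[R]_n) : (forall i, `|e i 0| <= net_mesh) ->
  \sum_i (net_size%:R *: e) i 0 ^+ 2 <= 1.
Proof.
move=> He; under eq_bigr do rewrite mxE exprMn.
rewrite -mulr_sumr -ler_pdivlMl ?exprn_gt0// mulr1 -hK.
rewrite mulr_natl -[X in _ *+ X](card_ord n) -sumr_const; apply: ler_sum => i _.
by rewrite -(real_normK (num_real _)); apply: lerXn2r; rewrite ?nnegrE// ltW.
Qed.

Let l1_error (s : R) (e : 'cV[R]_n) :
  (forall v : 'cV[R]_n, \sum_i v i 0 ^+ 2 <= 1 -> l1_combination M v <= s) ->
  (forall i, `|e i 0| <= net_mesh) -> l1_combination M e <= s / net_size%:R.
Proof.
move=> Hs He; have := Hs _ (error_sqr He).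
by rewrite l1_combinationZ (ger0_norm (ltW K0)) mulrC -ler_pdivlMr.
Qed.

(** Absorption: the supremum over the ball is at most the bound on the net plus [1 / net_size] times
    itself. A crude bound shows it finite, so it can be subtracted. *)
Lemma l1_design_ub (v : 'cV[R]_n) : \sum_i v i 0 ^+ 2 <= 1 ->
  l1_combination M v <= 2 * l1_up * d%:R.
Proof.
have [Hup _ _] := defect_terms.
pose A := [set l1_combination M v | v in [set v : 'cV[R]_n | \sum_i v i 0 ^+ 2 <= 1]].
have A0 : A !=set0.
  exists (l1_combination M 0), 0 => //=.
  by rewrite big1// => i _; rewrite mxE expr0n.
have Aub : has_ubound A.
  exists (\sum_k \sum_i `|M i k|) => _ [u /= u1 <-].
  apply: ler_sum => k _; apply: le_trans (ler_norm_sum _ _ _) _.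
  by apply: ler_sum => i _; rewrite normrM ler_piMl// entry_le1.
have As (u : 'cV[R]_n) : \sum_i u i 0 ^+ 2 <= 1 -> l1_combination M u <= sup A.
  by move=> u1; apply: ub_le_sup => //; exists u.
move=> v1; apply: le_trans (As _ v1) _.
have s0 : 0 <= sup A by apply: le_trans (As _ v1); exact: l1_combination_ge0.
suff : sup A <= l1_up * d%:R + sup A / 2 by lra.
apply: ge_sup => // _ [u /= u1 <-].
have [f fN Hf] := approx u1.
rewrite -[X in l1_combination _ X](subrK (net_point f)) addrC.
apply: le_trans (l1_combinationD _ _ _) _; apply: lerD; first exact: Hup.
have He i : `|(u - net_point f) i 0| <= net_mesh by rewrite !mxE; have := Hf i; rewrite mxE.
apply: le_trans (l1_error As He) _.
by rewrite ler_wpM2l// lef_pV2 ?posrE// ler_nat.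
Qed.

Lemma l1_design_lb (v : 'cV[R]_n) : \sum_i v i 0 ^+ 2 = 1 ->
  l1_low / 2 * d%:R <= l1_combination M v.
Proof.
move=> v1; have [_ Hlow _] := defect_terms.
have v1' : \sum_i v i 0 ^+ 2 <= 1 by rewrite v1.
have [f fN Hf] := approx v1'.
(* A unit vector leaves its net point a squared norm of at least [1/2 - 1/net_size^2]. *)
have f4 : 1 / 4 <= \sum_i net_point f i 0 ^+ 2.
  have := sum_sqr_approx_lb h0 Hf; rewrite v1 hK.
  have : (net_size%:R : R) ^- 2 <= 4^-1.
    rewrite lef_pV2 ?posrE ?exprn_gt0// -natrX ler_nat.
    by rewrite (_ : 4 = 2 ^ 2)%N// leq_exp2r.
  lra.
have := Hlow f fN f4.
have He i : `|(net_point f - v) i 0| <= net_mesh by rewrite !mxE distrC; have := Hf i; rewrite mxE.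
have := l1_combinationD M v (net_point f - v); rewrite [v + _]addrC subrK.
have := l1_error (s := 2 * l1_up * d%:R) (fun u => @l1_design_ub u) He.
have : 2 * l1_up * d%:R / net_size%:R <= l1_low / 2 * d%:R.
  have : 2 * l1_up / net_size%:R <= l1_low / 2.
    rewrite ler_pdivrMr// -ler_pdivrMl ?divr_gt0 ?l1_low_gt0//.
    have -> : (l1_low / 2)^-1 * (2 * l1_up) = 4 * l1_up / l1_low by field; rewrite gt_eqF// l1_low_gt0.
    have : 4 * l1_up / l1_low < (Num.truncn (4 * l1_up / l1_low)).+1%:R.
      exact: truncnS_gt.
    rewrite /net_size => /ltW/le_trans; apply.
    by rewrite ler_nat.
  have d0 : (0 : R) <= d%:R by [].
  by move=> H; rewrite mulrAC ler_wpM2r.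
lra.
Qed.

Lemma design_gram_lb (u : 'cV[R]_n) :
  gram_low * d%:R * (\sum_i u i 0 ^+ 2) <= \sum_k (\sum_i u i 0 * M i k) ^+ 2.
Proof.
set S := \sum_i _.
have S0 : 0 <= S by apply: sumr_ge0 => i _; exact: sqr_ge0.
have [->|Sn0] := eqVneq S 0.
  by rewrite mulr0 sumr_ge0// => k _; exact: sqr_ge0.
have Sp : 0 < S by rewrite lt_neqAle eq_sym Sn0.
pose v := (Num.sqrt S)^-1 *: u.
have v1 : \sum_i v i 0 ^+ 2 = 1.
  under eq_bigr do rewrite mxE exprMn.
  by rewrite -mulr_sumr exprVn sqr_sqrtr// mulVf.
have uE k : (\sum_i u i 0 * M i k) ^+ 2 = S * (\sum_i v i 0 * M i k) ^+ 2.
  under [in RHS]eq_bigr do rewrite mxE -mulrA.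
  by rewrite -mulr_sumr exprMn exprVn sqr_sqrtr// mulrA divff// mul1r.
under [leRHS]eq_bigr do rewrite uE.
rewrite -mulr_sumr mulrC ler_pM2l//.
have := l1_design_lb v1; rewrite /l1_combination.
set t := l1_low / 2; rewrite /gram_low -/t => H.
have t0 : 0 < t by rewrite divr_gt0// l1_low_gt0.
(* Cauchy-Schwarz in the linear form [a^2 >= 2 t a - t^2], coordinate by coordinate. *)
apply: (@le_trans _ _ (\sum_(k < d) (2 * t * `|\sum_i v i 0 * M i k| - t ^+ 2))).
  rewrite big_split/= sumrN sumr_const card_ord -mulr_sumr -[t ^+ 2 *+ d]mulr_natr.
  by have := ler_wpM2l (ltW t0) H; lra.
apply: ler_sum => k _; rewrite -[leRHS](real_normK (num_real _)).
by move: `|_| => a; have := sqr_ge0 (a - t); lra.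
Qed.

Lemma design_row_ub i : \sum_k M i k ^+ 2 <= row_up * d%:R.
Proof. by have [_ _] := defect_terms; exact. Qed.

End design.

Lemma ge0_integral_sum_le (R : realType) disp (T : measurableType disp) (P : probability T R)
    (I : finType) (A : pred I) (g : I -> T -> R) (c : R) :
  (forall i w, 0 <= g i w) -> (forall i, measurable_fun setT (g i)) ->
  (forall i, A i -> (\int[P]_w (g i w)%:E <= c%:E)%E) ->
  (\int[P]_w (\sum_(i | A i) g i w)%:E <= (#|A|%:R * c)%:E)%E.
Proof.
move=> g0 mg gc.
under eq_integral do rewrite -sumEFin -big_filter.
rewrite ge0_integral_sum//; last 2 first.
- by move=> i; exact/measurable_EFinP.
- by move=> i w _; rewrite lee_fin.
have -> : #|A|%:R * c = \sum_(i | A i) c by rewrite sumr_const mulr_natl.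
by rewrite -sumEFin big_filter; apply: lee_sum => i; exact: gc.
Qed.

Section defect.
Context {R : realType}.

Lemma measurable_l1_combination n d (u : 'cV[R]_n) :
  measurable_fun setT (fun M : mxspace R n d => l1_combination M u).
Proof.
apply: measurable_sum => k; apply: measurableT_comp => //.
apply: measurable_sum => i; apply: measurable_funM => //; exact: measurable_entry.
Qed.

Lemma measurable_design_defect n d :
  measurable_fun setT (fun M : mxspace R n d => design_defect M).
Proof.
have msum (I : finType) (A : pred I) (g : I -> mxspace R n d -> R) :
    (forall i, measurable_fun setT (g i)) -> measurable_fun setT (fun M => \sum_(i | A i) g i M).
  move=> mg; under eq_fun do rewrite -big_filter.
  exact: measurable_sum.
apply: measurable_funD; first apply: measurable_funD; apply: msum => i; apply: measurableT_comp => //;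
  apply: measurable_funB => //; try exact: measurable_l1_combination.
apply: measurable_sum => k; apply: measurable_funM => //; apply: measurable_funX.
exact: measurable_entry.
Qed.

Definition net_rate : R := 4 * 2 ^+ (@net_size R ^ 2).

Lemma net_rate_gt1 : 1 < net_rate.
Proof.
have : (1 : R) <= 2 ^+ (@net_size R ^ 2) by apply: exprn_ege1; lra.
rewrite /net_rate; lra.
Qed.

Context disp (T : measurableType disp) (P : probability T R).
Context (n d : nat) (x : 'I_n -> T -> 'cV[R]_d).
Hypotheses (n0 : (0 < n)%N) (xG : forall i, isotropic_gaussian P 1 (x i))
  (xI : mutually_independent P (fun i => sigma_mx (x i))).

Lemma measurable_row_matrix : measurable_fun setT (row_matrix x : T -> mxspace R n d).
Proof.
apply: measurable_mxspace => i k; under eq_fun do rewrite mxE.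
exact: (isotropic_random_matrix (xG i)).
Qed.

Lemma expectation_design_defect :
  (\int[P]_w (design_defect (row_matrix x w))%:E <=
   (3 * (net_rate ^+ n * expR (- (@rate1 R / 2 * d%:R))))%:E)%E.
Proof.
set q := expR _.
have q0 : 0 <= q by exact: expR_ge0.
have mrow := measurable_row_matrix.
have ml1 u : measurable_fun setT (fun w => l1_combination (row_matrix x w) u).
  exact: (measurableT_comp (measurable_l1_combination u) mrow).
have e2 : (4 : R) * expR (- 2) <= 1.
  have e1 : (2 : R) <= expR 1 by have := expR_ge1Dx (1 : R); lra.
  rewrite expRN ler_pdivrMr ?expR_gt0// mul1r.
  rewrite (_ : (2 : R) = 1 + 1); last lra.
  by rewrite expRD; nra.
(* The common Chernoff step: a moment bound [a ^+ d] against a level [b * d], for constants with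
   [a * expR (- b) <= expR (- (rate1 / 2))]. *)
have step a b (g : T -> R) : measurable_fun setT g -> (forall w, 0 <= expR (g w)) -> 
    (\int[P]_w (expR (g w))%:E <= (a ^+ d)%:E)%E -> 0 <= a -> a * expR (- b) <= expR (- (@rate1 R / 2)) ->
    (\int[P]_w (expR (g w - b * d%:R))%:E <= q%:E)%E.
  move=> mg g0 ga a0 ab.
  under eq_integral do rewrite expRD mulrC EFinM.
  rewrite ge0_integralZl//; last by apply/measurable_EFinP; exact: measurableT_comp.
  apply: (@le_trans _ _ ((expR (- (b * d%:R)))%:E * (a ^+ d)%:E)%E).
    by rewrite lee_wpmul2l// lee_fin expR_ge0.
  have E t : expR (- (t * d%:R)) = expR (- t) ^+ d by rewrite -mulNr expRM_natr.
  rewrite -EFinM lee_fin /q !E -exprMn; apply: lerXn2r => //.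
  - by rewrite nnegrE mulr_ge0// expR_ge0.
  - by rewrite nnegrE expR_ge0.
  - by rewrite mulrC.
have B1 f : \sum_i (net_point f : 'cV[R]_n) i 0 ^+ 2 <= 1 ->
   (\int[P]_w (expR (l1_combination (row_matrix x w) (net_point f) - l1_up * d%:R))%:E <= q%:E)%E.
  move=> f1; apply: (step 4) => //.
  - exact: l1_exp_moment_ub.
  - rewrite /l1_up opprD expRD mulrA ler_piMl ?expR_ge0//.
have B2 f : 1 / 4 <= \sum_i (net_point f : 'cV[R]_n) i 0 ^+ 2 ->
   (\int[P]_w (expR (l1_low * d%:R - l1_combination (row_matrix x w) (net_point f)))%:E <= q%:E)%E.
  move=> f1; under eq_integral do rewrite addrC -[X in _ + X]opprK -mulNr.
  have r1 : 1 - @rate1 R <= expR (- rate1) by apply: expR_ge1Dx.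
  have r0 : 0 <= 1 - @rate1 R.
    rewrite subr_ge0 /rate1 /small_ball_rate.
    rewrite ler_pdivrMr; have := expR_gt0 (4 : R); lra.
  apply: (step (1 - rate1)) => //.
  - exact: measurableT_comp.
  - exact: l1_exp_moment_lb.
  - rewrite opprK; apply: (@le_trans _ _ (expR (- rate1) * expR l1_low)).
      by rewrite ler_wpM2r// expR_ge0.
    by rewrite -expRD ler_expR /l1_low; lra.
have B3 i : (\int[P]_w (expR (\sum_k row_matrix x w i k ^+ 2 / 4 - row_up / 4 * d%:R))%:E <= q%:E)%E.
  have E w : \sum_k row_matrix x w i k ^+ 2 / 4 = \sum_k x i w k 0 ^+ 2 / 4.
    by apply: eq_bigr => k _; rewrite mxE.
  under eq_integral do rewrite E.
  apply: (step 2) => //.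
  - apply: measurable_sum => k; apply: measurable_funM => //; apply: measurable_funX.
    exact: (isotropic_random_matrix (xG i)).
  - exact: row_exp_moment.
  - rewrite /row_up (_ : - ((4 + 2 * rate1) / 4) = - 1 + - (rate1 / 2) :> R); last lra.
    rewrite expRD mulrA ler_piMl ?expR_ge0// expRN ler_pdivrMr ?expR_gt0// mul1r.
    by have := expR_ge1Dx (1 : R); lra.
have netc : (#|net (R := R) n|%:R : R) <= net_rate ^+ n.
  exact: (card_lattice_ball R n (@net_size R * n) (@net_size R ^ 2)).
(* A generous count of the row terms, so that all three parts of the defect share one bound. *)
have nc : (n%:R : R) <= net_rate ^+ n.
  apply: (@le_trans _ _ (2 ^+ n)); first by rewrite -natrX ler_nat ltnW// ltn_expl.
  apply: lerXn2r; rewrite ?nnegrE//; first by have := net_rate_gt1; lra.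
  have : (1 : R) <= 2 ^+ (@net_size R ^ 2) by apply: exprn_ege1; lra.
  rewrite /net_rate; lra.
pose S1 w := \sum_(f in net n) expR (l1_combination (row_matrix x w) (net_point f) - @l1_up R * d%:R).
pose S2 w := \sum_(f in net n | 1 / 4 <= \sum_i (net_point f : 'cV[R]_n) i 0 ^+ 2)
    expR (@l1_low R * d%:R - l1_combination (row_matrix x w) (net_point f)).
pose S3 w := \sum_i expR (\sum_k row_matrix x w i k ^+ 2 / 4 - @row_up R / 4 * d%:R).
have msum (I : finType) (A : pred I) (g : I -> T -> R) :
    (forall i, measurable_fun setT (g i)) -> measurable_fun setT (fun w => \sum_(i | A i) g i w).
  move=> mg; under eq_fun do rewrite -big_filter.
  exact: measurable_sum.
have mrowE i k : measurable_fun setT (fun w => row_matrix x w i k).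
  exact: (measurableT_comp (measurable_entry i k) mrow).
have m1 f : measurable_fun setT (fun w => expR (l1_combination (row_matrix x w) (net_point f) - @l1_up R * d%:R)).
  by apply: measurableT_comp => //; exact: measurable_funB.
have m2 f : measurable_fun setT (fun w => expR (@l1_low R * d%:R - l1_combination (row_matrix x w) (net_point f))).
  by apply: measurableT_comp => //; exact: measurable_funB.
have m3 i : measurable_fun setT (fun w => expR (\sum_k row_matrix x w i k ^+ 2 / 4 - @row_up R / 4 * d%:R)).
  apply: measurableT_comp => //; apply: measurable_funB => //; apply: measurable_sum => k.
  by apply: measurable_funM => //; exact: measurable_funX.
have I1 : (\int[P]_w (S1 w)%:E <= (net_rate ^+ n * q)%:E)%E.
  apply: (le_trans (ge0_integral_sum_le (g := fun f w => expR (l1_combination (row_matrix x w) (net_point f) - @l1_up R * d%:R)) (c := q) _ m1 _)).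
  - by move=> f w; exact: expR_ge0.
  - by move=> f fN; apply: B1; rewrite -net_le1.
  - by rewrite lee_fin ler_wpM2r.
have I2 : (\int[P]_w (S2 w)%:E <= (net_rate ^+ n * q)%:E)%E.
  apply: (le_trans (ge0_integral_sum_le (g := fun f w => expR (@l1_low R * d%:R - l1_combination (row_matrix x w) (net_point f))) (c := q) _ m2 _)).
  - by move=> f w; exact: expR_ge0.
  - by move=> f /andP[_]; exact: B2.
  - rewrite lee_fin ler_wpM2r//; apply: le_trans netc; rewrite ler_nat.
    by apply: subset_leq_card; apply/fintype.subsetP => f /andP[].
have I3 : (\int[P]_w (S3 w)%:E <= (net_rate ^+ n * q)%:E)%E.
  apply: (le_trans (ge0_integral_sum_le (g := fun i w => expR (\sum_k row_matrix x w i k ^+ 2 / 4 - @row_up R / 4 * d%:R)) (c := q) _ m3 _)).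
  - by move=> f w; exact: expR_ge0.
  - by move=> i _; exact: B3.
  - by rewrite lee_fin ler_wpM2r// card_ord.
have S10 w : 0 <= S1 w by apply: sumr_ge0 => *; exact: expR_ge0.
have S20 w : 0 <= S2 w by apply: sumr_ge0 => *; exact: expR_ge0.
have S30 w : 0 <= S3 w by apply: sumr_ge0 => *; exact: expR_ge0.
have mS1 : measurable_fun setT S1 by exact: msum.
have mS2 : measurable_fun setT S2 by exact: msum.
have mS3 : measurable_fun setT S3 by exact: msum.
rewrite (eq_integral (fun w => (S1 w)%:E + (S2 w)%:E + (S3 w)%:E)%E)//.
rewrite ge0_integralD//; last 4 first.
- by move=> w _; rewrite -EFinD lee_fin addr_ge0.
- by apply/measurable_EFinP; exact: measurable_funD.
- by move=> w _; rewrite lee_fin.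
- exact/measurable_EFinP.
rewrite ge0_integralD//; last 4 first.
- by move=> w _; rewrite lee_fin.
- exact/measurable_EFinP.
- by move=> w _; rewrite lee_fin.
- exact/measurable_EFinP.
set B := net_rate ^+ n * q in I1 I2 I3 *.
rewrite (_ : 3 * B = B + B + B); last lra.
by rewrite 2!EFinD; do 2 (apply: leeD => //).
Qed.

End defect.

(** * The random features *)

Section tanh.
Context {R : realType}.
Implicit Types a b t y v C : R.

Lemma tanhN t : tanh (- t) = - tanh t.
Proof. by rewrite /tanh opprK -[RHS]mulNr opprB; congr (_ / _); exact: addrC. Qed.

Lemma measurable_tanh : measurable_fun setT (@tanh R).
Proof.
have mN : measurable_fun setT (fun t : R => expR (- t)) by apply: measurableT_comp.
(* The quotient is written with [expR (- ln _)], so that measurability follows by composition. *)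
rewrite (_ : tanh = fun t => (expR t - expR (- t)) * expR (- ln (expR t + expR (- t)))).
  apply: measurable_funM; first exact: measurable_funB.
  do 2 apply: measurableT_comp => //.
  exact: (measurableT_comp (@measurable_ln R) (measurable_funD (@measurable_expR R) mN)).
apply/funext => t; rewrite /tanh; congr (_ * _).
by rewrite [RHS]expRN lnK// posrE addr_gt0// expR_gt0.
Qed.

Lemma tanh_le1 t : `|tanh t| <= 1.
Proof.
have e1 := expR_gt0 t; have e2 := expR_gt0 (- t).
rewrite /tanh normrM normfV [X in _ / X]gtr0_norm ?addr_gt0//.
rewrite ler_pdivrMr ?addr_gt0// mul1r ler_norml; apply/andP; split; lra.
Qed.

Lemma tanhB a b : tanh a - tanh b =
  2 * (expR (a - b) - expR (b - a)) / ((expR a + expR (- a)) * (expR b + expR (- b))).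
Proof.
rewrite /tanh !expRD !expRN; have a0 := expR_gt0 a; have b0 := expR_gt0 b.
field; rewrite !gt_eqF//= -?expr2 ?addr_gt0 ?exprn_gt0//.
Qed.

(** By [tanhB], an increment [v] in [[0, 1]] at [|y| <= C] raises [tanh] by at least
    [2 v / (2 e^(C+1))^2], since both arguments stay in [[-(C+1), C+1]]. *)
Definition tanh_slope C := expR (- 2 * (C + 1)) / 2.

Lemma tanh_slope_gt0 C : 0 < tanh_slope C.
Proof. by rewrite divr_gt0// expR_gt0. Qed.

Let sinh_ge t : 0 <= t -> t <= expR t - expR (- t).
Proof.
move=> t0; have h1 := expR_ge1Dx t; have : expR (- t) <= 1 by rewrite -expR0 ler_expR; lra.
lra.
Qed.

Let cosh_le C a : `|a| <= C -> expR a + expR (- a) <= 2 * expR C.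
Proof.
rewrite ler_norml => /andP[? ?].
have : expR a <= expR C by rewrite ler_expR.
have : expR (- a) <= expR C by rewrite ler_expR; lra.
lra.
Qed.

Let tanh_incr0 C y v : 0 <= v -> v <= 1 ->
  0 <= tanh (y + v) - tanh y /\ (`|y| <= C -> tanh_slope C * v <= tanh (y + v) - tanh y).
Proof.
move=> v0 v1; rewrite tanhB.
have -> : y + v - y = v by lra.
have -> : y - (y + v) = - v by lra.
have s1 := sinh_ge v0.
have p1 : 0 < expR (y + v) + expR (- (y + v)) by rewrite addr_gt0// expR_gt0.
have p2 : 0 < expR y + expR (- y) by rewrite addr_gt0// expR_gt0.
split.
  by apply: divr_ge0; [lra|apply: mulr_ge0; exact: ltW].
move=> yC.
have c1 : expR (y + v) + expR (- (y + v)) <= 2 * expR (C + 1).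
  apply: cosh_le; apply: le_trans (ler_normD _ _) _; rewrite (ger0_norm v0); lra.
have c2 : expR y + expR (- y) <= 2 * expR (C + 1).
  apply: cosh_le; lra.
rewrite ler_pdivlMr ?mulr_gt0//.
apply: (@le_trans _ _ (tanh_slope C * v * ((2 * expR (C + 1)) * (2 * expR (C + 1))))).
  rewrite ler_wpM2l//; first by rewrite mulr_ge0// ltW// tanh_slope_gt0.
  by apply: ler_pM => //; exact: ltW.
have E : expR (- 2 * (C + 1)) * (expR (C + 1) * expR (C + 1)) = 1.
  by rewrite -!expRD -[RHS]expR0; congr expR; lra.
have -> : tanh_slope C * v * ((2 * expR (C + 1)) * (2 * expR (C + 1))) =
   2 * v * (expR (- 2 * (C + 1)) * (expR (C + 1) * expR (C + 1))) by rewrite /tanh_slope; field.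
by rewrite E; lra.
Qed.

Lemma tanh_increment C y v : `|v| <= 1 ->
  0 <= v * (tanh (y + v) - tanh y) /\
  (`|y| <= C -> tanh_slope C * v ^+ 2 <= v * (tanh (y + v) - tanh y)).
Proof.
have [v0 v1|v0 v1] := ger0P v.
  have [h1 h2] := @tanh_incr0 C y v v0 v1; split; first exact: mulr_ge0.
  by move=> /h2 h; rewrite expr2 mulrCA ler_wpM2l.
have vN0 : 0 <= - v by lra.
have [] := @tanh_incr0 C (- y) (- v) vN0 v1.
rewrite -opprD !tanhN normrN => h1 h2.
have -> : v * (tanh (y + v) - tanh y) = - v * (- tanh (y + v) - - tanh y) by lra.
split; first exact: mulr_ge0.
by move=> /h2 h; rewrite -sqrrN expr2 mulrCA ler_wpM2l.
Qed.

(* A lower bound for the indicator of [|t| <= C] whose Gaussian expectation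
   reduces to exponential moments. *)
Definition cutoff C t := Num.max 0 (1 - expR (- C) * (expR t + expR (- t))).

Lemma measurable_cutoff C : measurable_fun setT (cutoff C).
Proof.
apply: measurable_maxr => //; apply: measurable_funB => //; apply: measurable_funM => //.
by apply: measurable_funD => //; exact: measurableT_comp.
Qed.

Lemma cutoff_ge0 C t : 0 <= cutoff C t.
Proof. by rewrite le_max lexx. Qed.

Lemma cutoff_le1 C t : cutoff C t <= 1.
Proof.
rewrite ge_max ler01 gerBl mulr_ge0 ?expR_ge0// addr_ge0// expR_ge0.
Qed.

(** For [|y| > C] the cutoff vanishes and monotonicity of [tanh] suffices; for [|y| <= C] the cutoff
    is at most 1. *)
Lemma tanh_increment_cutoff C y v : `|v| <= 1 ->
  tanh_slope C * v ^+ 2 * cutoff C y <= v * (tanh (y + v) - tanh y).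
Proof.
move=> v1; have [h1 h2] := @tanh_increment C y v v1.
have s0 := tanh_slope_gt0 C.
have [yC|yC] := leP `|y| C.
  apply: le_trans (h2 yC); rewrite ler_piMr ?cutoff_le1//.
  by rewrite mulr_ge0 ?sqr_ge0// ltW.
rewrite /cutoff max_l ?mulr0//.
have : expR `|y| <= expR y + expR (- y).
  by case: (ger0P y) => _; rewrite ?lerDl ?lerDr expR_ge0.
have : expR C <= expR `|y| by rewrite ler_expR ltW.
move=> c1 c2; rewrite subr_le0.
apply: (@le_trans _ _ (expR (- C) * expR C)); first by rewrite -expRD addNr expR0.
rewrite ler_wpM2l ?expR_ge0//; lra.
Qed.

End tanh.

(** * Small balls for the features of one Gaussian weight, with the design fixed *)

Section weight_small_ball.
Context {R : realType}.

(** For a good design [(M W)_i] has variance at most [row_up], so [exp(-cut_level)] times either of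
    its moments [E exp(+-(M W)_i)] is at most [exp(-2) <= 1/4]; the two signs leave the cutoff a
    mean of at least 1/2. *)
Definition cut_level : R := @row_up R / 2 + 2.
(** The slope times the least squared norm 1/4 of [v] times the least mean 1/2 of the cutoff. The
    other argument of [rate2] is the cost [d |b|^2 <= 1 / gram_low] of the translation found in
    [design_solve]. *)
Definition feature_gain : R := tanh_slope cut_level / 8.
Definition rate2 : R := small_ball_rate feature_gain (@gram_low R)^-1.

Lemma feature_gain_gt0 : 0 < feature_gain.
Proof. by rewrite divr_gt0// tanh_slope_gt0. Qed.

Lemma rate2_gt0 : 0 < rate2.
Proof. exact/small_ball_rate_gt0/feature_gain_gt0. Qed.

Lemma rate2_lt1 : rate2 < 1.
Proof.
apply: (le_lt_trans (small_ball_rate_le _ feature_gain_gt0)).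
have : expR (- 2 * (cut_level + 1)) <= 1.
  rewrite -[leRHS]expR0 ler_expR /cut_level /row_up; have := rate1_gt0 (R := R); lra.
rewrite /feature_gain /tanh_slope; lra.
Qed.

Definition feature_combination n d (M : 'M[R]_(n, d)) (v : 'cV[R]_n) (y : 'cV[R]_d) : R :=
  \sum_i v i 0 * tanh ((M *m y) i 0).

Lemma gram_low_gt0 : 0 < @gram_low R.
Proof. by rewrite exprn_gt0// divr_gt0// l1_low_gt0. Qed.

Context (n d : nat) (M : 'M[R]_(n, d)).
Hypotheses (n0 : (0 < n)%N) (d0 : (0 < d)%N) (M1 : design_defect M < 1).

(** With [u = (M M^T)^-1 v], the vector [b = M^T u] has squared norm [<u, v>], which the spectral
    lower bound of [design_gram_lb] controls. *)
Lemma design_solve (v : 'cV[R]_n) : exists2 b : 'cV[R]_d, M *m b = v &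
  d%:R * \sum_k b k 0 ^+ 2 <= \sum_i v i 0 ^+ 2 / @gram_low R.
Proof.
have dR : (0 : R) < d%:R by rewrite ltr0n.
have g0 := gram_low_gt0.
have bE (u : 'cV[R]_n) k : (M^T *m u) k 0 = \sum_i u i 0 * M i k.
  by rewrite mxE; apply: eq_bigr => i _; rewrite mxE mulrC.
have QE (u : 'cV[R]_n) : \sum_k (M^T *m u) k 0 ^+ 2 = \sum_i u i 0 * (M *m (M^T *m u)) i 0.
  transitivity (((M^T *m u)^T *m (M^T *m u)) 0 0).
    by rewrite mxE; apply: eq_bigr => k _; rewrite [in RHS]mxE expr2.
  rewrite trmx_mul trmxK -mulmxA mxE; apply: eq_bigr => i _; by rewrite mxE.
have lb (u : 'cV[R]_n) : @gram_low R * d%:R * \sum_i u i 0 ^+ 2 <= \sum_k (M^T *m u) k 0 ^+ 2.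
  by under [leRHS]eq_bigr do rewrite bE; exact: design_gram_lb.
have Gu : M *m M^T \in unitmx.
  rewrite -row_free_unit; apply: inj_row_free => r rG.
  have rG' : M *m (M^T *m r^T) = 0.
    by rewrite mulmxA; have := congr1 trmx rG; rewrite !trmx_mul trmxK trmx0.
  have := lb r^T; rewrite QE rG'.
  rewrite [leRHS]big1 => [|i _]; last by rewrite [X in _ * X]mxE mulr0.
  rewrite pmulr_rle0 ?mulr_gt0// => S0.
  apply/matrixP => i j; rewrite (ord1 i) [RHS]mxE; apply/eqP.
  have : r 0 j ^+ 2 <= 0.
    apply: le_trans S0; rewrite (bigD1 j)//= mxE lerDl sumr_ge0// => ? _; exact: sqr_ge0.
  by rewrite -sqrf_eq0 eq_le sqr_ge0 andbT.
pose u := invmx (M *m M^T) *m v.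
have Mu : M *m (M^T *m u) = v by rewrite mulmxA /u mulKVmx.
exists (M^T *m u) => //.
have := lb u; rewrite QE Mu.
set U := \sum_i u i 0 ^+ 2; set V := \sum_i u i 0 * v i 0 => lbU.
rewrite -mulr_suml; set S := \sum_i v i 0 ^+ 2.
pose a := @gram_low R * d%:R; rewrite -/a in lbU.
have a0 : 0 < a by rewrite mulr_gt0.
(* [2 V <= a U + S / a] together with [a U <= V] yields [V <= S / a]. *)
have : 2 * V <= a * U + a^-1 * S.
  rewrite /V /U /S !mulr_sumr -big_split/=; apply: ler_sum => i _.
  rewrite -subr_ge0 (_ : _ - _ = a^-1 * (a * u i 0 - v i 0) ^+ 2).
    by rewrite mulr_ge0 ?sqr_ge0// invr_ge0 ltW.
  by field; rewrite gt_eqF.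
move=> H; have VS : V <= a^-1 * S by lra.
apply: (le_trans (ler_wpM2l (ltW dR) VS)).
by rewrite (_ : d%:R * _ = S / gram_low)// /a; field; rewrite !gt_eqF.
Qed.

Context disp (T : measurableType disp) (P : probability T R) (W : T -> 'cV[R]_d).
Hypothesis WG : isotropic_gaussian P (d%:R^-1) W.

Let dR : (0 : R) < d%:R.
Proof. by rewrite ltr0n. Qed.

Let s20 : (0 : R) < d%:R^-1.
Proof. by rewrite invr_gt0. Qed.

Let mg i : measurable_fun setT (fun y : mxspace R d 1 => (M *m y) i 0).
Proof.
under eq_fun do rewrite mxE.
by apply: measurable_sum => k; apply: measurable_funM => //; exact: measurable_entry.
Qed.

Let mW : measurable_fun setT (W : T -> mxspace R d 1).
Proof. by apply: measurable_mxspace; exact: (isotropic_random_matrix WG). Qed.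

Let mgW i : measurable_fun setT (fun w => (M *m W w) i 0).
Proof. exact: (measurableT_comp (mg i) mW). Qed.

Let cutoff_expectation i :
  ((2^-1 : R)%:E <= \int[P]_w (cutoff cut_level ((M *m W w) i 0))%:E)%E.
Proof.
have mo (s : R) : (\int[P]_w (expR (s * (M *m W w) i 0))%:E <= (expR (s ^+ 2 * (@row_up R / 2)))%:E)%E.
  pose b : 'cV[R]_d := \col_k (s * M i k).
  have E w : s * (M *m W w) i 0 = \sum_k W w k 0 * b k 0.
    by rewrite mxE mulr_sumr; apply: eq_bigr => k _; rewrite mxE; lra.
  under eq_integral do rewrite E.
  rewrite (isotropic_exp_moment s20 WG) lee_fin ler_expR.
  have := design_row_ub M1 i.
  under [X in _ * X <= _]eq_bigr do rewrite mxE exprMn.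
  rewrite -mulr_suml -mulr_sumr; set S := \sum_k _ => HS.
  rewrite [leLHS](_ : _ = s ^+ 2 * (S / d%:R / 2)); last by field; rewrite gt_eqF.
  rewrite ler_wpM2l ?sqr_ge0// ler_wpM2r//.
  by rewrite ler_pdivrMr.
have m1 (s : R) : measurable_fun setT (fun w => expR (s * (M *m W w) i 0)).
  by apply: measurableT_comp => //; apply: measurable_funM.
have mc : measurable_fun setT (fun w => cutoff cut_level ((M *m W w) i 0)).
  exact: (measurableT_comp (measurable_cutoff _) (mgW i)).
have Zl (c : R) (f : T -> R) : 0 <= c -> measurable_fun setT f -> (forall w, 0 <= f w) ->
    (\int[P]_w (c * f w)%:E = c%:E * \int[P]_w (f w)%:E)%E.
  move=> c0 mf f0; under eq_integral do rewrite EFinM.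
  rewrite ge0_integralZl//; first exact/measurable_EFinP.
  by move=> w _; rewrite lee_fin.
have : (1 <= \int[P]_w ((cutoff cut_level ((M *m W w) i 0))%:E +
   ((expR (- cut_level) * expR (1 * (M *m W w) i 0))%:E + (expR (- cut_level) * expR (- 1 * (M *m W w) i 0))%:E)))%E.
  rewrite -(@probability_setT _ _ _ P) -[leLHS]mul1e -integral_cst//; apply: ge0_le_integral => //.
  - apply/measurable_EFinP; apply: measurable_funD => //; apply: measurable_funD; exact: measurable_funM.
  - move=> w _; rewrite -!EFinD lee_fin -mulrDr mul1r mulN1r.
    by rewrite -lerBlDr /cutoff le_max lexx orbT.
rewrite ge0_integralD//; last 4 first.
- by move=> w _; rewrite lee_fin cutoff_ge0.
- exact/measurable_EFinP.
- by move=> w _; rewrite -EFinD lee_fin addr_ge0// mulr_ge0 ?expR_ge0.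
- by apply/measurable_EFinP; apply: measurable_funD; exact: measurable_funM.
rewrite ge0_integralD//; last 2 first.
- by apply/measurable_EFinP; exact: measurable_funM.
- by apply/measurable_EFinP; exact: measurable_funM.
rewrite !Zl ?expR_ge0//.
set I0 := (\int[P]_w (cutoff _ _)%:E)%E; set I1 := (\int[P]_w _)%E; set I2 := (\int[P]_w (expR (-1 * _))%:E)%E => H.
have e4 : 4 * expR (- 2 : R) <= 1.
  have e1 : (2 : R) <= expR 1 by have := expR_ge1Dx (1 : R); lra.
  rewrite expRN ler_pdivrMr ?expR_gt0// mul1r.
  rewrite (_ : (2 : R) = 1 + 1); last lra.
  by rewrite expRD; nra.
have b1 (I : \bar R) : (I <= (expR (@row_up R / 2))%:E)%E -> ((expR (- cut_level))%:E * I <= (4^-1 : R)%:E)%E.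
  move=> HI; apply: (le_trans (lee_wpmul2l _ HI)); first by rewrite lee_fin expR_ge0.
  rewrite -EFinM lee_fin -expRD /cut_level.
  rewrite (_ : _ + _ = - 2); lra.
have mo1 s : s ^+ 2 = 1 -> (\int[P]_w (expR (s * (M *m W w) i 0))%:E <= (expR (@row_up R / 2))%:E)%E.
  by move=> s1; have := mo s; rewrite s1 mul1r.
have B1 : ((expR (- cut_level))%:E * I1 <= (4^-1 : R)%:E)%E by apply/b1/mo1; rewrite expr1n.
have B2 : ((expR (- cut_level))%:E * I2 <= (4^-1 : R)%:E)%E by apply/b1/mo1; rewrite sqrrN expr1n.
have : (1 <= I0 + ((4^-1 : R)%:E + (4^-1 : R)%:E))%E.
  apply: (le_trans H); rewrite leeD2l//; apply: leeD; [exact: B1|exact: B2].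
rewrite -EFinD -leeBlDr// -EFinB => H2; apply: le_trans H2.
by rewrite lee_fin; lra.
Qed.

Lemma weight_small_ball (v : 'cV[R]_n) :
  1 / 4 <= \sum_i v i 0 ^+ 2 -> \sum_i v i 0 ^+ 2 <= 1 ->
  (\int[P]_w (expR (- `|feature_combination M v (W w)|))%:E <= (1 - rate2)%:E)%E.
Proof.
move=> v4 v1; have [b Mb bv] := design_solve v.
have fg := feature_gain_gt0.
have sl := tanh_slope_gt0 cut_level.
pose D (y : mxspace R d 1) : R :=
  \sum_i (tanh_slope cut_level * v i 0 ^+ 2) * cutoff cut_level ((M *m y) i 0).
have mcut i : measurable_fun setT (fun y : mxspace R d 1 => cutoff cut_level ((M *m y) i 0)).
  exact: (measurableT_comp (measurable_cutoff _) (mg i)).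
have c0 i : 0 <= tanh_slope cut_level * v i 0 ^+ 2 by rewrite mulr_ge0 ?sqr_ge0// ltW.
apply: (small_ball (Y := feature_combination M v) (D := D) (b := b) s20 WG).
- apply: measurable_sum => i; apply: measurable_funM => //.
  exact: (measurableT_comp measurable_tanh (mg i)).
- by apply: measurable_sum => i; apply: measurable_funM.
- exact: fg.
- rewrite invrK -mulr_suml mulrC; apply: le_trans bv _.
  by rewrite -mulr_suml ler_piMl// invr_ge0 ltW// gram_low_gt0.
- by move=> y; apply: sumr_ge0 => i _; rewrite mulr_ge0// cutoff_ge0.
- move=> y.
  (* [small_ball] truncates [|Y|] at 1, so the gain must not exceed 1. *)
  have D1 : D y <= 1.
    apply: (@le_trans _ _ (\sum_i v i 0 ^+ 2)) => //; apply: ler_sum => i _.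
    have : tanh_slope cut_level <= 1.
      rewrite /tanh_slope ler_pdivrMr//.
      have : expR (-2 * (cut_level + 1)) <= 1.
        rewrite -[leRHS]expR0 ler_expR /cut_level /row_up; have := rate1_gt0 (R := R); lra.
      lra.
    have := cutoff_le1 cut_level ((M *m y) i 0); have := cutoff_ge0 cut_level ((M *m y) i 0).
    have := sqr_ge0 (v i 0); move: (v i 0 ^+ 2) (cutoff _ _) (tanh_slope _) sl => a e t t0 a0 e0 e1 t1.
    by rewrite mulrAC ler_piMl// mulr_ile1// ltW.
  have DY : D y <= feature_combination M v (y + b) - feature_combination M v y.
    rewrite /feature_combination -sumrB; apply: ler_sum => i _.
    rewrite -mulrBr mulmxDr Mb [(M *m y + v) i 0]mxE.
    by apply: tanh_increment_cutoff; exact: entry_le1.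
  move: (feature_combination M v (y + b)) (feature_combination M v y) DY => p q DY.
  have := ler_norm p; have := ler_norm (- q); rewrite normrN.
  have := normr_ge0 p; have := normr_ge0 q.
  by case: (leP `|q| 1) => ?; case: (leP `|p| 1) => ?; lra.
- rewrite /D.
  under eq_integral do rewrite -sumEFin.
  rewrite ge0_integral_sum//; last 2 first.
  + move=> i; apply/measurable_EFinP; apply: measurable_funM => //.
    exact: (measurableT_comp (measurable_cutoff _) (mgW i)).
  + by move=> i w _; rewrite lee_fin mulr_ge0// cutoff_ge0.
  apply: (@le_trans _ _ (\sum_i (tanh_slope cut_level * v i 0 ^+ 2)%:E * (2^-1 : R)%:E)%E).
    under eq_bigr do rewrite -EFinM.
    rewrite sumEFin lee_fin -mulr_suml -mulr_sumr /feature_gain; move: (\sum_i _) v4 => S S4.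
    nra.
  apply: lee_sum => i _; under eq_integral do rewrite EFinM.
  rewrite ge0_integralZl//; last 3 first.
  + apply/measurable_EFinP; exact: (measurableT_comp (measurable_cutoff _) (mgW i)).
  + by move=> w _; rewrite lee_fin cutoff_ge0.
  + by rewrite lee_fin.
  by rewrite lee_wpmul2l// lee_fin.
Qed.

End weight_small_ball.

(** [exp t <= 1 / (1 - t) <= 1 + t + 2 t^2] for [|t| <= 1/2]; adding the bounds at [y] and [-y]
    cancels the linear terms. *)
Lemma cosh_quadratic (R : realType) (y : R) : `|y| <= 1 / 2 ->
  expR y + expR (- y) <= 2 * (1 + 2 * y ^+ 2).
Proof.
move=> y2; suff H (t : R) : `|t| <= 1 / 2 -> expR t <= 1 + t + 2 * t ^+ 2.
  have := H y y2; have := H (- y); rewrite normrN sqrrN => /(_ y2); lra.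
rewrite ler_norml => /andP[t1 t2].
rewrite -[expR t]invrK -expRN.
apply: (@le_trans _ _ (1 - t)^-1).
  rewrite lef_pV2 ?posrE ?expR_gt0//; first exact: expR_ge1Dx.
  lra.
rewrite -[leLHS]mul1r ler_pdivrMr; last lra.
have := sqr_ge0 t; nra.
Qed.

Lemma sqr_le_cosh (R : realType) (a : R) : a ^+ 2 <= expR a + expR (- a).
Proof.
suff H (t : R) : 0 <= t -> t ^+ 2 <= expR t.
  case: (ger0P a) => a0.
    by apply: (le_trans (H _ a0)); rewrite lerDl expR_ge0.
  rewrite -sqrrN; apply: (@le_trans _ _ (expR (- a))); last by rewrite lerDr expR_ge0.
  by apply: H; lra.
move=> t0.
(* [t <= (1 + t/4)^2], hence [t^2 <= (1 + t/4)^4 <= exp t]. *)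
have h1 : 1 + t / 4 <= expR (t / 4) by exact: expR_ge1Dx.
have -> : expR t = expR (t / 4) ^+ 4 by rewrite -expRM_natl; congr expR; lra.
apply: (@le_trans _ _ ((1 + t / 4) ^+ 4)).
  rewrite (_ : (1 + t / 4) ^+ 4 = ((1 + t / 4) ^+ 2) ^+ 2); last by rewrite -exprM.
  apply: lerXn2r; rewrite ?nnegrE ?sqr_ge0//.
  by have := sqr_ge0 (1 - t / 4); lra.
by apply: lerXn2r; rewrite ?nnegrE ?expR_ge0//; lra.
Qed.

(** The law is symmetric and [g] is odd, so [exp g] has the mean of [cosh g], which contains no
    linear term. *)
Lemma odd_exp_moment (R : realType) disp (T : measurableType disp) (P : probability T R)
    (m : nat) (s2 : R) (v : T -> 'cV[R]_m) (g : mxspace R m 1 -> R) (h : R) :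
  0 < s2 -> isotropic_gaussian P s2 v -> measurable_fun setT g ->
  (forall y : 'cV[R]_m, g (- y) = - g y) -> (forall y, `|g y| <= `|h|) -> `|h| <= 1 / 2 ->
  (\int[P]_w (expR (g (v w)))%:E <= (1 + 2 * h ^+ 2)%:E)%E.
Proof.
move=> s20 vG mg gN gh h2.
have mv : measurable_fun setT (v : T -> mxspace R m 1).
  by apply: measurable_mxspace; exact: (isotropic_random_matrix vG).
have mgv : measurable_fun setT (fun w => g (v w)) by exact: (measurableT_comp mg mv).
have me : measurable_fun setT (fun w => expR (g (v w))) by exact: measurableT_comp.
have meN : measurable_fun setT (fun w => expR (- g (v w))).
  by apply: measurableT_comp => //; exact: measurable_funN.
have I0 : (0 <= \int[P]_w (expR (g (v w)))%:E)%E.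
  by apply: integral_ge0 => w _; rewrite lee_fin expR_ge0.
have opp : (\int[P]_w (expR (- g (v w)))%:E = \int[P]_w (expR (g (v w)))%:E)%E.
  rewrite -(isotropic_opp s20 vG (f := fun y => (expR (g y))%:E)).
  - by apply: eq_integral => w _; rewrite gN.
  - by apply/measurable_EFinP; exact: measurableT_comp.
  - by move=> y; rewrite lee_fin expR_ge0.
have II : (\int[P]_w (expR (g (v w)))%:E + \int[P]_w (expR (- g (v w)))%:E <=
    (2 * (1 + 2 * h ^+ 2))%:E)%E.
  rewrite -ge0_integralD//; last 2 first.
  - exact/measurable_EFinP.
  - exact/measurable_EFinP.
  have -> : (2 * (1 + 2 * h ^+ 2))%:E = (\int[P]_w (2 * (1 + 2 * h ^+ 2))%:E)%E.
    by rewrite integral_cst//= probability_setT mule1.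
  apply: ge0_le_integral => //.
  - by move=> w _; rewrite -EFinD lee_fin addr_ge0// expR_ge0.
  - by apply/measurable_EFinP; exact: measurable_funD.
  - move=> w _; rewrite -EFinD lee_fin.
    move: (g (v w)) (gh (v w)) => y yh.
    have y2 : y ^+ 2 <= h ^+ 2.
      by rewrite -(real_normK (num_real y)) -(real_normK (num_real h)); apply: lerXn2r; rewrite ?nnegrE.
    have := cosh_quadratic (le_trans yh h2); lra.
rewrite opp in II.
move: I0 II; case: (\int[P]_w (expR (g (v w)))%:E)%E => [r| |] //=.
rewrite -EFinD !lee_fin; lra.
Qed.

(** * Moments of the features, with the Gaussian rows frozen *)

Section conditional.
Context {R : realType} disp (T : measurableType disp) (P : probability T R).
Context (n p d : nat) (x : 'I_n -> T -> 'cV[R]_d) (W : 'I_p -> T -> 'cV[R]_d).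
Hypotheses (n0 : (0 < n)%N) (d0 : (0 < d)%N).
Hypotheses (xG : forall i, isotropic_gaussian P 1 (x i))
  (WG : forall j, isotropic_gaussian P (d%:R^-1) (W j)).

Let sigma (k : 'I_n + 'I_p) :=
  match k with inl i => sigma_mx (x i) | inr j => sigma_mx (W j) end.

Hypothesis xWI : mutually_independent P sigma.

Let Sm k : sigma k `<=` measurable.
Proof.
case: k => i; apply: sigma_mx_measurable; apply: isotropic_random_matrix; first exact: xG.
exact: WG.
Qed.

Let SI k : setI_closed (sigma k).
Proof. by case: k => i; exact: sigma_mx_setI. Qed.

Let ST k : sigma k setT.
Proof. by case: k => i; exact: sigma_mx_setT. Qed.

Lemma rows_independent : mutually_independent P (fun i => sigma_mx (x i)).
Proof. by apply: (independent_inj (f := inl) _ xWI) => i j []. Qed.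

Lemma weights_independent : mutually_independent P (fun j => sigma_mx (W j)).
Proof. by apply: (independent_inj (f := inr) _ xWI) => i j []. Qed.

Definition weight_matrix (w : T) : 'M[R]_(d, p) := \matrix_(k, j) W j w k 0.

Lemma measurable_weight_matrix : measurable_fun setT (weight_matrix : T -> mxspace R d p).
Proof.
apply: measurable_mxspace => k j; under eq_fun do rewrite mxE.
exact: (isotropic_random_matrix (WG j)).
Qed.

Lemma ge0_integral_rows_weights_le (H : mxspace R n d * mxspace R d p -> R) (c : R) :
  measurable_fun setT H -> (forall s, 0 <= H s) ->
  (forall w, \int[P]_w' (H (row_matrix x w, weight_matrix w'))%:E <= c%:E)%E ->
  (\int[P]_w (H (row_matrix x w, weight_matrix w))%:E <= c%:E)%E.
Proof.
move=> mH H0 Hc; have -> : c%:E = (\int[P]_w c%:E)%E.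
  by rewrite integral_cst//= probability_setT mule1.
apply: (ge0_integral_independent_le (A := row_matrix x : T -> mxspace R n d)
  (B := weight_matrix : T -> mxspace R d p) (H := fun s => (H s)%:E)) => //; last exact/measurable_EFinP.
- exact: (measurable_row_matrix xG).
- exact: measurable_weight_matrix.
move=> E1 E2 mE1 mE2.
apply: (independent_blocks Sm SI ST xWI (a := fun k => if k is inl _ then true else false)).
- pose G := \bigcup_(k in [set k : 'I_n + 'I_p | (if k is inl _ then true else false) = true]) sigma k.
  have mM : measurable_fun setT (row_matrix x : g_sigma_algebraType G -> mxspace R n d).
    apply: measurable_mxspace => i k; under eq_fun do rewrite mxE.
    move=> _ B mB; apply: sub_sigma_algebra; exists (inl i) => //.
    rewrite setTI; apply: (sigma_mx_preimage (E := [set y : mxspace R d 1 | B (y k 0)])).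
    by have := @measurable_entry R d 1 k 0 measurableT B mB; rewrite setTI.
  by have := mM measurableT E1 mE1; rewrite setTI.
- pose G := \bigcup_(k in [set k : 'I_n + 'I_p | (if k is inl _ then true else false) = false]) sigma k.
  have mM : measurable_fun setT (weight_matrix : g_sigma_algebraType G -> mxspace R d p).
    apply: measurable_mxspace => k j; under eq_fun do rewrite mxE.
    move=> _ B mB; apply: sub_sigma_algebra; exists (inr j) => //.
    rewrite setTI; apply: (sigma_mx_preimage (E := [set y : mxspace R d 1 | B (y k 0)])).
    by have := @measurable_entry R d 1 k 0 measurableT B mB; rewrite setTI.
  by have := mM measurableT E2 mE2; rewrite setTI.
Qed.

Lemma ge0_integral_weights (J : {set 'I_p}) (f : 'I_p -> mxspace R d 1 -> R) :
  (forall j y, 0 <= f j y) -> (forall j, measurable_fun setT (f j)) ->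
  (\int[P]_w (\prod_(j in J) f j (W j w))%:E = \prod_(j in J) \int[P]_w (f j (W j w))%:E)%E.
Proof.
move=> f0 mf.
apply: (ge0_integral_prod _ _ _ weights_independent (f := fun j w => f j (W j w))).
- by move=> j; exact: (Sm (k := inr j)).
- by move=> j; exact: (SI (k := inr j)).
- by move=> j; exact: (ST (inr j)).
- by move=> j w.
- move=> j E _ mE; apply: (sigma_mx_preimage (E := f j @^-1` E)).
  by have := mf j measurableT E mE; rewrite setTI.
Qed.

Let featureE w i j : feature_matrix tanh x W w i j = tanh ((row_matrix x w *m W j w) i 0).
Proof.
rewrite mxE; congr tanh; rewrite !mxE; apply: eq_bigr => k _.
by rewrite !mxE mulrC.
Qed.

Let measurable_product i j : measurable_fun setT
  (fun s : mxspace R n d * mxspace R d p => ((s.1 : 'M[R]_(n, d)) *m (s.2 : 'M[R]_(d, p))) i j).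
Proof.
under eq_fun do rewrite mxE; apply: measurable_sum => k; apply: measurable_funM.
  exact: (measurableT_comp (measurable_entry i k) measurable_fst).
exact: (measurableT_comp (measurable_entry k j) measurable_snd).
Qed.

Let mul_col (M : 'M[R]_(n, d)) w i j : (M *m weight_matrix w) i j = (M *m W j w) i 0.
Proof. by rewrite !mxE; apply: eq_bigr => k _; rewrite mxE. Qed.

Let measurable_mulmx (M : 'M[R]_(n, d)) i : measurable_fun setT (fun y : mxspace R d 1 => (M *m y) i 0).
Proof.
under eq_fun do rewrite mxE.
by apply: measurable_sum => k; apply: measurable_funM => //; exact: measurable_entry.
Qed.

(** The indicator keeps only rows to which [weight_small_ball] applies; once they are frozen, the
    weights are independent and the exponential factors over [J]. *)
Lemma feature_laplace (J : {set 'I_p}) (v : 'cV[R]_n) :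
  1 / 4 <= \sum_i v i 0 ^+ 2 -> \sum_i v i 0 ^+ 2 <= 1 ->
  (\int[P]_w (if design_defect (row_matrix x w) < 1 then
     expR (- \sum_(j in J) `|\sum_i v i 0 * feature_matrix tanh x W w i j|) else 0)%:E <=
   ((1 - @rate2 R) ^+ #|J|)%:E)%E.
Proof.
move=> v4 v1.
pose H (s : mxspace R n d * mxspace R d p) : R :=
  if design_defect (s.1 : 'M[R]_(n, d)) < 1 then
    expR (- \sum_(j in J) `|\sum_i v i 0 * tanh (((s.1 : 'M[R]_(n, d)) *m (s.2 : 'M[R]_(d, p))) i j)|) else 0.
have mH : measurable_fun setT H.
  apply: measurable_fun_ifT => //.
  - apply: measurable_fun_ltr => //.
    apply: (measurableT_comp (f := fun M : mxspace R n d => design_defect M)).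
      exact: measurable_design_defect.
    exact: measurable_fst.
  - apply: measurableT_comp => //; apply: measurableT_comp => //.
    under eq_fun do rewrite -big_filter.
    apply: measurable_sum => j; apply: measurableT_comp => //.
    apply: measurable_sum => i; apply: measurable_funM => //.
    exact: (measurableT_comp measurable_tanh (measurable_product i j)).
have H0 s : 0 <= H s by rewrite /H; case: ifP => // _; exact: expR_ge0.
rewrite (eq_integral (fun w => (H (row_matrix x w, weight_matrix w))%:E)); last first.
  move=> w _; congr _%:E; rewrite /H /=; case: ifP => // _; congr (expR (- _)).
  apply: eq_bigr => j _; congr `|_|; apply: eq_bigr => i _.
  by rewrite featureE mul_col.
apply: ge0_integral_rows_weights_le => // w.
have [M1|M1] := boolP (design_defect (row_matrix x w) < 1); last first.
  rewrite (eq_integral (cst 0%E)) ?integral0; last first.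
    by move=> w' _; rewrite /H /= (negbTE M1).
  by rewrite lee_fin exprn_ge0// subr_ge0 ltW// rate2_lt1.
pose f (j : 'I_p) (y : mxspace R d 1) := expR (- `|feature_combination (row_matrix x w) v y|).
rewrite (eq_integral (fun w' => (\prod_(j in J) f j (W j w'))%:E)); last first.
  move=> w' _; rewrite /H /= M1 /f -expR_sum sumrN; congr (expR (- _))%:E.
  apply: eq_bigr => j _; congr `|_|; apply: eq_bigr => i _.
  by rewrite mul_col.
rewrite ge0_integral_weights; last 2 first.
- by move=> j y; exact: expR_ge0.
- move=> j; apply: measurableT_comp => //; apply: measurableT_comp => //; apply: measurableT_comp => //.
  apply: measurable_sum => i; apply: measurable_funM => //.
  exact: (measurableT_comp measurable_tanh (measurable_mulmx _ i)).
apply: lee_prod_EFin => j _; apply/andP; split.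
  by apply: integral_ge0 => w' _; rewrite lee_fin expR_ge0.
exact: weight_small_ball.
Qed.

Lemma feature_exp_moment (s : 'I_p -> R) (i : 'I_n) (h : R) :
  (forall j, `|s j| <= 1) -> `|h| <= 1 / 2 ->
  (\int[P]_w (expR (h * \sum_j s j * feature_matrix tanh x W w i j))%:E <=
   ((1 + 2 * h ^+ 2) ^+ p)%:E)%E.
Proof.
move=> s1 h2.
pose H (t : mxspace R n d * mxspace R d p) : R :=
  expR (h * \sum_j s j * tanh (((t.1 : 'M[R]_(n, d)) *m (t.2 : 'M[R]_(d, p))) i j)).
have mH : measurable_fun setT H.
  apply: measurableT_comp => //; apply: measurable_funM => //.
  apply: measurable_sum => j; apply: measurable_funM => //.
  exact: (measurableT_comp measurable_tanh (measurable_product i j)).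
rewrite (eq_integral (fun w => (H (row_matrix x w, weight_matrix w))%:E)); last first.
  move=> w _; congr (expR (h * _))%:E; apply: eq_bigr => j _.
  by rewrite featureE mul_col.
apply: ge0_integral_rows_weights_le => // [t|w]; first exact: expR_ge0.
set M := row_matrix x w.
pose f (j : 'I_p) (y : mxspace R d 1) := expR (h * (s j * tanh ((M *m y) i 0))).
have mf j : measurable_fun setT (f j).
  apply: measurableT_comp => //; do 2 apply: measurable_funM => //.
  exact: (measurableT_comp measurable_tanh (measurable_mulmx _ i)).
rewrite (eq_integral (fun w' => (\prod_(j in [set: 'I_p]%SET) f j (W j w'))%:E)); last first.
  move=> w' _; rewrite /H /f -expR_sum mulr_sumr; congr (expR _)%:E.
  by apply: eq_big => [j|j _]; rewrite ?inE// mul_col.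
rewrite ge0_integral_weights//; last by move=> j y; exact: expR_ge0.
have -> : (1 + 2 * h ^+ 2) ^+ p = (1 + 2 * h ^+ 2) ^+ #|[set: 'I_p]%SET| by rewrite cardsT card_ord.
apply: lee_prod_EFin => j _; apply/andP; split.
  by apply: integral_ge0 => w' _; rewrite lee_fin expR_ge0.
have dR : (0 : R) < d%:R^-1 by rewrite invr_gt0 ltr0n.
apply: (odd_exp_moment (g := fun y => h * (s j * tanh ((M *m y) i 0))) dR (WG j)) => //.
- do 2 apply: measurable_funM => //.
  exact: (measurableT_comp measurable_tanh (measurable_mulmx _ i)).
- move=> y; have -> : (M *m (- y)) i 0 = - (M *m y) i 0 by rewrite mulmxN mxE.
  by rewrite tanhN !mulrN.
- move=> y; rewrite normrM ler_piMr// normrM mulr_ile1//.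
  exact: tanh_le1.
Qed.

(** With [h = 1 / (2 sqrt p)], [S^2 / (4 p) = (h S)^2 <= exp(h S) + exp(-h S)], and each exponential
    has mean at most [exp(1/2) <= 2]. Factoring exponential moments replaces the expansion of the
    square. *)
Lemma feature_second_moment (s : 'I_p -> R) (i : 'I_n) : (0 < p)%N -> 
  (forall j, `|s j| <= 1) ->
  (\int[P]_w ((\sum_j s j * feature_matrix tanh x W w i j) ^+ 2)%:E <= (16 * p%:R)%:E)%E.
Proof.
move=> p0 s1; have pR : (0 : R) < p%:R by rewrite ltr0n.
pose S w := \sum_j s j * feature_matrix tanh x W w i j.
have mS : measurable_fun setT S.
  apply: measurable_sum => j; apply: measurable_funM => //.
  under eq_fun do rewrite featureE.
  apply: (measurableT_comp measurable_tanh); under eq_fun do rewrite mxE.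
  apply: measurable_sum => k; apply: measurable_funM.
    by under eq_fun do rewrite mxE; exact: (isotropic_random_matrix (xG i)).
  exact: (isotropic_random_matrix (WG j)).
pose h : R := (2 * Num.sqrt p%:R)^-1.
have sp : 1 <= Num.sqrt (p%:R : R) by rewrite -[leLHS]sqrtr1 ler_sqrt// ler1n.
have h0 : 0 < h by rewrite invr_gt0; lra.
have h2 : h ^+ 2 = (4 * p%:R)^-1.
  by rewrite exprVn exprMn sqr_sqrtr ?ltW//; congr _^-1; lra.
have h12 : `|h| <= 1 / 2.
  rewrite (ger0_norm (ltW h0)) /h mul1r lef_pV2 ?posrE//; lra.
have mom (a : R) : `|a| <= 1 / 2 -> a ^+ 2 = (4 * p%:R)^-1 -> (\int[P]_w (expR (a * S w))%:E <= 2%:E)%E.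
  move=> a1 a2; apply: (le_trans (feature_exp_moment i s1 a1)); rewrite lee_fin a2.
  apply: (@le_trans _ _ (expR (2 * (4 * p%:R)^-1) ^+ p)).
    have q0 : 0 <= 1 + 2 * (4 * p%:R)^-1 :> R by rewrite addr_ge0// mulr_ge0// invr_ge0 mulr_ge0// ltW.
    by apply: lerXn2r; rewrite ?nnegrE ?expR_ge0 ?expR_ge1Dx.
  rewrite -expRM_natl (_ : p%:R * _ = 2^-1); last by field; rewrite gt_eqF.
  rewrite -[leLHS]invrK -[leRHS]invrK -expRN lef_pV2 ?posrE ?invr_gt0 ?expR_gt0//.
  apply: le_trans (expR_ge1Dx _); lra.
have mexp (a : R) : measurable_fun setT (fun w => expR (a * S w)).
  by apply: measurableT_comp => //; exact: measurable_funM.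
apply: (@le_trans _ _ (\int[P]_w ((4 * p%:R)%:E * ((expR (h * S w))%:E + (expR (- h * S w))%:E)))%E).
  apply: ge0_le_integral => //.
  - by move=> w _; rewrite lee_fin sqr_ge0.
  - by apply/measurable_EFinP; exact: measurable_funX.
  - apply/measurable_EFinP; apply: measurable_funM => //; exact: measurable_funD.
  - move=> w _; rewrite -EFinD -EFinM lee_fin -/(S w) -ler_pdivrMl; last by rewrite mulr_gt0.
    by rewrite -h2 -exprMn mulNr; exact: sqr_le_cosh.
rewrite ge0_integralZl//; last 2 first.
- by apply/measurable_EFinP; exact: measurable_funD.
- by move=> w _; rewrite -EFinD lee_fin addr_ge0// expR_ge0.
rewrite ge0_integralD//; last 2 first.
- exact/measurable_EFinP.
- exact/measurable_EFinP.
apply: (@le_trans _ _ ((4 * p%:R)%:E * (2%:E + 2%:E)))%E; last by rewrite -EFinD -EFinM lee_fin; lra.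
apply: lee_wpmul2l; first by rewrite lee_fin mulr_ge0// (ltW pR).
apply: leeD; first by apply: mom.
by apply: mom; rewrite ?normrN ?sqrrN.
Qed.

End conditional.

(** * Zeros of the noise and exact recovery *)

Section zeros.
Context {R : realType}.

Definition zero_ind (t : R) : R := (t == 0)%:R.

Lemma measurable_zero_ind : measurable_fun setT zero_ind.
Proof.
rewrite (_ : zero_ind = \1_[set 0]); first exact: measurable_indic.
apply/funext => t; rewrite /zero_ind indicE; congr (nat_of_bool _)%:R.
by apply/eqP/idP; rewrite inE.
Qed.

Lemma zero_ind_ge0 t : 0 <= zero_ind t.
Proof. exact: ler0n. Qed.

Definition zero_count p (z : 'cV[R]_p) : R := \sum_j zero_ind (z j 0).

Context disp (T : measurableType disp) (P : probability T R).
Context (p : nat) (z : T -> 'cV[R]_p) (eps : R) (Q : 'I_p -> probability R R).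
Hypotheses (e01 : 0 <= eps < 1)
  (zQ : forall j, has_law P (fun w => z w j 0) (contamination eps (Q j)))
  (zI : mutually_independent P (fun j => sigma_rv (fun w => z w j 0))).

(** Since [exp(-1) <= 1/2], a coordinate contributes at most one minus half its probability of being
    0. That probability is at least [1 - eps], and possibly more, as [Q_j] may charge 0. *)
Lemma zero_count_laplace :
  (\int[P]_w (expR (- zero_count (z w)))%:E <= (expR (- ((1 - eps) * p%:R / 2)))%:E)%E.
Proof.
have mz j : measurable_fun setT (fun w => z w j 0) by case: (zQ j).
have mzi j : measurable_fun setT (fun w => zero_ind (z w j 0)).
  exact: (measurableT_comp measurable_zero_ind (mz j)).
under eq_integral do rewrite /zero_count -sumrN expR_sum.
rewrite (ge0_integral_prodT _ _ _ zI (f := fun j w => expR (- zero_ind (z w j 0)))); last 5 first.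
- by move=> j; exact: sigma_rv_measurable.
- by move=> j; exact: sigma_rv_setI.
- by move=> j; exact: sigma_rv_setT.
- by move=> j w; exact: expR_ge0.
- move=> j E mE.
  have mm : measurable_fun setT (fun t : R => expR (- zero_ind t)).
    by apply: measurableT_comp => //; apply: measurableT_comp => //; exact: measurable_zero_ind.
  have := mm measurableT E mE; rewrite setTI.
  exact: (sigma_rv_preimage (fun w => z w j 0)).
rewrite (_ : - ((1 - eps) * p%:R / 2) = p%:R * - ((1 - eps) / 2)); last lra.
rewrite expRM_natl -[p in leRHS]card_ord.
apply: lee_prod_EFin => j _; apply/andP; split.
  by apply: integral_ge0 => w _; rewrite lee_fin expR_ge0.
have H1 : (\int[P]_w (expR (- zero_ind (z w j 0)))%:E + \int[P]_w (2^-1 * zero_ind (z w j 0))%:E <= 1)%E.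
  rewrite -ge0_integralD//; last 3 first.
  - by apply/measurable_EFinP; do 2 apply: measurableT_comp => //.
  - by move=> w _; rewrite lee_fin mulr_ge0 ?invr_ge0 ?zero_ind_ge0.
  - by apply/measurable_EFinP; exact: measurable_funM.
  rewrite -(@probability_setT _ _ _ P) -[leRHS]mul1e -integral_cst//; apply: ge0_le_integral => //.
  - by move=> w _; rewrite -EFinD lee_fin addr_ge0 ?expR_ge0// mulr_ge0 ?invr_ge0 ?zero_ind_ge0.
  - apply/measurable_EFinP; apply: measurable_funD => //; last exact: measurable_funM.
    by do 2 apply: measurableT_comp => //.
  - move=> w _; rewrite -EFinD lee_fin /zero_ind; case: (_ == _) => /=.
      have e1 : (2 : R) <= expR 1 by have := expR_ge1Dx (1 : R); lra.
      rewrite mulr1 expRN.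
      have : (expR 1)^-1 <= (2 : R)^-1 by rewrite lef_pV2 ?posrE ?expR_gt0.
      lra.
    by rewrite mulr0 oppr0 expR0; lra.
have H2 : ((1 - eps)%:E <= \int[P]_w (zero_ind (z w j 0))%:E)%E.
  rewrite (eq_integral (fun w => (\1_((fun w => z w j 0) @^-1` [set 0]) w)%:E)); last first.
    move=> w _; rewrite /zero_ind indicE; congr ((nat_of_bool _)%:R)%:E.
    by apply/eqP/idP; rewrite inE.
  have ms : measurable ((fun w => z w j 0) @^-1` [set 0]).
    by rewrite -[X in measurable X]setTI; exact: mz.
  rewrite integral_indic// setIT.
  have [_ zl] := zQ j.
  apply: (@le_trans _ _ (contamination eps (Q j) [set 0%R])); last by rewrite -zl.
  rewrite /contamination diracE mem_set// mule1 leeDl// mule_ge0// lee_fin.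
  by case/andP: e01.
move: H1; under [X in (_ + X <= _)%E -> _]eq_integral do rewrite EFinM.
rewrite ge0_integralZl//; last 2 first.
- exact/measurable_EFinP.
- by move=> w _; rewrite lee_fin zero_ind_ge0.
move=> H1; apply: (@le_trans _ _ (1 - (1 - eps) / 2)%:E); last by rewrite lee_fin; exact: expR_ge1Dx.
rewrite EFinB leeBrDr//; apply: le_trans H1; rewrite leeD2l//.
rewrite mulrC EFinM lee_wpmul2l// lee_fin invr_ge0//.
Qed.

End zeros.

(** * A deterministic certificate of recovery *)

Section certificate.
Context {R : realType}.

(** Half of the decay rate pays for the threshold; the other half remains for the union bound over
    the grid. *)
Definition threshold : R := @rate2 R / 2.
(** Above [2 / threshold], so that rounding costs at most [threshold / 2] per zero of [z], and at
    least 2, which keeps the squared norm of the grid point at least 1/4. *)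
Definition grid_size : nat := (Num.truncn (2 / threshold)).+2.

Lemma threshold_gt0 : 0 < threshold.
Proof. by rewrite divr_gt0// rate2_gt0. Qed.

Context (n p : nat).

Definition grid_mesh : R := (grid_size * n)%:R^-1.
Definition grid_point := @lattice_point R n (grid_size * n) grid_mesh.

(* The grid has mesh of order [1/n], hence [(C n)^n] points: since the features
   are only known to be bounded by [1], moving from a unit vector to the grid
   perturbs each feature combination by at most [n * grid_mesh]. This cardinal
   is the source of the logarithm in the sparsity condition. *)
Definition grid_defect (X : 'M[R]_(n, p)) (z : 'cV[R]_p) : R :=
  \sum_(f | 1 / 4 <= \sum_i grid_point f i 0 ^+ 2 <= 1)
    expR (threshold * zero_count z -
      \sum_j zero_ind (z j 0) * `|\sum_i grid_point f i 0 * X i j|).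

Definition sign_energy (X : 'M[R]_(n, p)) (z : 'cV[R]_p) : R :=
  \sum_i (\sum_j Num.sg (z j 0) * X i j) ^+ 2.

Lemma grid_defect_ge0 X z : 0 <= grid_defect X z.
Proof. by apply: sumr_ge0 => *; exact: expR_ge0. Qed.

Lemma sign_energy_ge0 X z : 0 <= sign_energy X z.
Proof. by apply: sumr_ge0 => *; exact: sqr_ge0. Qed.

Context (X : 'M[R]_(n, p)) (z : 'cV[R]_p).
Hypotheses (n0 : (0 < n)%N) (X1 : forall i j, `|X i j| <= 1).

Let h0 : 0 < grid_mesh.
Proof. by rewrite invr_gt0 ltr0n muln_gt0 n0. Qed.

Let nh : n%:R * grid_mesh = grid_size%:R^-1.
Proof.
rewrite /grid_mesh natrM invfM mulrCA divff ?mulr1//.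
by rewrite pnatr_eq0 -lt0n.
Qed.

Lemma grid_defect_lb (v : 'cV[R]_n) : grid_defect X z < 1 -> \sum_i v i 0 ^+ 2 = 1 ->
  threshold / 2 * zero_count z <= \sum_j zero_ind (z j 0) * `|\sum_i v i 0 * X i j|.
Proof.
move=> G1 v1; have v1' : \sum_i v i 0 ^+ 2 <= 1 by rewrite v1.
have hB : grid_mesh^-1 <= (grid_size * n)%:R by rewrite invrK.
have [f Hf] := lattice_approx h0 hB (entry_le1 v1').
have t0 := threshold_gt0.
have f1 : \sum_i grid_point f i 0 ^+ 2 <= 1.
  by rewrite -v1; apply: sum_sqr_approx_ub => i; case: (Hf i).
have f4 : 1 / 4 <= \sum_i grid_point f i 0 ^+ 2.
  have Hf2 i : `|v i 0 - grid_point f i 0| <= grid_mesh by case: (Hf i).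
  have := sum_sqr_approx_lb h0 Hf2; rewrite v1 (_ : n%:R * _ = grid_size%:R^-1 * grid_mesh); last by rewrite expr2 mulrA nh.
  have g2 : (grid_size%:R : R)^-1 <= 2^-1 by rewrite lef_pV2 ?posrE// ler_nat.
  have g3 : grid_mesh <= 2^-1.
    rewrite /grid_mesh lef_pV2 ?posrE//; last by rewrite ltr0n muln_gt0 n0.
    by rewrite ler_nat (leq_trans _ (leq_pmulr _ n0)).
  have : grid_size%:R^-1 * grid_mesh <= 2^-1 * 2^-1.
    by apply: ler_pM => //; exact: ltW.
  lra.
have : expR (threshold * zero_count z - \sum_j zero_ind (z j 0) * `|\sum_i grid_point f i 0 * X i j|) < 1.
  apply: le_lt_trans G1; rewrite /grid_defect (bigD1 f)/=; last by rewrite f1 f4.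
  by rewrite lerDl sumr_ge0// => *; exact: expR_ge0.
rewrite -[ltRHS]expR0 ltr_expR subr_lt0 => H.
have gt : (grid_size%:R : R)^-1 <= threshold / 2.
  have th : 0 < threshold / 2 by exact: divr_gt0.
  rewrite -[leRHS]invrK lef_pV2 ?posrE//; last by rewrite invr_gt0.
  rewrite invf_div.
  by rewrite /grid_size; apply: (le_trans (ltW (truncnS_gt _))); rewrite ler_nat.
have step : \sum_j zero_ind (z j 0) * `|\sum_i grid_point f i 0 * X i j| <=
    \sum_j zero_ind (z j 0) * `|\sum_i v i 0 * X i j| + threshold / 2 * zero_count z.
  rewrite /zero_count mulr_sumr -big_split/=; apply: ler_sum => j _.
  rewrite [threshold / 2 * _]mulrC -mulrDr ler_wpM2l ?zero_ind_ge0//.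
  apply: le_trans (lerD (lexx _) gt).
  have -> : \sum_i grid_point f i 0 * X i j =
      \sum_i v i 0 * X i j - \sum_i (v i 0 - grid_point f i 0) * X i j.
    by rewrite -sumrB; apply: eq_bigr => i _; lra.
  apply: (le_trans (ler_normB _ _)); rewrite lerD2l.
  apply: (le_trans (ler_norm_sum _ _ _)).
  rewrite -nh mulr_natl -[X in _ *+ X](card_ord n) -sumr_const; apply: ler_sum => i _.
  rewrite normrM -[leRHS]mulr1; apply: ler_pM => //.
  by case: (Hf i).
lra.
Qed.

(** [B] and [N0] are the levels for [|S|_2^2] and for the number of zeros;
    [sqrt B <= threshold / 2 * N0] is what makes the mass on the zeros win. *)
Lemma l1_minimizer_unique (B N0 : R) (v : 'cV[R]_n) : 0 < B ->
  Num.sqrt B <= threshold / 2 * N0 ->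
  grid_defect X z + sign_energy X z / B + expR (N0 - zero_count z) < 1 ->
  l1norm (z - X^T *m v) <= l1norm z -> v = 0.
Proof.
move=> B0 BN Psi vmin.
have t0 := threshold_gt0.
have [G0 E0] := (grid_defect_ge0 X z, sign_energy_ge0 X z).
have EB0 : 0 <= sign_energy X z / B by rewrite divr_ge0// ltW.
have e0 := expR_ge0 (N0 - zero_count z).
have G1 : grid_defect X z < 1 by lra.
have E1 : sign_energy X z < B.
  by rewrite -[ltRHS]mul1r -ltr_pdivrMr//; lra.
have NN : N0 < zero_count z.
  by rewrite -subr_lt0 -ltr_expR expR0; lra.
have aE j : (X^T *m v) j 0 = \sum_i v i 0 * X i j.
  by rewrite mxE; apply: eq_bigr => i _; rewrite mxE mulrC.
(* With [a = X^T v], [|z_j| - |z_j - a_j|] equals [- |a_j|] at a zero of [z] and is at most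
   [sg z_j * a_j] elsewhere. *)
have key : \sum_j zero_ind (z j 0) * `|\sum_i v i 0 * X i j| <=
    \sum_j Num.sg (z j 0) * \sum_i v i 0 * X i j.
  rewrite -subr_ge0 -sumrB.
  have : 0 <= l1norm z - l1norm (z - X^T *m v) by rewrite subr_ge0.
  rewrite /l1norm -sumrB => /le_trans; apply; apply: ler_sum => j _.
  rewrite !mxE -/((X^T *m v) j 0).
  under eq_bigr do rewrite mxE mulrC.
  move: (\sum_i _) (z j 0) => a t; rewrite /zero_ind.
  case: sgrP => [->|t1|t1].
  - by rewrite !sub0r normrN mul0r mul1r sub0r.
  - rewrite mul0r mul1r subr0; have := ler_norm (t - a); lra.
  - rewrite mul0r mulN1r subr0; have := ler_norm (- (t - a)); rewrite normrN; lra.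
set S := \sum_i v i 0 ^+ 2.
have S0 : 0 <= S by apply: sumr_ge0 => i _; exact: sqr_ge0.
have [Sz|Sn0] := eqVneq S 0.
  apply/matrixP => i j; rewrite (ord1 j) [RHS]mxE; apply/eqP; rewrite -sqrf_eq0.
  rewrite eq_le sqr_ge0 andbT -Sz /S (bigD1 i)//= lerDl sumr_ge0// => *; exact: sqr_ge0.
have Sp : 0 < S by rewrite lt_neqAle eq_sym Sn0.
pose c := (Num.sqrt S)^-1; have c0 : 0 < c by rewrite invr_gt0 sqrtr_gt0.
pose u := c *: v.
have u1 : \sum_i u i 0 ^+ 2 = 1.
  under eq_bigr do rewrite mxE exprMn.
  by rewrite -mulr_sumr exprVn sqr_sqrtr// mulVf.
have uE j : \sum_i u i 0 * X i j = c * \sum_i v i 0 * X i j.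
  by rewrite mulr_sumr; apply: eq_bigr => i _; rewrite mxE mulrA.
have key2 : \sum_j zero_ind (z j 0) * `|\sum_i u i 0 * X i j| <=
    \sum_j Num.sg (z j 0) * \sum_i u i 0 * X i j.
  rewrite [leLHS](_ : _ = c * \sum_j zero_ind (z j 0) * `|\sum_i v i 0 * X i j|); last first.
    rewrite mulr_sumr; apply: eq_bigr => j _; rewrite uE normrM (gtr0_norm c0); lra.
  rewrite [leRHS](_ : _ = c * \sum_j Num.sg (z j 0) * \sum_i v i 0 * X i j); last first.
    rewrite mulr_sumr; apply: eq_bigr => j _; rewrite uE; lra.
  by rewrite ler_pM2l.
have := grid_defect_lb G1 u1.
pose r := Num.sqrt B; have r0 : 0 < r by rewrite sqrtr_gt0.
have rB : r ^+ 2 = B by rewrite sqr_sqrtr// ltW.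
(* [2 <u, S> <= r |u|^2 + |S|^2 / r] with [r = sqrt B], in place of Cauchy-Schwarz. *)
have sg_le : 2 * (\sum_j Num.sg (z j 0) * \sum_i u i 0 * X i j) <= r + r^-1 * sign_energy X z.
  have -> : \sum_j Num.sg (z j 0) * \sum_i u i 0 * X i j = \sum_i u i 0 * \sum_j Num.sg (z j 0) * X i j.
    under eq_bigr do rewrite mulr_sumr.
    rewrite exchange_big/=; apply: eq_bigr => i _; rewrite mulr_sumr; apply: eq_bigr => j _; lra.
  rewrite [X in X + _](_ : r = r * \sum_i u i 0 ^+ 2); last by rewrite u1 mulr1.
  rewrite /sign_energy !mulr_sumr -big_split/=; apply: ler_sum => i _.
  move: (\sum_j _) (u i 0) => b a.
  rewrite -subr_ge0 (_ : _ - _ = r^-1 * (r * a - b) ^+ 2).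
    by rewrite mulr_ge0 ?sqr_ge0// invr_ge0 ltW.
  by field; rewrite gt_eqF.
have : r^-1 * sign_energy X z < r.
  by rewrite ltr_pdivrMl// -expr2 rB.
have : threshold / 2 * N0 < threshold / 2 * zero_count z by rewrite ltr_pM2l// divr_gt0.
rewrite -/r in BN; move=> A1 A2 A3; exfalso; lra.
Qed.

End certificate.

(** * Probability of the certificate *)

Section assembly.
Context {R : realType}.

Lemma ge0_integral_leD disp (T : measurableType disp) (P : probability T R)
    (f g : T -> R) (a b : R) :
  (forall w, 0 <= f w) -> (forall w, 0 <= g w) ->
  measurable_fun setT f -> measurable_fun setT g ->
  (\int[P]_w (f w)%:E <= a%:E)%E -> (\int[P]_w (g w)%:E <= b%:E)%E ->
  (\int[P]_w (f w + g w)%:E <= (a + b)%:E)%E.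
Proof.
move=> f0 g0 mf mg fa gb.
under eq_integral do rewrite EFinD.
rewrite ge0_integralD//; last 4 first.
- by move=> w _; rewrite lee_fin.
- exact/measurable_EFinP.
- by move=> w _; rewrite lee_fin.
- exact/measurable_EFinP.
by rewrite EFinD leeD.
Qed.

Definition certificate n p (B N0 : R) (s : mxspace R p 1 * mxspace R n p) : R :=
  grid_defect (s.2 : 'M[R]_(n, p)) (s.1 : 'cV[R]_p) +
  sign_energy (s.2 : 'M[R]_(n, p)) (s.1 : 'cV[R]_p) / B + expR (N0 - zero_count (s.1 : 'cV[R]_p)).

Lemma certificate_ge0 n p (B N0 : R) (s : mxspace R p 1 * mxspace R n p) : 0 < B ->
  0 <= certificate B N0 s.
Proof.
move=> B0; rewrite !addr_ge0 ?expR_ge0 ?grid_defect_ge0//.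
by rewrite divr_ge0 ?sign_energy_ge0 ?ltW.
Qed.

Lemma measurable_sgr : measurable_fun setT (Num.sg : R -> R).
Proof.
rewrite (_ : Num.sg = fun t : R => if t == 0 then 0 else if t < 0 then -1 else 1); last first.
  by apply/funext => t; rewrite /Num.sg.
apply: measurable_fun_ifT => //; first exact: measurable_fun_eqr.
by apply: measurable_fun_ifT => //; exact: measurable_fun_ltr.
Qed.

Section measurable_certificate.
Context (n p : nat).
Notation pair := (mxspace R p 1 * mxspace R n p)%type.

Let mz j : measurable_fun setT (fun s : pair => (s.1 : 'cV[R]_p) j 0).
Proof. exact: (measurableT_comp (measurable_entry j 0) measurable_fst). Qed.

Let mX i j : measurable_fun setT (fun s : pair => (s.2 : 'M[R]_(n, p)) i j).
Proof. exact: (measurableT_comp (measurable_entry i j) measurable_snd). Qed.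

Let mind j : measurable_fun setT (fun s : pair => zero_ind ((s.1 : 'cV[R]_p) j 0)).
Proof. exact: (measurableT_comp measurable_zero_ind (mz j)). Qed.

Let mcount : measurable_fun setT (fun s : pair => zero_count (s.1 : 'cV[R]_p)).
Proof. exact: measurable_sum. Qed.

Lemma measurable_certificate B N0 : measurable_fun setT (@certificate n p B N0).
Proof.
apply: measurable_funD; last by apply: measurableT_comp => //; exact: measurable_funB.
apply: measurable_funD.
  under eq_fun do rewrite /grid_defect -big_filter.
  apply: measurable_sum => f; apply: measurableT_comp => //; apply: measurable_funB.
    exact: measurable_funM.
  apply: measurable_sum => j; apply: measurable_funM => //; apply: measurableT_comp => //.
  by apply: measurable_sum => i; exact: measurable_funM.
apply: measurable_funM => //; apply: measurable_sum => i; apply: measurable_funX.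
apply: measurable_sum => j; apply: measurable_funM => //.
exact: (measurableT_comp measurable_sgr (mz j)).
Qed.

End measurable_certificate.

Context disp (T : measurableType disp) (P : probability T R).
Context (n p d : nat) (x : 'I_n -> T -> 'cV[R]_d) (W : 'I_p -> T -> 'cV[R]_d).
Hypotheses (n0 : (0 < n)%N) (d0 : (0 < d)%N) (p0 : (0 < p)%N).
Hypotheses (xG : forall i, isotropic_gaussian P 1 (x i))
  (WG : forall j, isotropic_gaussian P (d%:R^-1) (W j)).
Hypothesis xWI : mutually_independent P (fun k : 'I_n + 'I_p =>
  match k with inl i => sigma_mx (x i) | inr j => sigma_mx (W j) end).

Local Notation X := (feature_matrix tanh x W).

Lemma random_feature_matrix : random_matrix X.
Proof.
move=> i j.
rewrite (_ : (fun w => _) = fun w => tanh (\sum_k W j w k 0 * x i w k 0)); last first.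
  apply/funext => w; rewrite mxE mxE; congr tanh; apply: eq_bigr => k _.
  by rewrite mxE.
apply: (measurableT_comp measurable_tanh); apply: measurable_sum => k; apply: measurable_funM.
  exact: (isotropic_random_matrix (WG j)).
exact: (isotropic_random_matrix (xG i)).
Qed.

Let mX : measurable_fun setT (X : T -> mxspace R n p).
Proof. by apply: measurable_mxspace => i j; exact: random_feature_matrix. Qed.

Definition design_bound : R := 3 * (net_rate ^+ n * expR (- (rate1 / 2 * d%:R))).
Definition grid_bound (N0 : R) : R :=
  ((2 * (@grid_size R * n).+1) ^ n)%N%:R * expR (- (rate2 / 2 * N0)).

Lemma grid_defect_expectation (z0 : 'cV[R]_p) (N0 : R) : N0 <= zero_count z0 ->
  (\int[P]_w (if design_defect (row_matrix x w) < 1 then grid_defect (X w) z0 else 0)%:E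
   <= (grid_bound N0)%:E)%E.
Proof.
move=> NN; pose J := [set j | z0 j 0 == 0]%SET.
have countJ : zero_count z0 = #|J|%:R :> R.
  rewrite /zero_count /zero_ind -natr_sum; congr _%:R.
  by rewrite -sum1dep_card [RHS]big_mkcond/=; apply: eq_bigr => j _; case: (_ == _).
pose A (f : {ffun 'I_n -> bool * 'I_(@grid_size R * n).+1}) :=
  1 / 4 <= \sum_i (grid_point f : 'cV[R]_n) i 0 ^+ 2 <= 1.
pose g f w : R := if design_defect (row_matrix x w) < 1 then
   expR (threshold * zero_count z0) *
   expR (- \sum_(j in J) `|\sum_i (grid_point f : 'cV[R]_n) i 0 * X w i j|) else 0.
have gE w : (if design_defect (row_matrix x w) < 1 then grid_defect (X w) z0 else 0) =
    \sum_(f | A f) g f w.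
  rewrite /g; case: (_ < 1); last by rewrite big1.
  apply: eq_bigr => f _; rewrite -expRD; congr (expR (_ - _)).
  rewrite [RHS]big_mkcond/=; apply: eq_bigr => j _; rewrite inE /zero_ind.
  by case: (_ == _); rewrite ?mul1r ?mul0r.
under eq_integral do rewrite gE.
have mdef : measurable_fun setT (fun w => design_defect (row_matrix x w)).
  apply: (measurableT_comp (f := fun M : mxspace R n d => design_defect M)).
    exact: measurable_design_defect.
  exact: measurable_row_matrix.
have mcomb f : measurable_fun setT (fun w => expR (- \sum_(j in J) `|\sum_i (grid_point f : 'cV[R]_n) i 0 * X w i j|)).
  apply: measurableT_comp => //; apply: measurableT_comp => //.
  under eq_fun do rewrite -big_filter.
  apply: measurable_sum => j; apply: measurableT_comp => //.
  by apply: measurable_sum => i; apply: measurable_funM => //; exact: random_feature_matrix.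
apply: (le_trans (ge0_integral_sum_le (g := g) (c := expR (- (rate2 / 2 * N0))) _ _ _)).
- by move=> f w; rewrite /g; case: (_ < 1) => //; rewrite mulr_ge0// expR_ge0.
- move=> f; apply: measurable_fun_ifT => //; first exact: measurable_fun_ltr.
  exact: measurable_funM.
- move=> f /andP[f4 f1].
  pose h w : R := if design_defect (row_matrix x w) < 1 then
    expR (- \sum_(j in J) `|\sum_i (grid_point f : 'cV[R]_n) i 0 * X w i j|) else 0.
  rewrite (eq_integral (fun w => ((expR (threshold * zero_count z0))%:E * (h w)%:E)%E)); last first.
    by move=> w _; rewrite /g /h; case: (_ < 1); rewrite -EFinM ?mulr0.
  rewrite ge0_integralZl//; last 2 first.
  - apply/measurable_EFinP; apply: measurable_fun_ifT => //; exact: measurable_fun_ltr.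
  - by move=> w _; rewrite lee_fin /h; case: (_ < 1) => //; exact: expR_ge0.
  apply: (@le_trans _ _ ((expR (threshold * zero_count z0))%:E * ((1 - @rate2 R) ^+ #|J|)%:E)%E).
    apply: lee_wpmul2l; first by rewrite lee_fin expR_ge0.
    exact: feature_laplace.
  rewrite -EFinM lee_fin; have r0 := @rate2_gt0 R; have r1 := @rate2_lt1 R.
  apply: (@le_trans _ _ (expR (threshold * zero_count z0) * expR (- rate2) ^+ #|J|)).
    rewrite ler_wpM2l ?expR_ge0//; apply: lerXn2r; rewrite ?nnegrE ?expR_ge0 ?expR_ge1Dx//.
    by rewrite subr_ge0 ltW.
  rewrite -expRM_natl -expRD ler_expR -countJ /threshold.
  have : rate2 / 2 * N0 <= rate2 / 2 * zero_count z0 by rewrite ler_wpM2l// divr_ge0// ltW.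
  lra.
- rewrite lee_fin ler_wpM2r ?expR_ge0// ler_nat.
  apply: (leq_trans (max_card _)).
  by rewrite card_ffun card_prod card_bool !card_ord.
Qed.


Lemma sign_energy_expectation (z0 : 'cV[R]_p) :
  (\int[P]_w (sign_energy (X w) z0)%:E <= (n%:R * (16 * p%:R))%:E)%E.
Proof.
have := ge0_integral_sum_le (P := P) (A := xpredT) (c := 16 * p%:R)
  (g := fun i w => (\sum_j Num.sg (z0 j 0) * X w i j) ^+ 2).
rewrite card_ord; apply=> [i w|i|i _]; first exact: sqr_ge0.
  apply: measurable_funX; apply: measurable_sum => j; apply: measurable_funM => //.
  exact: random_feature_matrix.
apply: feature_second_moment => // j.
by rewrite normr_sg; case: (_ == 0).
Qed.

(** The truncation at 1 settles two bad cases: too few zeros, where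
    [expR (N0 - zero_count z0) >= 1], and a bad design, where [design_defect >= 1]. Otherwise the
    terms are bounded separately. *)
Lemma certificate_conditional (B N0 : R) (z0 : 'cV[R]_p) : 0 < B ->
  (\int[P]_w (Num.min (certificate B N0 (z0, X w)) 1)%:E <=
   (design_bound + grid_bound N0 + n%:R * (16 * p%:R) / B + expR (N0 - zero_count z0))%:E)%E.
Proof.
move=> B0.
pose cert w := certificate B N0 (z0, X w).
have mcert : measurable_fun setT cert.
  apply: (measurableT_comp (f := certificate B N0)); first exact: measurable_certificate.
  exact: measurable_fun_pair.
have cert0 w : 0 <= cert w by exact: certificate_ge0.
have mmin : measurable_fun setT (fun w => Num.min (cert w) 1) by exact: measurable_minr.
have db0 : 0 <= design_bound.
  by rewrite /design_bound !mulr_ge0 ?expR_ge0// exprn_ge0// ltW// (lt_trans ltr01) ?net_rate_gt1.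
have gb0 : 0 <= grid_bound N0 by rewrite mulr_ge0 ?expR_ge0.
have sb0 : 0 <= n%:R * (16 * p%:R) / B by rewrite divr_ge0 ?(ltW B0)// !mulr_ge0.
have [zN|NN] := ltP (zero_count z0) N0.
  apply: (@le_trans _ _ (\int[P]_w (cst 1%E w)))%E.
    apply: ge0_le_integral => //.
    - by move=> w _; rewrite lee_fin le_min cert0 ler01.
    - exact/measurable_EFinP.
    - by move=> w _; rewrite lee_fin ge_min lexx orbT.
  rewrite integral_cst//= probability_setT mule1 lee_fin.
  have : expR 0 <= expR (N0 - zero_count z0) by rewrite ler_expR subr_ge0 ltW.
  rewrite expR0; lra.
have mdef : measurable_fun setT (fun w => design_defect (row_matrix x w)).
  apply: (measurableT_comp (f := fun M : mxspace R n d => design_defect M)).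
    exact: measurable_design_defect.
  exact: measurable_row_matrix.
have mgrid : measurable_fun setT (fun w => grid_defect (X w) z0).
  under eq_fun do rewrite /grid_defect -big_filter.
  apply: measurable_sum => f; apply: measurableT_comp => //; apply: measurable_funB => //.
  apply: measurable_sum => j; apply: measurable_funM => //; apply: measurableT_comp => //.
  by apply: measurable_sum => i; apply: measurable_funM => //; exact: random_feature_matrix.
have msign : measurable_fun setT (fun w => sign_energy (X w) z0).
  apply: measurable_sum => i; apply: measurable_funX; apply: measurable_sum => j.
  by apply: measurable_funM => //; exact: random_feature_matrix.
have dd0 w : 0 <= design_defect (row_matrix x w).
  by rewrite /design_defect !addr_ge0//; apply: sumr_ge0 => *; exact: expR_ge0.
pose g1 w := if design_defect (row_matrix x w) < 1 then grid_defect (X w) z0 else 0.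
have g10 w : 0 <= g1 w by rewrite /g1; case: (_ < 1) => //; exact: grid_defect_ge0.
have mg1 : measurable_fun setT g1.
  by apply: measurable_fun_ifT => //; exact: measurable_fun_ltr.
have s0 w : 0 <= sign_energy (X w) z0 / B by rewrite divr_ge0 ?sign_energy_ge0 ?ltW.
have ms : measurable_fun setT (fun w => sign_energy (X w) z0 / B) by exact: measurable_funM.
apply: (@le_trans _ _ (\int[P]_w (design_defect (row_matrix x w) + g1 w +
    sign_energy (X w) z0 / B + expR (N0 - zero_count z0))%:E))%E.
  apply: ge0_le_integral => //.
  - by move=> w _; rewrite lee_fin le_min cert0 ler01.
  - exact/measurable_EFinP.
  - apply/measurable_EFinP; apply: measurable_funD => //; apply: measurable_funD => //.
    exact: measurable_funD.
  - move=> w _; rewrite lee_fin /g1; have [lt1|ge1] := ltP (design_defect _) 1.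
      rewrite ge_min; apply/orP; left; rewrite /cert /certificate/=.
      by have := dd0 w; lra.
    rewrite ge_min; apply/orP; right; have := s0 w; have := expR_ge0 (N0 - zero_count z0); lra.
apply: ge0_integral_leD => //.
- by move=> w; apply: addr_ge0 => //; exact: addr_ge0.
- by apply: measurable_funD => //; exact: measurable_funD.
- apply: ge0_integral_leD => //.
  + by move=> w; exact: addr_ge0.
  + exact: measurable_funD.
  + apply: ge0_integral_leD => //; last exact: grid_defect_expectation.
    apply: expectation_design_defect => //; exact: rows_independent xWI.
  + under eq_integral do rewrite mulrC EFinM.
    rewrite ge0_integralZl//; last 3 first.
    * exact/measurable_EFinP.
    * by move=> w _; rewrite lee_fin sign_energy_ge0.
    * by rewrite lee_fin invr_ge0 ltW.
    rewrite mulrC EFinM; apply: lee_wpmul2l; first by rewrite lee_fin invr_ge0 ltW.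
    exact: sign_energy_expectation.
- by rewrite integral_cst//= probability_setT mule1.
Qed.


Context (thetahat z : T -> 'cV[R]_p) (eps : R) (Q : 'I_p -> probability R R).
Hypotheses (e01 : 0 <= eps < 1)
  (zQ : forall j, has_law P (fun w => z w j 0) (contamination eps (Q j)))
  (zI : mutually_independent P (fun j : 'I_p => sigma_rv (fun w => z w j 0)))
  (zXI : independent2 P (sigma_mx z) (sigma_join (sigma_mx X) (sigma_mx thetahat))).

Let mz : measurable_fun setT (z : T -> mxspace R p 1).
Proof. by apply: measurable_mxspace => i j; rewrite (ord1 j); case: (zQ i). Qed.

Definition failure_bound (B N0 : R) : R :=
  design_bound + grid_bound N0 + n%:R * (16 * p%:R) / B +
  expR (N0 - (1 - eps) * p%:R / 2).

(** The noise is frozen while the features are integrated; afterwards only its number of zeros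
    remains, through a Laplace transform. *)
Lemma certificate_expectation (B N0 : R) : 0 < B ->
  (\int[P]_w (Num.min (certificate B N0 (z w, X w)) 1)%:E <= (failure_bound B N0)%:E)%E.
Proof.
move=> B0.
pose H (s : mxspace R p 1 * mxspace R n p) : \bar R := (Num.min (certificate B N0 s) 1)%:E.
set C := design_bound + grid_bound N0 + n%:R * (16 * p%:R) / B.
have C0 : 0 <= C.
  apply: addr_ge0; last by rewrite divr_ge0 ?(ltW B0)// !mulr_ge0.
  apply: addr_ge0; last by rewrite mulr_ge0 ?expR_ge0.
  by rewrite /design_bound !mulr_ge0 ?expR_ge0// exprn_ge0// ltW// (lt_trans ltr01) ?net_rate_gt1.
have mcount : measurable_fun setT (fun w => zero_count (z w)).
  apply: measurable_sum => j; apply: (measurableT_comp measurable_zero_ind).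
  by case: (zQ j).
apply: (@le_trans _ _ (\int[P]_w (C + expR (N0 - zero_count (z w)))%:E)%E).
  apply: (ge0_integral_independent_le (A := z : T -> mxspace R p 1) (B := X : T -> mxspace R n p) (H := H)) => //.
  - move=> E1 E2 mE1 mE2; apply: zXI; first exact: sigma_mx_preimage.
    by apply: sub_sigma_algebra; left; exact: sigma_mx_preimage.
  - apply/measurable_EFinP; apply: measurable_minr => //; exact: measurable_certificate.
  - by move=> s; rewrite lee_fin le_min certificate_ge0//=.
  - apply/measurable_EFinP; apply: measurable_funD => //; apply: measurableT_comp => //.
    exact: measurable_funB.
  - by move=> w; exact: certificate_conditional.
apply: ge0_integral_leD => //.
- by apply: measurableT_comp => //; exact: measurable_funB.
- by rewrite integral_cst//= probability_setT mule1.
under eq_integral do rewrite expRD EFinM.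
rewrite ge0_integralZl//; last by apply/measurable_EFinP; do 2 apply: measurableT_comp => //.
rewrite expRD EFinM; apply: lee_wpmul2l; first by rewrite lee_fin expR_ge0.
exact: zero_count_laplace.
Qed.

Definition certified (B N0 : R) : set T := [set w | certificate B N0 (z w, X w) < 1].

Lemma measurable_certified B N0 : measurable (certified B N0).
Proof.
rewrite -[X in measurable X]setTI; apply: measurable_fun_ltr => //.
apply: (measurableT_comp (f := certificate B N0)); first exact: measurable_certificate.
exact: measurable_fun_pair.
Qed.

Lemma probability_certified (B N0 : R) : 0 < B ->
  ((1 - failure_bound B N0)%:E <= P (certified B N0))%E.
Proof.
move=> B0; have mA := measurable_certified B N0.
have mcert : measurable_fun setT (fun w => certificate B N0 (z w, X w)).
  apply: (measurableT_comp (f := certificate B N0)); first exact: measurable_certificate.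
  exact: measurable_fun_pair.
(* Markov: off the event the truncated certificate equals 1. *)
have : (P (~` certified B N0) <= (failure_bound B N0)%:E)%E.
  apply: le_trans (certificate_expectation N0 B0).
  rewrite -[X in P X]setIT -integral_indic//; last exact: measurableC.
  apply: ge0_le_integral => //.
  - by apply/measurable_EFinP; apply: measurable_indic; exact: measurableC.
  - by apply/measurable_EFinP; apply: measurable_minr.
  - move=> w _; rewrite lee_fin indicE; case wA : (w \in _); last by rewrite le_min certificate_ge0/=.
    by rewrite le_min lexx andbT leNgt; apply/negP; exact: (set_mem wA).
rewrite probability_setC// => H.
by rewrite EFinB leeBlDr// addeC -leeBlDr//; exact: fin_num_measure.
Qed.

End assembly.

(** * Choice of the constants *)

Section scales.
Context {R : realType}.

(** [n^2 <= p] gives [log(e p / n) >= 1 + log n], and [n <= p] gives [n <= sqrt(n p)]. Both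
    quantities are thus at most [sqrt(n p) log(e p / n)], which the sparsity hypothesis bounds. *)
Lemma sparsity_scale (n p : nat) (a c : R) : (0 < n)%N -> (n <= p)%N -> 0 < a -> c <= 1 ->
  Num.sqrt (n%:R / p%:R) * ln (expR 1 * p%:R / n%:R) / a <= c ->
  n%:R ^+ 2 / p%:R <= c ->
  Num.sqrt (n%:R * p%:R) <= c * (a * p%:R) /\ n%:R * (1 + ln n%:R) <= c * (a * p%:R).
Proof.
move=> n0 np a0 c1 Hr Hn.
have nR : (0 : R) < n%:R by rewrite ltr0n.
have pR : (0 : R) < p%:R by rewrite ltr0n (leq_trans n0).
have npR : (n%:R : R) <= p%:R by rewrite ler_nat.
have n1 : (1 : R) <= n%:R by rewrite ler1n.
have c0 : 0 < c by apply: lt_le_trans Hn; rewrite divr_gt0// exprn_gt0.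
have n2p : (n%:R : R) ^+ 2 <= p%:R.
  move: Hn; rewrite ler_pdivrMr// => /le_trans; apply.
  by rewrite ler_piMl// ltW.
have lnn : 0 <= ln (n%:R : R) by rewrite ln_ge0.
have L1 : 1 + ln n%:R <= ln (expR 1 * p%:R / n%:R) :> R.
  rewrite -mulrA lnM ?posrE ?expR_gt0 ?divr_gt0// expRK lerD2l ler_ln ?posrE ?divr_gt0//.
  by rewrite ler_pdivlMr// -expr2.
have spE : Num.sqrt (n%:R * p%:R) = Num.sqrt (n%:R / p%:R) * p%:R :> R.
  have -> : n%:R * p%:R = n%:R / p%:R * p%:R ^+ 2 :> R by field; rewrite gt_eqF.
  by rewrite sqrtrM ?divr_ge0 ?(ltW nR) ?(ltW pR)// sqrtr_sqr ger0_norm// ltW.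
have nS : n%:R <= Num.sqrt (n%:R * p%:R) :> R.
  rewrite -[leLHS]ger0_norm ?(ltW nR)// -sqrtr_sqr ler_sqrt ?mulr_gt0//.
  by rewrite expr2 ler_pM2l.
have SL : Num.sqrt (n%:R * p%:R) * ln (expR 1 * p%:R / n%:R) <= c * (a * p%:R).
  move: Hr; rewrite ler_pdivrMr// => Hr.
  by rewrite spE mulrAC mulrA ler_pM2r.
have S0 : 0 <= Num.sqrt (n%:R * p%:R) :> R by exact: sqrtr_ge0.
split; apply: le_trans SL.
  by rewrite ler_peMr//; apply: le_trans L1; rewrite lerDl.
by apply: ler_pM => //; exact: addr_ge0.
Qed.

(** Each term of [failure_bound] receives [delta / 4]. In [k], the summands [k1], [k2] and [4 * l]
    serve the grid, the design and the count of zeros, and [t] serves the inequality for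
    [sqrt B]. *)
Lemma failure_bound_small (delta : R) : 0 < delta < 1 -> exists2 c : R, 0 < c &
  forall (n p d : nat) (eps : R), (0 < n)%N -> (0 < d)%N -> (n <= p)%N -> 0 <= eps < 1 ->
  Num.sqrt (n%:R / p%:R) * ln (expR 1 * p%:R / n%:R) / (1 - eps) <= c ->
  n%:R ^+ 2 / p%:R <= c -> n%:R / d%:R <= c ->
  exists B, exists N0, [/\ 0 < B, Num.sqrt B <= threshold / 2 * N0 &
    failure_bound n p d eps B N0 <= delta].
Proof.
move=> /andP[D0 D1].
pose l : R := ln (4 / delta).
pose g : R := ln (4 * (@grid_size R)%:R); pose K := 1 + g.
pose M : R := ln 3 + ln net_rate.
pose t : R := 64 / (Num.sqrt delta * threshold).
have [r1 [r2 th]] := (@rate1_gt0 R, (@rate2_gt0 R, @threshold_gt0 R)).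
have sd : 0 < Num.sqrt delta by rewrite sqrtr_gt0.
have l0 : 0 <= l by rewrite ln_ge0// ler_pdivlMr// mul1r; lra.
have el : expR (- l) = delta / 4.
  by rewrite expRN lnK ?posrE ?divr_gt0// invf_div.
have G2 : (2 : R) <= (@grid_size R)%:R by rewrite ler_nat.
have g0 : 0 <= g by rewrite ln_ge0//; lra.
have K1 : 1 <= K by rewrite lerDl.
have M0 : 0 <= M by rewrite addr_ge0// ln_ge0// ?ler1n// ltW// net_rate_gt1.
have t0 : 0 <= t by rewrite divr_ge0// mulr_ge0// ltW.
pose k1 := 8 / rate2 * (K + l); pose k2 := 2 / rate1 * (M + l).
have k10 : 0 <= k1 by apply: mulr_ge0; [exact: divr_ge0 (ltW r2)|lra].
have k20 : 0 <= k2 by apply: mulr_ge0; [exact: divr_ge0 (ltW r1)|lra].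
pose k := 1 + k1 + k2 + 4 * l + t.
have k1' : 1 <= k by rewrite /k; lra.
have k0 : 0 < k by lra.
exists k^-1; first by rewrite invr_gt0.
move=> n p d eps n0 d0 np /andP[e0 e1] H1 H2 H3.
have a0 : 0 < 1 - eps by lra.
have kc : k^-1 <= 1 by rewrite invf_le1.
have [S1 S2] := sparsity_scale n0 np a0 kc H1 H2.
have nR : (0 : R) < n%:R by rewrite ltr0n.
have n1 : (1 : R) <= n%:R by rewrite ler1n.
have dR : (0 : R) < d%:R by rewrite ltr0n.
have pR : (0 : R) < p%:R by rewrite ltr0n (leq_trans n0).
have lnn : 0 <= ln (n%:R : R) by rewrite ln_ge0.
set s := (1 - eps) * p%:R in S1 S2.
pose m : R := n%:R * (1 + ln n%:R).
have m1 : 1 <= m by rewrite /m -[leLHS]mulr1; apply: ler_pM => //; rewrite lerDl.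
have ks : k * m <= s by rewrite -ler_pdivlMl.
have kr : k * Num.sqrt (n%:R * p%:R) <= s by rewrite -ler_pdivlMl.
have kd : k * n%:R <= d%:R.
  by move: H3; rewrite ler_pdivrMr// -ler_pdivlMl ?invr_gt0// invrK.
(* This [B] makes the sign term exactly [delta / 4]. The zeros have Laplace exponent [s / 2], so
   [N0 = s / 4] leaves [exp(- s / 4)]. *)
exists (64 * n%:R * p%:R / delta), (s / 4); split.
- by rewrite divr_gt0// !mulr_gt0.
- rewrite (_ : 64 * n%:R * p%:R / delta = (8 / Num.sqrt delta) ^+ 2 * (n%:R * p%:R)); last first.
    by rewrite expr_div_n sqr_sqrtr ?(ltW D0)//; field; rewrite gt_eqF.
  rewrite sqrtrM ?sqr_ge0// sqrtr_sqr ger0_norm; last by rewrite divr_ge0// ltW.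
  have tk : 64 / Num.sqrt delta <= threshold * k.
    rewrite (_ : 64 / Num.sqrt delta = threshold * t); last by rewrite /t; field; rewrite !gt_eqF.
    by rewrite ler_pM2l// /k; lra.
  apply: (@le_trans _ _ (threshold / 8 * (k * Num.sqrt (n%:R * p%:R)))).
    rewrite mulrA; apply: ler_wpM2r; first exact: sqrtr_ge0.
    lra.
  rewrite (_ : threshold / 2 * (s / 4) = threshold / 8 * s); last lra.
  by rewrite ler_pM2l// divr_gt0.
rewrite /failure_bound -/s.
rewrite [leRHS](_ : delta = delta / 4 + delta / 4 + delta / 4 + delta / 4); last lra.
have km : k <= k * m by rewrite ler_peMr// ltW.
have kn : k <= k * n%:R by rewrite ler_peMr// ltW.
apply: lerD; last first.
  rewrite -el ler_expR; rewrite /k in ks km; lra.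
apply: lerD; last first.
  rewrite le_eqVlt; apply/orP; left; apply/eqP; field; by rewrite !gt_eqF.
apply: lerD.
  rewrite /design_bound -el.
  have r0 : 0 < @net_rate R by apply: lt_trans (@net_rate_gt1 R).
  rewrite -[X in X * (_ * _)](@lnK _ 3) ?posrE// -[X in X ^+ _]lnK ?posrE// -expRM_natl -!expRD ler_expR.
  have H : (M + l) * n%:R <= rate1 / 2 * d%:R.
    apply: (@le_trans _ _ (rate1 / 2 * (k * n%:R))); last by rewrite ler_pM2l// divr_gt0.
    rewrite mulrA ler_pM2r// (_ : M + l = rate1 / 2 * k2).
      by rewrite ler_pM2l ?divr_gt0// /k; lra.
    by rewrite /k2; field; rewrite gt_eqF.
  have l3 : 0 <= ln (3 : R) by rewrite ln_ge0// ler1n.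
  have H' : (ln 3 + l) * 1 <= (ln 3 + l) * n%:R by apply: ler_wpM2l => //; exact: addr_ge0.
  by rewrite /M in H; lra.
rewrite /grid_bound -el natrX.
have G0 : (0 : R) < (@grid_size R)%:R by rewrite ltr0n.
apply: (@le_trans _ _ ((4 * (@grid_size R)%:R * n%:R) ^+ n * expR (- (rate2 / 2 * (s / 4))))).
  rewrite ler_wpM2r ?expR_ge0//; apply: lerXn2r; rewrite ?nnegrE ?mulr_ge0//.
  rewrite natrM -[(_ * n).+1]addn1 natrD natrM.
  have : (1 : R) <= (@grid_size R)%:R * n%:R by rewrite -natrM ler1n muln_gt0 n0.
  lra.
rewrite -[X in X ^+ _]lnK ?posrE ?mulr_gt0// -expRM_natl -expRD ler_expR lnM ?posrE ?mulr_gt0// -/g.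
have H : (K + l) * m <= rate2 / 8 * s.
  apply: (@le_trans _ _ (rate2 / 8 * (k * m))); last by rewrite ler_pM2l// divr_gt0.
  rewrite [leRHS]mulrA ler_pM2r ?(lt_le_trans ltr01 m1)// (_ : K + l = rate2 / 8 * k1).
    rewrite ler_pM2l; last exact: divr_gt0.
    by rewrite /k; lra.
  by rewrite /k1; field; rewrite gt_eqF.
(* The slack in [n * (g + ln n) + l <= (K + l) * m] is [n] plus the products in [Q1] and [Q2]. *)
have Q1 : 0 <= (g + l) * (n%:R * ln n%:R) by rewrite !mulr_ge0// addr_ge0.
have Q2 : 0 <= l * (n%:R - 1) by rewrite mulr_ge0// subr_ge0.
by rewrite /K /m in H; lra.
Qed.

End scales.

Theorem corollary4p2 (R : realType) (delta : R) (hdelta : 0 < delta < 1) :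
  exists2 c : R, 0 < c &
  forall (n p d : nat) (disp : measure_display) (T : measurableType disp)
    (P : probability T R)
    (x : 'I_n -> T -> 'cV[R]_d) (W : 'I_p -> T -> 'cV[R]_d)
    (thetahat z : T -> 'cV[R]_p)
    (eps : R) (Q : 'I_p -> probability R R)
    (utilde : T -> 'cV[R]_n),
  let X := feature_matrix tanh x W in
  let eta := fun w => thetahat w + z w in
  let thetatilde := fun w => (X w)^T *m utilde w in
  (0 < n)%N -> (0 < d)%N -> (n <= p)%N ->
  (forall i, isotropic_gaussian P 1 (x i)) ->
  (forall j, isotropic_gaussian P (d%:R^-1) (W j)) ->
  mutually_independent P (fun k : 'I_n + 'I_p =>
    match k with inl i => sigma_mx (x i) | inr j => sigma_mx (W j) end) ->
  random_matrix thetahat ->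
  (forall w, ((thetahat w)^T <= X w)%MS) ->
  0 <= eps < 1 ->
  (forall j, has_law P (fun w => z w j 0) (contamination eps (Q j))) ->
  mutually_independent P (fun j : 'I_p => sigma_rv (fun w => z w j 0)) ->
  independent2 P (sigma_mx z) (sigma_join (sigma_mx X) (sigma_mx thetahat)) ->
  (forall w, argmin (fun u => l1norm (eta w - (X w)^T *m u)) (utilde w)) ->
  Num.sqrt (n%:R / p%:R) * ln (expR 1 * p%:R / n%:R) / (1 - eps) <= c ->
  n%:R ^+ 2 / p%:R <= c ->
  n%:R / d%:R <= c ->
  prob_at_least P (1 - delta) [set w | thetatilde w = thetahat w].
Proof.
have [c c0 Hc] := failure_bound_small hdelta.
exists c => // n p d disp T P x W thetahat z eps Q utilde X eta thetatilde n0 d0 np.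
move=> xG WG xWI _ rowspace e01 zQ zI zXI umin H1 H2 H3.
have [B [N0 [B0 BN fb]]] := Hc _ _ _ _ n0 d0 np e01 H1 H2 H3.
have p0 : (0 < p)%N := leq_trans n0 np.
(* The event involves [z] and [X] only, so it serves every choice of the minimizer. *)
exists (certified x W z B N0); split.
- exact: (measurable_certified xG WG zQ).
- move=> w /= cert.
  have [D DE] := submxP (rowspace w).
  have thE : thetahat w = (X w)^T *m D^T by rewrite -trmx_mul -DE trmxK.
  have : utilde w - D^T = 0.
    apply: (l1_minimizer_unique n0 _ B0 BN cert) => [i j|].
      by rewrite mxE tanh_le1.
    have -> : z w - (X w)^T *m (utilde w - D^T) = eta w - (X w)^T *m utilde w.
      by rewrite mulmxBr -thE opprB addrA [z w + _]addrC.
    have zE : z w = eta w - (X w)^T *m D^T by rewrite -thE /eta addrAC subrr add0r.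
    by rewrite [in leRHS]zE; exact: umin.
  by move/eqP; rewrite subr_eq0 /thetatilde thE => /eqP ->.
- apply: le_trans (probability_certified n0 d0 p0 xG WG xWI e01 zQ zI zXI N0 B0).
  by rewrite lee_fin; lra.
Qed.
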